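(* Let $\Omega\subset\mathbb{R}^n$ be a bounded, connected, open set, let $1<p<\infty$, let $v$ be a non-negative measurable function on $\Omega$, and let $Q$ be a symmetric, positive semidefinite, measurable $n\times n$ matrix function on $\Omega$ with $|Q|_{\mathrm{op}}\in L^{p/2}_{\mathrm{loc}}(\Omega)$. Then the pair $(v,Q)$ has the $p$-Dirichlet property on $\Omega$ if and only if it has the $p$-Sobolev property on $\Omega$. Furthermore, in this case solutions of the Dirichlet problem are unique: for all admissible $F,\mathbf{t},f,g$, if $(u_1,\nabla u_1)$ and $(u_2,\nabla u_2)$ in $QH^{1,p}_0(v,\Omega)$ are both degenerate weak solutions of the Dirichlet problem with data $F,\mathbf{t},f,g$, then $(u_1,\nabla u_1)=(u_2,\nabla u_2)$ in $QH^{1,p}_0(v,\Omega)$.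
   Context: Here $|Q(x)|_{\mathrm{op}}=\sup_{|\xi|=1}|Q(x)\xi|$. The weight $v$ is not assumed to be locally integrable. Spaces. $L^p(v,\Omega)$ is the space of measurable functions $f$ with $\|f\|_{L^p(v,\Omega)}=(\int_\Omega |f|^p\,v\,dx)^{1/p}<\infty$ (functions equal $v\,dx$-a.e. identified); $L^\infty(v,\Omega)$ is the space of functions essentially bounded with respect to $v\,dx$. $QL^p(\Omega)$ is the space of measurable $\mathbf{f}:\Omega\to\mathbb{R}^n$ with $\|\mathbf{f}\|_{QL^p(\Omega)}=(\int_\Omega|\sqrt{Q}\,\mathbf{f}|^p\,dx)^{1/p}<\infty$ (with $\mathbf f,\mathbf g$ identified when $\sqrt Q\mathbf f=\sqrt Q\mathbf g$ a.e.). Both are separable reflexive Banach spaces. $\mathrm{Lip}_{\mathrm{loc}}(\Omega)$ is the set of functions that are Lipschitz on compact subsets of $\Omega$; $\mathrm{Lip}_0(\Omega)$ is the set of those with compact support in $\Omega$. $Q\mathrm{Lip}(v,\Omega)$ is the set of $\varphi\in\mathrm{Lip}_{\mathrm{loc}}(\Omega)$ with $\|\varphi\|_{QH^{1,p}(v,\Omega)}=\|\varphi\|_{L^p(v,\Omega)}+\|\nabla\varphi\|_{QL^p(\Omega)}<\infty$, and $Q\mathrm{Lip}_0(v,\Omega)=\mathrm{Lip}_0(\Omega)\cap Q\mathrm{Lip}(v,\Omega)$. $QH^{1,p}(v,\Omega)$ (resp. $QH^{1,p}_0(v,\Omega)$) is the closure of $\{(\varphi,\nabla\varphi)\}$, $\varphi\in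 Q\mathrm{Lip}(v,\Omega)$ (resp. $\varphi\in Q\mathrm{Lip}_0(v,\Omega)$), in $L^p(v,\Omega)\oplus QL^p(\Omega)$; its elements are written as pairs $(u,\nabla u)$, where $\nabla u$ denotes the second component (it need not be a distributional gradient nor be determined by $u$). $p$-Sobolev property: there is a constant $S(p,1)>0$ such that for all $\varphi\in Q\mathrm{Lip}_0(v,\Omega)$, $\left(\int_\Omega|\varphi|^p\,v\,dx\right)^{1/p}\le S(p,1)\left(\int_\Omega|\sqrt{Q}\nabla\varphi|^p\,dx\right)^{1/p}$. Admissible data: $f,g\in L^p(v,\Omega)$; $F\in L^\infty(v,\Omega)$ non-negative; and $\mathbf{t}:\Omega\to\mathbb{R}^n$ a (measurable) degenerate subunit vector field, i.e. there is a constant $C(\mathbf{t})$ with $\|\mathbf{t}\cdot\nabla\varphi\|_{L^p(v,\Omega)}\le C(\mathbf{t})\|\nabla\varphi\|_{QL^p(\Omega)}$ for all $\varphi\in Q\mathrm{Lip}_0(v,\Omega)$. Dirichlet problem: $-v^{-1}\mathrm{div}(|\sqrt{Q}\nabla u|^{p-2}Q\nabla u)+F|u|^{p-2}u=|f|^{p-2}f-v^{-1}\mathrm{div}(v|g|^{p-2}g\,\mathbf{t})$ in $\Omega$, $u=0$ on $\partial\Omega$. A pair $(u,\nabla u)\in QH^{1,p}_0(v,\Omega)$ is a degenerate weak solution if for all $\varphi\in Q\mathrm{Lip}_0(v,\Omega)$, $$\int_\Omega|\sqrt{Q}\nabla u|^{p-2}Q\nabla u\cdot\nabla\varphi\,dx+\int_\Omega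 F|u|^{p-2}u\,\varphi\,v\,dx=\int_\Omega|f|^{p-2}f\varphi\,v\,dx+\int_\Omega|g|^{p-2}g\,\mathbf{t}\cdot\nabla\varphi\,v\,dx .$$ (Expressions $|a|^{p-2}a$ are read as $0$ when $a=0$.) $p$-Dirichlet property: for all admissible $F,\mathbf{t},f,g$ there exists a degenerate weak solution $(u,\nabla u)\in QH^{1,p}_0(v,\Omega)$ of the Dirichlet problem; moreover, any degenerate weak solution $(u,\nabla u)\in QH^{1,p}_0(v,\Omega)$ is regular, that is, there is a positive constant $c_0$ such that $\|u\|_{L^p(v,\Omega)}\le c_0\left[\|f\|_{L^p(v,\Omega)}+\|g\|_{L^p(v,\Omega)}\right]$, where $c_0$ does not depend on $f$, $g$ or $(u,\nabla u)$ (it may depend on $p,v,Q,\Omega,F,\mathbf{t}$). *)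

(* Defs.v *)
From HB Require Import structures.
From mathcomp Require Import all_boot all_order all_algebra.
From mathcomp Require Import all_classical all_reals all_analysis.

Set Implicit Arguments.
Unset Strict Implicit.
Unset Printing Implicit Defensive.

Import Order.TTheory GRing.Theory Num.Theory.
Import numFieldNormedType.Exports.

Local Open Scope classical_set_scope.
Local Open Scope ring_scope.

(** * Lebesgue measure on R^n

    R^n is ['rV[R]_n], with the topology and the (sup) norm of the library.
    Its Lebesgue measure is obtained in two steps.  [borel_lebesgue n] is the
    [n]-fold product of the one-dimensional Lebesgue measure, written as an
    iterated integral; it is only meaningful on Borel sets.  [leb] is the
    Caratheodory completion of that product, so that the measurable sets of
    [lebT R n] are all the Lebesgue measurable subsets of R^n. *)

Section lebesgue_rV.
Context {R : realType}.

Fixpoint borel_lebesgue (n : nat) : set 'rV[R]_n -> \bar R :=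
  match n return set 'rV[R]_n -> \bar R with
  | 0 => fun A => (\1_A (0 : 'rV[R]_0))%:E
  | m.+1 => fun A => (\int[lebesgue_measure]_t
      borel_lebesgue [set y : 'rV[R]_m |
        A (row_mx (t%:M : 'rV[R]_1) y : 'rV[R]_(1 + m))])%E
  end.

Lemma borel_lebesgue_ge0 n (A : set 'rV[R]_n) : (0 <= borel_lebesgue A)%E.
Proof.
elim: n A => [|n IH] A /=; first by rewrite lee_fin.
by apply: integral_ge0 => t _; exact: IH.
Qed.

Lemma borel_lebesgue0 n : @borel_lebesgue n set0 = 0%E.
Proof.
elim: n => [|n IH] /=; first by rewrite indicE in_set0.
by under eq_integral do rewrite (_ : [set _ | _] = set0) ?IH//; rewrite integral0.
Qed.

Definition leb_outer (n : nat) : set 'rV[R]_n -> \bar R :=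
  mu_ext (@borel_lebesgue n :
    set (g_sigma_algebraType (@open 'rV[R]_n)) -> \bar R).

Section leb_outer_instance.
Variable n : nat.
Let lam : set (g_sigma_algebraType (@open 'rV[R]_n)) -> \bar R :=
  @borel_lebesgue n.
Let lam0 : lam set0 = 0%E := borel_lebesgue0 n.
Let lam_ge0 (A : set (g_sigma_algebraType (@open 'rV[R]_n))) : (0 <= lam A)%E :=
  borel_lebesgue_ge0 A.

HB.instance Definition _ := isOuterMeasure.Build R 'rV[R]_n (@leb_outer n)
  (mu_ext0 lam0 lam_ge0) (mu_ext_ge0 lam_ge0) (@le_mu_ext _ _ _ lam)
  (mu_ext_sigma_subadditive lam_ge0).
End leb_outer_instance.

End lebesgue_rV.

Notation lebT R n := (caratheodory_type (@leb_outer R n)).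

Definition leb (R : realType) (n : nat) : set (lebT R n) -> \bar R :=
  @leb_outer R n.
HB.instance Definition _ (R : realType) (n : nat) :=
  isMeasure.Build _ _ _ (@leb R n)
    (caratheodory_measure0 (@leb_outer R n))
    (caratheodory_measure_ge0 (mu := @leb_outer R n))
    (@caratheodory_measure_sigma_additive _ _ (@leb_outer R n)).

(** * Euclidean structure and matrices

    Vectors are rows, so the vector [A xi] is the row [xi *m A^T]. *)

Section euclidean.
Context {R : realType} {n : nat}.
Implicit Types (x y : 'rV[R]_n) (A : 'M[R]_n).

Definition dot x y : R := \sum_(i < n) x 0 i * y 0 i.

Definition enorm x : R := Num.sqrt (dot x x).

Definition mulmxv A x : 'rV[R]_n := x *m A^T.

Definition psdmx A : Prop := A^T = A /\ forall x, 0 <= dot (mulmxv A x) x.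

(* The default value is never used: every [A] with [psdmx A] has exactly one
   such square root. *)
Definition sqrtmx A : 'M[R]_n := xget 0 [set B | psdmx B /\ B *m B = A].

Definition opnorm A : R := sup [set enorm (mulmxv A x) | x in [set x | enorm x = 1]].

(* The partial derivatives of a locally Lipschitz function exist almost
   everywhere; the library gives them a default value elsewhere. *)
Definition grad (phi : 'rV[R]_n -> R) (x : 'rV[R]_n) : 'rV[R]_n :=
  \row_(i < n) 'D_(delta_mx 0 i : 'rV[R]_n) phi x.

End euclidean.

(** * Function spaces

    Functions on [Omega] are total functions on R^n of which only the
    restriction to [Omega] matters; elements of the spaces are represented by
    functions, and their equality is the appropriate equality a.e. *)

Section spaces.
Context {R : realType} {n : nat}.
Variables (p : R) (v : 'rV[R]_n -> R) (Q : 'rV[R]_n -> 'M[R]_n)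
  (Omega : set 'rV[R]_n).
Implicit Types (f g u F phi : 'rV[R]_n -> R) (U t : 'rV[R]_n -> 'rV[R]_n).

Definition measurable_on (f : 'rV[R]_n -> R) : Prop :=
  measurable_fun (Omega : set (lebT R n)) (f : lebT R n -> R).

Definition vmeasurable_on (U : 'rV[R]_n -> 'rV[R]_n) : Prop :=
  forall i, measurable_on (fun x => U x 0 i).

(* the measure v dx on Omega *)
Definition vdx : set (lebT R n) -> \bar R :=
  fun A => (\int[@leb R n]_(x in A `&` (Omega : set (lebT R n))) (v x)%:E)%E.

Definition Lpnorm f : \bar R :=
  ((\int[@leb R n]_(x in Omega) (`|f x| `^ p * v x)%:E) `^ p^-1)%E.

Definition QLpnorm U : \bar R :=
  ((\int[@leb R n]_(x in Omega) (enorm (mulmxv (sqrtmx (Q x)) (U x)) `^ p)%:E)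
     `^ p^-1)%E.

Definition Lp f : Prop := measurable_on f /\ (Lpnorm f < +oo)%E.

Definition Linfty f : Prop :=
  measurable_on f /\ exists M : R, {ae vdx, forall x, Omega x -> `|f x| <= M}.

Definition QLp U : Prop := vmeasurable_on U /\ (QLpnorm U < +oo)%E.

Definition Lip_loc phi : Prop :=
  forall K : set 'rV[R]_n, compact K -> K `<=` Omega ->
    [lipschitz phi x | x in K].

Definition Lip0 phi : Prop :=
  let supp := closure (Omega `&` [set x | phi x != 0]) in
  [/\ Lip_loc phi, compact supp & supp `<=` Omega].

Definition QLip phi : Prop :=
  Lip_loc phi /\ (Lpnorm phi + QLpnorm (grad phi) < +oo)%E.

Definition QLip0 phi : Prop := Lip0 phi /\ QLip phi.

(* [QH0 u U]: the pair (u, U) lies in the closure of the pairs (phi, grad phi),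
   phi in QLip0, in the direct sum of Lp and QLp *)
Definition QH0 u U : Prop :=
  [/\ Lp u, QLp U &
    forall e : R, 0 < e -> exists2 phi, QLip0 phi &
      (Lpnorm (u \- phi)%R + QLpnorm (U \- grad phi)%R < e%:E)%E].

Definition QH0_eq u1 U1 u2 U2 : Prop :=
  {ae vdx, forall x, Omega x -> u1 x = u2 x} /\
  {ae @leb R n, forall x, Omega x ->
    mulmxv (sqrtmx (Q x)) (U1 x) = mulmxv (sqrtmx (Q x)) (U2 x)}.

Definition p_Sobolev : Prop :=
  exists S : R, 0 < S /\ forall phi, QLip0 phi ->
    (Lpnorm phi <= S%:E * QLpnorm (grad phi))%E.

Definition subunit t : Prop :=
  vmeasurable_on t /\ exists C : R, forall phi, QLip0 phi ->
    (Lpnorm (fun x => dot (t x) (grad phi x)) <= C%:E * QLpnorm (grad phi))%E.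

Definition admissible_coef F t : Prop :=
  [/\ Linfty F, {ae vdx, forall x, Omega x -> 0 <= F x} & subunit t].

Definition admissible F t f g : Prop :=
  [/\ admissible_coef F t, Lp f & Lp g].

(* The value at [a = 0] is 0 for every [p], because of the second factor; the
   same holds for the vector term of [weak_solution], as [sqrtmx Q U = 0] implies
   [Q U = 0]. *)
Definition signed_pow (a : R) : R := `|a| `^ (p - 2) * a.

Definition weak_solution F t f g u U : Prop :=
  QH0 u U /\
  forall phi, QLip0 phi ->
    \int[@leb R n]_(x in Omega)
       (enorm (mulmxv (sqrtmx (Q x)) (U x)) `^ (p - 2)
          * dot (mulmxv (Q x) (U x)) (grad phi x))
    + \int[@leb R n]_(x in Omega) (F x * signed_pow (u x) * phi x * v x)
    = \int[@leb R n]_(x in Omega) (signed_pow (f x) * phi x * v x)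
    + \int[@leb R n]_(x in Omega)
        (signed_pow (g x) * dot (t x) (grad phi x) * v x).

Definition regular F t : Prop :=
  exists c0 : R, 0 < c0 /\
    forall f g u U, Lp f -> Lp g -> weak_solution F t f g u U ->
      (Lpnorm u <= c0%:E * (Lpnorm f + Lpnorm g))%E.

Definition p_Dirichlet : Prop :=
  (forall F t f g, admissible F t f g -> exists u U, weak_solution F t f g u U)
  /\
  (forall F t, admissible_coef F t -> regular F t).

End spaces.

(* Main.v *)
(* Write [E] for the p-th power of the norm of the gradient in [QL^p] plus
   [int F |u|^p v].  Under the Sobolev property [E / p] minus the linear form
   given by the data is bounded below on [QLip0], and the uniform convexity of
   the p-th power of the euclidean norm makes its minimizing sequences Cauchy;
   the limit solves the equation.  A solution may be tested with the test
   functions that approximate it, which gives regularity, and the difference of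
   two solutions with those that approximate the difference, which gives
   uniqueness by strict monotonicity of [a |-> |a|^(p-2) a] and Sobolev.

   Conversely, let [u] solve the problem with [F = 0], [t = 0], [g = 0] and
   [f = phi].  Testing with [phi] itself yields
   [int |phi|^p v = int |sqrt Q nabla u|^(p-2) Q nabla u . nabla phi], while
   regularity bounds the energy of [u] by [int |phi|^p v]; Young's inequality
   then gives the Sobolev inequality.

   Since [nabla phi] is made of partial derivatives, [phi |-> nabla phi] is only
   linear almost everywhere, because a Lipschitz function of one real variable is
   differentiable almost everywhere. *)

Require Import Defs.
From HB Require Import structures.
From mathcomp Require Import all_boot all_order all_algebra.
From mathcomp Require Import all_classical all_reals all_analysis.
From mathcomp Require Import measurable_realfun ring lra.

Set Implicit Arguments.
Unset Strict Implicit.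
Unset Printing Implicit Defensive.

Import Order.TTheory GRing.Theory Num.Theory.
Import numFieldNormedType.Exports.

Local Open Scope classical_set_scope.
Local Open Scope ring_scope.

(** * Borel sets and Lebesgue measure of R^n *)

(** Both spaces are read as sets of fields in unweighted [L^p]: [u] becomes the one-component field
    [v^(1/p) u], [U] becomes [sqrt Q U], and the zero-order term is the energy of [F^(1/p)] times
    the former. What they share is the record [energy_form], and the variational argument is carried
    out once, for two such forms. It works with p-th powers of norms: Young's inequality with a free
    parameter replaces Hoelder's, and tangent inequalities at either end of a segment replace the
    differentiation of the energy, so that no case distinction on [p] is made. The obstacle is
    measurability. [sqrtmx (Q x)] is not known to be measurable in [x], so that only dot products of
    fields are, through [Q] itself, and the completeness of [QL^p] requires a measurable [U] behind
    a limit of [sqrt Q U_k]. Likewise, the set where a partial derivative fails has to be Borel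
    before Fubini applies to it. *)

Lemma near_rat_ball {R : realType} {n} (x : 'rV[R]_n) (e : R) : 0 < e ->
  exists q : 'rV[rat]_n, ball x e (map_mx ratr q).
Proof.
move=> e0.
have H (i : 'I_n) : exists q : rat, `|x 0 i - ratr q| < e.
  have /rat_in_itvoo[q /[!in_itv]/= /andP[q1 q2]] : x 0 i - e < x 0 i + e.
    by rewrite ltrD2l gtrN.
  by exists q; rewrite ltr_distlC q1 q2.
have /choice[f fP] := H.
exists (\row_i f i); split => // i j; rewrite !ord1 !mxE; exact: fP.
Qed.

Lemma open_bigcup_rat_ball {R : realType} {n} (U : set 'rV[R]_n) : open U ->
  U = \bigcup_(qk in [set qk : 'rV[rat]_n * nat |
        ball (map_mx ratr qk.1 : 'rV[R]_n) qk.2.+1%:R^-1 `<=` U])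
      ball (map_mx ratr qk.1 : 'rV[R]_n) qk.2.+1%:R^-1.
Proof.
move=> oU; apply/seteqP; split => [x Ux|x [[q k] /= sub /sub]//].
have /nbhs_ballP[e /= e0 xeU] : nbhs x U by apply: open_nbhs_nbhs.
have e20 : 0 < e / 2 by rewrite divr_gt0.
have [k kP] : exists k, k.+1%:R^-1 < e / 2.
  have [k _ /(_ k (leqnn k)) h] := near_infty_natSinv_lt (PosNum e20).
  by exists k.
have [q qP] := near_rat_ball x (ltac:(by rewrite invr_gt0) : 0 < k.+1%:R^-1 :> R).
exists (q, k) => /=; last exact: ball_sym.
move=> y qy; apply: xeU; apply: (@le_ball _ _ _ (k.+1%:R^-1 + k.+1%:R^-1)).
  by rewrite [leRHS](splitr e) lerD// ltW.
exact: ball_triangle qP qy.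
Qed.

(** Balls of the sup norm are cubes: membership in one is a finite conjunction of conditions on the
    coordinates, and countably many rational balls make up an open set. *)
Lemma measurable_preimage_rV_open {R : realType} {n} d (T : measurableType d)
    (D : set T) (f : T -> 'rV[R]_n) (U : set 'rV[R]_n) : measurable D ->
  (forall i, measurable_fun D (fun x => f x 0 i)) -> open U ->
  measurable (D `&` f @^-1` U).
Proof.
move=> mD mf /open_bigcup_rat_ball ->.
rewrite preimage_bigcup setI_bigcupr bigcup_mkcond.
apply: countable_bigcupT_measurable => // -[q k] /=.
case: ifPn => _; last exact: measurable0.
(* The outer [D] is for [n = 0], where the intersection is the whole space. *)
rewrite (_ : _ `&` _ = D `&` \bigcap_(i in [set: 'I_n])
   (D `&` (fun x => f x 0 i) @^-1` ball (ratr (q 0 i) : R) k.+1%:R^-1)); last first.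
  apply/seteqP; split => x [Dx /= H]; split => //.
    by move=> i _; split => //=; have := H.2 0 i; rewrite mxE.
  by split; rewrite ?invr_gt0// => i j; rewrite !ord1 mxE; have [] := H j I.
apply: measurableI => //; apply: fin_bigcap_measurable => // i _.
apply: mf => //; exact: (@measurable_ball R).
Qed.

Notation borelT R n := (g_sigma_algebraType (@open 'rV[R]_n)).

Lemma borel_measurable_open {R : realType} {n} (U : set 'rV[R]_n) :
  open U -> measurable (U : set (borelT R n)).
Proof. by move=> oU; exact: sub_sigma_algebra. Qed.

Lemma measurable_fun_to_borel {R : realType} {n} d (T : measurableType d)
    (D : set T) (f : T -> borelT R n) :
  (forall i, measurable_fun D (fun x => (f x : 'rV[R]_n) 0 i)) ->
  measurable_fun D f.
Proof.
move=> mf mD.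
apply: (measurability (rT := borelT R n) (@open 'rV[R]_n)) => // _ [U oU <-].
exact: measurable_preimage_rV_open.
Qed.

(** [h] will be the identity from the Borel or from the Caratheodory copy of R^n, so that one proof
    serves both sigma-algebras. *)
Lemma open_continuous_measurable_real {R : realType} {n} d (T : measurableType d)
    (h : T -> 'rV[R]_n) (D : set 'rV[R]_n) (f : 'rV[R]_n -> R) :
  (forall U, open U -> measurable (h @^-1` U)) ->
  open D -> (forall x, D x -> {for x, continuous f}) ->
  measurable_fun (h @^-1` D) (f \o h).
Proof.
move=> mh oD cf; apply: (measurability _ (RGenOpens.measurableE R)) => _ [_ [a [b ->] <-]].
rewrite (_ : _ `&` _ = h @^-1` (D `&` f @^-1` `]a, b[))//; apply: mh.
rewrite openE => x [Dx fx]; rewrite /interior; apply: filterI.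
  exact: open_nbhs_nbhs.
apply: (cf _ Dx); apply: open_nbhs_nbhs; split => //; exact: interval_open.
Qed.

Lemma borel_coord {R : realType} {n} (i : 'I_n) :
  measurable_fun setT (fun x : borelT R n => (x : 'rV[R]_n) 0 i).
Proof.
apply: (@open_continuous_measurable_real _ _ _ (borelT R n) id setT (fun x => x 0 i)).
- exact: borel_measurable_open.
- exact: openT.
- by move=> x _; exact: coord_continuous.
Qed.

Definition cons_rV {R : realType} {m} (z : R * borelT R m) : borelT R m.+1 :=
  row_mx (z.1%:M : 'rV[R]_1) (z.2 : 'rV[R]_m) : 'rV[R]_(1 + m).

Lemma measurable_cons_rV {R : realType} {m} :
  measurable_fun [set: measurableTypeR R * borelT R m]
    (cons_rV : measurableTypeR R * borelT R m -> borelT R m.+1).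
Proof.
apply: measurable_fun_to_borel => i.
case: (@split_ordP 1 m i) => j ->.
  apply: (eq_measurable_fun fst); last exact: measurable_fst.
  by move=> [t y] _; rewrite /cons_rV (@row_mxEl _ _ 1 m) ord1 mxE eqxx.
apply: (eq_measurable_fun ((fun y : borelT R m => (y : 'rV[R]_m) 0 j) \o snd)).
  by move=> -[t y] _; rewrite /cons_rV (@row_mxEr _ _ 1 m).
by apply: measurableT_comp => //; exact: borel_coord.
Qed.

Definition uncons_rV {R : realType} {m} (x : borelT R m.+1) : measurableTypeR R * borelT R m :=
  ((x : 'rV[R]_(1 + m)) 0 (lshift m ord0), rsubmx (x : 'rV[R]_(1 + m))).

Lemma cons_rVK {R : realType} {m} : cancel (@cons_rV R m) uncons_rV.
Proof.
move=> [t y]; congr pair; rewrite /= /cons_rV; last by rewrite (@row_mxKr _ _ 1 m).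
by rewrite (@row_mxEl _ _ 1 m) mxE eqxx.
Qed.

Lemma measurable_uncons_rV {R : realType} {m} :
  measurable_fun [set: borelT R m.+1] (@uncons_rV R m).
Proof.
apply/measurable_fun_pairP; split; first exact: borel_coord.
apply: measurable_fun_to_borel => i /=.
under eq_fun do rewrite /uncons_rV /= mxE.
exact: borel_coord.
Qed.

(** Identifies the iterated integral with the image of a product measure, which brings
    sigma-additivity and the exchange of integrals. *)
Lemma borel_lebesgueS {R : realType} m (A : set 'rV[R]_m.+1) :
  borel_lebesgue A = pushforward (lebesgue_measure \x
    (@borel_lebesgue R m : set (borelT R m) -> \bar R))%E cons_rV A.
Proof.
rewrite /= /pushforward /product_measure1; apply: eq_integral => t _ /=.
congr borel_lebesgue; apply/seteqP; split => y; by rewrite /xsection /= inE.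
Qed.

(** An existence statement because the measure structure is itself built by induction on [n]: the
    product can be formed only once the previous dimension carries a sigma-finite measure. *)
Lemma borel_lebesgue_measure (R : realType) n :
  exists mu : {sigma_finite_measure set (borelT R n) -> \bar R},
    (mu : set _ -> \bar R) = @borel_lebesgue R n.
Proof.
elim: n => [|m [mu muE]].
  by exists (@dirac _ (borelT R 0) (0 : 'rV[R]_0) R); apply/funext => A.
pose M := pushforward (lebesgue_measure \x mu)%E cons_rV.
have ME : M = @borel_lebesgue R m.+1.
  by apply/funext => A; rewrite borel_lebesgueS -muE.
have sM : sigma_finite setT M.
  have /sigma_finiteP[F [TF ndF Foo]] :=
    sigma_finiteT (@lebesgue_measure R : {sigma_finite_measure set _ -> \bar _}).
  have /sigma_finiteP[G [TG ndG Goo]] := sigma_finiteT mu.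
  have FGT : \bigcup_k (F k `*` G k) = setT.
    apply/seteqP; split => // -[t y] _.
    have [i _ Fit] : (\bigcup_i F i) t by rewrite -TF.
    have [j _ Gjy] : (\bigcup_i G i) y by rewrite -TG.
    exists (maxn i j) => //; split => /=.
      by move: t Fit; exact/subsetPset/ndF/leq_maxl.
    by move: y Gjy; exact/subsetPset/ndG/leq_maxr.
  exists (fun k => uncons_rV @^-1` (F k `*` G k)).
    by rewrite -preimage_bigcup FGT preimage_setT.
  move=> k; have [mF Fk] := Foo k; have [mG Gk] := Goo k; split.
    rewrite -[X in measurable X]setTI; apply: measurable_uncons_rV => //.
    exact: measurableX.
  rewrite /M /pushforward -comp_preimage.
  rewrite (_ : uncons_rV \o _ = id); last by apply/funext => z; exact: cons_rVK.
  by rewrite preimage_id product_measure1E// lte_mul_pinfty// ge0_fin_numE.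
pose M' : {sigma_finite_measure set (borelT R m.+1) -> \bar R} :=
  HB.pack M (Measure_isSigmaFinite.Build _ _ _ M sM).
by have mf := @measurable_cons_rV R m; exists (M' mf mf mf).
Qed.

Definition line_null {R : realType} {n} (i : 'I_n) (N : set 'rV[R]_n) :=
  forall x, lebesgue_measure [set s : R | N (x + s *: delta_mx 0 i)] = 0%E.

(** Fubini: either [i] is the first coordinate, and the slices to measure are lines, or it survives
    in the slices along the first coordinate, and induction applies. *)
Lemma borel_lebesgue_line_null (R : realType) n (i : 'I_n)
    (N : set (borelT R n)) : measurable N -> line_null i N ->
  borel_lebesgue (N : set 'rV[R]_n) = 0%E.
Proof.
elim: n i N => [[]//|m IH] i N mN null.
have [mu muE] := borel_lebesgue_measure R m.
have mN' : measurable (cons_rV @^-1` N : set (measurableTypeR R * borelT R m)).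
  by rewrite -[X in measurable X]setTI; exact: measurable_cons_rV.
rewrite borel_lebesgueS -muE /pushforward.
have rowE t (y : 'rV[R]_m) s : (row_mx (t%:M : 'rV[R]_1) y : 'rV[R]_m.+1) +
    s *: delta_mx 0 (lshift m (ord0 : 'I_1)) = row_mx (t + s)%:M y.
  apply/rowP => j; case: (@split_ordP 1 m j) => k ->; rewrite [LHS]mxE ![X in _ + X]mxE.
    by rewrite !(@row_mxEl _ _ 1 m) !ord1 !mxE eqxx mulr1.
  by rewrite !(@row_mxEr _ _ 1 m) mxE eq_rlshift andbF mulr0 addr0.
case: (@split_ordP 1 m i) null => k -> null.
  (* By symmetry of the product measure the first coordinate may be integrated innermost; the inner
     measures are then those of lines in direction [i]. *)
  rewrite (product_measure_unique (m' := (lebesgue_measure \x^ mu)%E))//; last first.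
    by move=> *; exact: product_measure2E.
  apply: integral0_eq => y _ /=.
  rewrite -[RHS](null (row_mx (0%:M : 'rV[R]_1) y)); congr (lebesgue_measure _).
  by apply/seteqP; split => t; rewrite /ysection /= inE /= ord1 rowE add0r.
apply: integral0_eq => t _ /=; rewrite muE; apply: (IH k).
  exact: measurable_xsection.
move=> y; rewrite -[RHS](null (row_mx (t%:M : 'rV[R]_1) y)).
congr (lebesgue_measure _); apply/seteqP.
suff h s : row_mx (t%:M : 'rV[R]_1) (y + s *: delta_mx 0 k) =
    row_mx (t%:M : 'rV[R]_1) y + s *: delta_mx 0 (rshift 1 k) :> 'rV[R]_(1 + m).
  by split => s; rewrite /xsection /= inE /cons_rV /= h.
apply/rowP => j; case: (@split_ordP 1 m j) => l ->; rewrite [RHS]mxE [X in _ = _ + X]mxE.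
  by rewrite !(@row_mxEl _ _ 1 m) !mxE eq_lrshift andbF mulr0 addr0.
by rewrite !(@row_mxEr _ _ 1 m) !mxE (inj_eq (@rshift_inj _ _)).
Qed.

Lemma borel_measurable_lebT (R : realType) n (A : set 'rV[R]_n) :
  measurable (A : set (borelT R n)) -> measurable (A : set (lebT R n)).
Proof.
move=> mA; have [mu muE] := borel_lebesgue_measure R n.
have lebE : @leb_outer R n = mu_ext mu by rewrite /leb_outer -muE.
suff : caratheodory_measurable (@leb_outer R n) A by [].
rewrite lebE; apply: (@sub_caratheodory _ (borelT R n) _ mu).
exact: sub_sigma_algebra.
Qed.

Lemma leb_borelE (R : realType) n (A : set 'rV[R]_n) :
  measurable (A : set (borelT R n)) -> leb (A : set (lebT R n)) = borel_lebesgue A.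
Proof.
move=> mA; have [mu muE] := borel_lebesgue_measure R n.
by rewrite /leb /leb_outer -muE measurable_mu_extE.
Qed.

Lemma open_measurable_lebT (R : realType) n (A : set 'rV[R]_n) :
  open A -> measurable (A : set (lebT R n)).
Proof.
by move=> oA; apply: borel_measurable_lebT; exact: borel_measurable_open.
Qed.

Lemma leb_complete (R : realType) n (A B : set (lebT R n)) :
  measurable A -> leb A = 0%E -> B `<=` A -> measurable B.
Proof.
move=> mA A0 BA; apply: (@measure_is_complete_caratheodory _ _ (@leb_outer R n)).
by exists A.
Qed.

(** * Differentiability of Lipschitz functions along lines *)

Lemma lebesgue_stieltjes_measure_itvoc {R : realType} (h : cumulative R R) a b :
  a <= b -> lebesgue_stieltjes_measure h `]a, b] = (h b - h a)%:E.
Proof.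
move=> ab; rewrite /lebesgue_stieltjes_measure /measure_extension.
by rewrite measurable_mu_extE/=; [rewrite wlength_itv_bnd|exact: is_ocitv].
Qed.

(** The Stieltjes measures of [h1] and [h2] add up to [b - a] on []a, b]], so that their sum is the
    Lebesgue measure by uniqueness. *)
Lemma cumulative_complement_le_lebesgue {R : realType} (h1 h2 : cumulative R R)
    (A : set (measurableTypeR R)) : (forall x, h1 x + h2 x = x) ->
  measurable A -> (lebesgue_stieltjes_measure h1 A <= lebesgue_measure A)%E.
Proof.
move=> h12 mA.
have addE B : measure_add (lebesgue_stieltjes_measure h1)
      (lebesgue_stieltjes_measure h2) B =
    (lebesgue_stieltjes_measure h1 B + lebesgue_stieltjes_measure h2 B)%E.
  exact: measure_addE.
rewrite (@lebesgue_measure_unique _ (measure_add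
   (lebesgue_stieltjes_measure h1) (lebesgue_stieltjes_measure h2)))//.
  by rewrite [leRHS]addE leeDl.
move=> _ [[a b] /= _ <-]; rewrite [RHS]addE.
have [ab|/ltW ba] := leP a b.
  rewrite !lebesgue_stieltjes_measure_itvoc//=.
  rewrite [LHS]lebesgue_stieltjes_measure_itvoc// -EFinD; apply: congr1 => /=.
  by have := h12 a; have := h12 b; lra.
rewrite (_ : [set` _] = set0) ?measure0 ?adde0//.
by apply/seteqP; split => // x /=; rewrite in_itv/= => /andP[/lt_le_trans h /h]; rewrite ltNge ba.
Qed.

Lemma nondecreasing_cumulative {R : realType} (h : R -> R) :
  nondecreasing h -> continuous h -> exists h' : cumulative R R, h' = h :> (R -> R).
Proof.
move=> nd ch.
by exists (HB.pack_for (cumulative R R) h (isCumulative.Build R _ R h nd (right_continuousW ch))).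
Qed.

Lemma lipschitz_continuous {R : realType} (f : R -> R) k :
  (forall x y, `|f x - f y| <= k * `|x - y|) -> continuous f.
Proof.
move=> fk x; have k1 : 0 < `|k| + 1 by rewrite ltr_wpDl.
apply/cvgrPdist_lt => e e0; near=> y.
apply: (le_lt_trans (fk _ _)); apply: (@le_lt_trans _ _ ((`|k| + 1) * `|x - y|)).
  by rewrite ler_wpM2r// (le_trans (ler_norm k))// lerDl.
rewrite -ltr_pdivlMl//; near: y; apply: cvgr_dist_lt => //.
by rewrite mulr_gt0// invr_gt0.
Unshelve. all: by end_near. Qed.

(* The functions [x / 2 + f x] and [x / 2 - f x] are nondecreasing and their sum
   is the identity, so that the Stieltjes measure of the first one is bounded by
   the Lebesgue measure: it has a density and the first fundamental theorem of
   calculus applies. *)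
Lemma half_lipschitz_ae_derivable {R : realType} (f : R -> R) :
  (forall x y, `|f x - f y| <= 2^-1 * `|x - y|) ->
  {ae lebesgue_measure, forall x, derivable f x 1}.
Proof.
move=> fL; have cf := lipschitz_continuous fL.
have ndh (s : R) : `|s| = 1 -> nondecreasing (fun x => 2^-1 * x + s * f x).
  move=> s1 x y xy; rewrite -subr_ge0.
  rewrite (_ : _ - _ = 2^-1 * (y - x) + s * (f y - f x)); last by ring.
  have : `|s * (f y - f x)| <= 2^-1 * (y - x).
    by rewrite normrM s1 mul1r (le_trans (fL _ _))// ger0_norm// subr_ge0.
  by rewrite ler_norml => /andP[+ _]; rewrite -subr_ge0 opprK addrC.
have ch (s : R) : continuous (fun x : R => 2^-1 * x + s * f x : R).
  by move=> x; apply: cvgD; apply: cvgM; [exact: cvg_cst|exact: cvg_id|exact: cvg_cst|exact: cf].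
have [h hE] := nondecreasing_cumulative (ndh 1 (normr1 _)) (ch 1).
have [h2 h2E] := nondecreasing_cumulative (ndh (-1) (normrN1 _)) (ch (-1)).
have hD x : h x + h2 x = x by rewrite hE h2E mul1r mulN1r; lra.
pose nu := lebesgue_stieltjes_measure h.
(* Radon-Nikodym is applied to a finite measure, the restriction of [nu] to a bounded interval. *)
suff H (M : nat) : {ae lebesgue_measure, forall x,
    `](- M%:R), M%:R[%classic x -> derivable f x 1}.
  have := @ae_foralln _ _ _ lebesgue_measure _ H.
  apply: filterS => x Hx; apply: (Hx (Num.bound `|x|)).
  by rewrite /= in_itv/= -ltr_norml archi_boundP.
pose D := `](- M%:R), (M%:R : R)]%classic.
have mD : measurable (D : set (measurableTypeR R)) by exact: measurable_itv.
have MM : - M%:R <= (M%:R : R) by rewrite (@le_trans _ _ 0)// oppr_le0.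
have Doo : (nu D < +oo)%E by rewrite /nu /D lebesgue_stieltjes_measure_itvoc// ltry.
have dom : mfrestr mD Doo `<< lebesgue_measure.
  apply/null_content_dominatesP => A mA A0; apply/eqP.
  rewrite eq_le measure_ge0 andbT /mfrestr /mrestr -A0.
  apply: (le_trans (cumulative_complement_le_lebesgue hD _)).
    exact: measurableI.
  by apply: le_measure; rewrite ?inE//=; exact: measurableI.
have [g [g0 gfin intg gE]] := radon_nikodym_sigma_finite dom.
have gK : EFin \o (fine \o g) = g.
  by apply/funext => x /=; rewrite fineK.
have intg' A : measurable A -> lebesgue_measure.-integrable A (EFin \o (fine \o g)).
  by move=> mA; rewrite gK; apply: integrableS intg.
have := @FTC1 _ (fine \o g) (BRight (- M%:R)) (fun y => intg' _ (measurable_itv _)).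
move=> /(_ (open_integrable_locally openT (intg' _ measurableT))).
apply: filterS; first exact: (ae_filter_ringOfSetsType lebesgue_measure).
move=> x /= Hx; rewrite in_itv/= => /andP[Mx xM].
have [dF _] := Hx Mx.
have dh : derivable (fun y => h y - h (- M%:R)) x 1.
  apply: near_eq_derivable dF.
  near=> y; have yM : y \in `](- M%:R), M%:R[ by near: y; apply: near_in_itvoo; rewrite in_itv/= Mx.
  move: yM; rewrite in_itv/= => /andP[My yM].
  rewrite /Rintegral.
  under eq_integral do rewrite -[_%:E]/((EFin \o (fine \o g)) _) gK.
  rewrite -gE; last exact: measurable_itv.
  rewrite [X in fine X](_ : _ = nu (`](- M%:R), y] `&` D))// /nu.
  rewrite (_ : _ `&` _ = `](- M%:R), y]%classic) ?lebesgue_stieltjes_measure_itvoc ?ltW//.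
  apply/seteqP; split => z; rewrite /D /= !in_itv/=; first by case.
  by move=> /andP[-> zy]; rewrite zy (le_trans zy)// ltW.
rewrite (_ : f = (fun y => (h y - h (- M%:R)) + h (- M%:R) - 2^-1 * y)); last first.
  by apply/funext => y; rewrite hE; lra.
apply: derivableB.
  by apply: derivableD; [exact: dh|exact: derivable_cst].
by apply: derivableM; [exact: derivable_cst|exact: derivable_id].
Unshelve. all: by end_near. Qed.

Lemma lipschitz_ae_derivable {R : realType} (f : R -> R) k :
  (forall x y, `|f x - f y| <= k * `|x - y|) ->
  {ae lebesgue_measure, forall x, derivable f x 1}.
Proof.
(* Division by [c] brings the Lipschitz constant below [1 / 2]; the added 1 keeps [c] positive, as
   [k] may be 0. *)
move=> fL; pose c := 2 * (`|k| + 1); have c0 : 0 < c by rewrite mulr_gt0// ltr_wpDl.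
have /half_lipschitz_ae_derivable : forall x y, `|c^-1 * f x - c^-1 * f y| <= 2^-1 * `|x - y|.
  move=> x y; rewrite -mulrBr normrM gtr0_norm ?invr_gt0// ler_pdivrMl//.
  apply: (le_trans (fL _ _)); rewrite mulrA ler_wpM2r//.
  by rewrite /c mulrAC divff// mul1r (le_trans (ler_norm k))// lerDl.
apply: filterS; first exact: (ae_filter_ringOfSetsType lebesgue_measure).
move=> x dx.
rewrite (_ : f = (fun y => c * (c^-1 * f y))); last first.
  by apply/funext => y; rewrite mulrA divff ?mul1r// gt_eqF.
by apply: derivableM; [exact: derivable_cst|exact: dx].
Qed.

Lemma lipschitz_onP {R : realType} {V : normedModType R} (f : V -> R) (K : set V) :
  [lipschitz f x | x in K] <->
  exists k, forall x y, K x -> K y -> `|f x - f y| <= k * `|x - y|.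
Proof.
split=> [[M [_ H]]|[k H]].
  have /H HM : M < M + 1 by rewrite ltrDl.
  by exists (M + 1) => x y Kx Ky; exact: (HM (x, y)).
exists k; split; first exact: num_real.
move=> M kM [x y] [/= Kx Ky]; apply: (le_trans (H _ _ Kx Ky)).
by rewrite ler_wpM2r// ltW.
Qed.

Lemma closed_ball_compact_rV {R : realType} {n} (x : 'rV[R]_n) e :
  compact (closed_ball x e).
Proof.
have [e0|e0] := leP e 0; first by rewrite closed_ball0//; exact: compact0.
apply: bounded_closed_compact; last exact: closed_ball_closed.
exists (`|x| + e); split; first exact: num_real.
move=> M xeM y; rewrite closed_ballE// /closed_ball_ /= => xy.
rewrite -(subKr x y) (le_trans (ler_normB _ _))// (le_trans _ (ltW xeM))//.
by rewrite lerD2l.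
Qed.

Lemma Lip_loc_continuous {R : realType} {n} (Omega : set 'rV[R]_n) phi x :
  open Omega -> Lip_loc Omega phi -> Omega x -> {for x, continuous phi}.
Proof.
move=> oO Lphi Ox.
have [e /= [/= e0 eO]] : exists e : R, 0 < e /\ closed_ball x e `<=` Omega.
  have /nbhs_ballP[e /= e0 eO] : nbhs x Omega by apply: open_nbhs_nbhs.
  exists (e / 2); split; first by rewrite divr_gt0.
  apply: subset_trans eO; apply: closed_ball_subset; first by rewrite divr_gt0.
  by rewrite ltr_pdivrMr// ltr_pMr// ltr1n.
have /lipschitz_onP[k Hk] := Lphi _ (@closed_ball_compact_rV _ _ x e) eO.
apply/(@cvgrPdist_lt _ _ _ (nbhs x)) => d d0; near=> y.
have xx : closed_ball x e x by exact: closed_ballxx.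
have xy : closed_ball x e y.
  by apply: subset_closed_ball; near: y; exact: nbhsx_ballx.
have k1 : 0 < `|k| + 1 by rewrite ltr_wpDl.
apply: (le_lt_trans (Hk _ _ xx xy)).
apply: (@le_lt_trans _ _ ((`|k| + 1) * `|x - y|)).
  by rewrite ler_wpM2r// (le_trans (ler_norm k))// lerDl.
rewrite -ltr_pdivlMl//; near: y; apply: cvgr_dist_lt => //.
by rewrite mulr_gt0// invr_gt0.
Unshelve. all: by end_near. Qed.

Lemma normr_delta_le1 {R : realType} {n} (i : 'I_n) :
  `|delta_mx 0 i : 'rV[R]_n| <= 1.
Proof.
rewrite [leLHS]/Num.norm /= mx_normrE; apply/bigmax_leP; split => // -[j k] _ /=.
by rewrite mxE; case: (_ && _); rewrite ?normr1 ?normr0.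
Qed.

(** * Partial derivatives of locally Lipschitz functions *)

Section partial_derivative.
Context {R : realType} {n : nat}.
Variables (Omega : set 'rV[R]_n) (i : 'I_n).
Hypothesis openO : open Omega.
Local Notation e_i := (delta_mx 0 i : 'rV[R]_n).

Definition dquo (phi : 'rV[R]_n -> R) (x : 'rV[R]_n) (h : R) : R :=
  h^-1 * (phi (h *: e_i + x) - phi x).

(** An exhaustion of [Omega] on which difference quotients with steps below [m.+1%:R^-1] evaluate
    [phi] inside [Omega] only, where it is continuous. The interior makes these sets open. *)
Definition core m : set 'rV[R]_n :=
  interior [set x | ball x m.+1%:R^-1 `<=` Omega].

Lemma open_core m : open (core m). Proof. exact: open_interior. Qed.

Lemma core_sub m x : core m x -> ball x m.+1%:R^-1 `<=` Omega.
Proof. by move=> /interior_subset. Qed.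

Lemma bigcup_core : \bigcup_m core m = Omega.
Proof.
apply/seteqP; split => [x [m _ /core_sub]|x Ox].
  by apply; apply: ballxx; rewrite invr_gt0.
have /nbhs_ballP[e /= e0 eO] : nbhs x Omega by apply: open_nbhs_nbhs.
have e20 : 0 < e / 2 by rewrite divr_gt0.
have [m _ /(_ m (leqnn m)) mP] := near_infty_natSinv_lt (PosNum e20).
exists m => //; apply/nbhs_ballP; exists (e / 2) => //= y xy z yz.
apply: eO; rewrite [e]splitr; apply: ball_triangle xy _.
by apply: le_ball yz; exact: ltW.
Qed.

Lemma shift_ball (h : R) x e : `|h| < e -> ball x e (h *: e_i + x).
Proof.
move=> he; rewrite -ball_normE /= opprD addrCA subrr addr0 normrN normrZ.
by rewrite (le_lt_trans _ he)// ler_piMr// normr_delta_le1.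
Qed.

Variable phi : 'rV[R]_n -> R.
Hypothesis Lphi : Lip_loc Omega phi.

Lemma dquo_continuous m x h : core m x -> `|h| < m.+1%:R^-1 ->
  {for x, continuous (dquo phi ^~ h)}.
Proof.
move=> cx hm.
suff : (phi (h *: e_i + y) - phi y) @[y --> x] --> phi (h *: e_i + x) - phi x.
  move=> H; rewrite /prop_for /continuous_at /dquo.
  by apply: (@cvgM _ _ (nbhs x)) H; exact: cvg_cst.
apply: (@cvgB _ _ _ (nbhs x)); last first.
  apply: (Lip_loc_continuous openO Lphi).
  by apply: (core_sub cx); apply: ballxx; rewrite invr_gt0.
have H : h *: e_i + y @[y --> x] --> h *: e_i + x.
  by apply: (@cvgD _ _ _ (nbhs x)); [exact: cvg_cst|exact: cvg_id].
apply: (cvg_comp _ _ H).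
apply: (Lip_loc_continuous openO Lphi).
by apply: (core_sub cx); exact: shift_ball.
Qed.

(* The difference quotients violate the Cauchy criterion at scale [m + j]; this
   is an open condition, whence the measurability of the points where the partial
   derivative does not exist. *)
Definition oscillating m k j : set 'rV[R]_n := [set x | core m x /\
  exists h h', [/\ 0 < `|h| < (m + j).+1%:R^-1, 0 < `|h'| < (m + j).+1%:R^-1 &
    k.+1%:R^-1 < `|dquo phi x h - dquo phi x h'|]].

Lemma open_oscillating m k j : open (oscillating m k j).
Proof.
rewrite openE => x [cx [h [h' [hj h'j hk]]]]; rewrite /interior.
have mj : ((m + j).+1%:R^-1 : R) <= m.+1%:R^-1.
  by rewrite lef_pV2 ?posrE// ler_nat ltnS leq_addr.
have cq (s : R) : 0 < `|s| < (m + j).+1%:R^-1 -> {for x, continuous (dquo phi ^~ s)}.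
  by move=> /andP[_ sj]; apply: (@dquo_continuous m) => //; exact: lt_le_trans sj mj.
near=> y; split; first by near: y; apply: open_nbhs_nbhs; split => //; exact: open_core.
exists h, h'; split => //; near: y.
apply: (cvgr_gt (`|dquo phi x h - dquo phi x h'|)) => //.
by apply: cvg_norm; apply: cvgB; exact: cq.
Unshelve. all: by end_near. Qed.

(** [m] is the depth of the point in [Omega], [k] the size of the oscillation, [j] the scale.
    Countable operations on open sets give a Borel set, as Fubini requires. *)
Definition nonderiv : set 'rV[R]_n :=
  \bigcup_m \bigcup_k \bigcap_j oscillating m k j.

Lemma measurable_nonderiv : measurable (nonderiv : set (borelT R n)).
Proof.
apply: bigcupT_measurable => m; apply: bigcupT_measurable => k.
apply: bigcapT_measurable => j; apply: borel_measurable_open.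
exact: open_oscillating.
Qed.

Lemma derivable_dquoP x : derivable phi x e_i <-> cvg (dquo phi x h @[h --> 0^']).
Proof. by []. Qed.

Lemma nonderivP x : nonderiv x -> ~ derivable phi x e_i.
Proof.
move=> [m _ [k _ osc]] /derivable_dquoP /cvg_ex[l /cvgrPdist_lt].
have k20 : 0 < k.+1%:R^-1 / 2 :> R by rewrite divr_gt0// invr_gt0.
move=> /(_ _ k20) => /nbhs_ballP[e /= e0 eP].
have [j _ /(_ j (leqnn j)) jP] := near_infty_natSinv_lt (PosNum e0).
have [_ [h [h' [/andP[h0 hj] /andP[h'0 h'j]]]]] := osc j I.
have mj : ((m + j).+1%:R^-1 : R) <= j.+1%:R^-1.
  by rewrite lef_pV2 ?posrE// ler_nat ltnS leq_addl.
have near_l (s : R) : 0 < `|s| -> `|s| < (m + j).+1%:R^-1 ->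
    `|l - dquo phi x s| < k.+1%:R^-1 / 2.
  move=> s0 sj; apply: eP; last by rewrite -normr_gt0.
  by rewrite -ball_normE /= sub0r normrN (lt_le_trans sj)// (le_trans mj)// ltW.
rewrite ltNge => /negP; apply; apply: ltW; rewrite [ltRHS]splitr.
apply: (le_lt_trans (ler_distD l _ _)); rewrite distrC.
by apply: ltrD; exact: near_l.
Qed.

Lemma not_derivable_nonderiv x : Omega x -> ~ derivable phi x e_i -> nonderiv x.
Proof.
rewrite -[X in X x]bigcup_core => -[m _ cx] nd; apply: contrapT => nN; apply: nd.
apply/derivable_dquoP/cauchy_cvgP/cauchy_exP => e e0.
have [k _ /(_ k (leqnn k)) kP] := near_infty_natSinv_lt (PosNum e0).
have [j noosc] : exists j, ~ oscillating m k j x.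
  by apply/existsNP => H; apply: nN; exists m => //; exists k => // j _; exact: H.
have r0 : 0 < (m + j).+1%:R^-1 :> R by rewrite invr_gt0.
have hr : 0 < `|(m + j).+1%:R^-1 / 2 : R| < (m + j).+1%:R^-1.
  rewrite gtr0_norm ?divr_gt0//=.
  by rewrite ltr_pdivrMr// ltr_pMr// ltr1n.
(* The Cauchy criterion asks for one centre: the quotient at half the scale, itself within the range
   where oscillation is excluded. *)
exists (dquo phi x ((m + j).+1%:R^-1 / 2)).
rewrite /nbhs /=; apply/nbhs_ballP; exists (m + j).+1%:R^-1 => //= h.
rewrite -ball_normE /= sub0r normrN => hj h0.
apply: le_lt_trans kP; rewrite leNgt; apply/negP => lt.
apply: noosc; split => //; exists ((m + j).+1%:R^-1 / 2), h; split => //.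
by rewrite hj andbT normr_gt0.
Qed.

End partial_derivative.

Lemma clamp_lipschitz {R : realType} (a b s t : R) :
  `|Num.max a (Num.min s b) - Num.max a (Num.min t b)| <= `|s - t|.
Proof.
have : s - t <= `|s - t| := ler_norm _.
have : t - s <= `|s - t| by rewrite distrC ler_norm.
rewrite ler_norml.
have [? | ?] := leP s b; have [? | ?] := leP t b;
  have [? | ?] := leP a s; have [? | ?] := leP a t; have [? | ?] := leP a b; lra.
Qed.

Section partial_derivative_ae.
Context {R : realType} {n : nat}.
Variables (Omega : set 'rV[R]_n) (i : 'I_n).
Hypothesis openO : open Omega.
Variable phi : 'rV[R]_n -> R.
Hypothesis Lphi : Lip_loc Omega phi.
Local Notation e_i := (delta_mx 0 i : 'rV[R]_n).

Lemma measurable_line (x : 'rV[R]_n) :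
  measurable_fun setT (fun s : measurableTypeR R => x + s *: e_i : borelT R n).
Proof.
apply: measurable_fun_to_borel => j.
apply: (eq_measurable_fun (fun s : measurableTypeR R => x 0 j + s * e_i 0 j)).
  by move=> s _; rewrite !mxE.
apply: measurable_funD; first exact: measurable_cst.
by apply: measurable_funM; [exact: measurable_id|exact: measurable_cst].
Qed.

Lemma line_continuous (x : 'rV[R]_n) : continuous (fun s : R => x + s *: e_i).
Proof.
move=> s; apply: (@cvgD _ _ _ (nbhs s)); first exact: cvg_cst.
by apply: cvgZr_tmp; exact: cvg_id.
Qed.

Lemma derivable_line (x : 'rV[R]_n) (s : R) :
  derivable phi (x + s *: e_i) e_i <-> derivable (fun s : R => phi (x + s *: e_i)) s 1.
Proof.
rewrite derivable1P [X in _ <-> X]derivable1P.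
rewrite (_ : (fun h => phi (h *: e_i + (x + s *: e_i))) =
  (fun h : R => phi (x + (h *: (1 : R) + s) *: e_i)))//.
apply/funext => h; congr phi.
by rewrite scalerDl addrCA [_ *: 1]mulr1.
Qed.

(** [phi] is Lipschitz on compact sets only, so the trace of [Omega] on the line is covered by its
    countably many rational segments; the theorem on Lipschitz functions of one variable applies to
    each. *)
Lemma ae_derivable_line (x : 'rV[R]_n) : {ae lebesgue_measure, forall s : R,
  Omega (x + s *: e_i) -> derivable phi (x + s *: e_i) e_i}.
Proof.
pose O : set R := [set s | Omega (x + s *: e_i)].
have oO : open O by apply: open_comp => // s _; exact: line_continuous.
have H (k : nat) : {ae lebesgue_measure, forall s : R,
    forall ab : rat * rat, unpickle k = Some ab ->
    `[ratr ab.1, ratr ab.2] `<=` O -> s \in `]ratr ab.1, ratr ab.2[ ->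
    derivable phi (x + s *: e_i) e_i}.
  case: (unpickle k) => [[a b]|]; last by apply: aeW.
  have [abO|nabO] := pselect (`[ratr a, ratr b] `<=` O); last first.
    by apply: aeW => s _ [<-].
  pose K := [set x + s *: e_i | s in `[ratr a : R, ratr b]].
  have cK : compact K.
    apply: continuous_compact; last exact: segment_compact.
    by apply: continuous_subspaceT; exact: line_continuous.
  have [] := (lipschitz_onP phi K).1 (Lphi cK _).
    by move=> _ [s /abO Os <-].
  move=> c Hc.
  have [ab|ba] := ltP (ratr a : R) (ratr b); last first.
    by apply: aeW => s _ [<-] /= _; rewrite in_itv/= => /andP[/lt_trans h /h]; rewrite ltNge ba.
  (* Clamping extends the function from the segment to a Lipschitz function on R; the two coincide
     near interior points, hence so do their derivatives. *)
  pose cl s : R := Num.max (ratr a) (Num.min s (ratr b)).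
  have clK s : K (x + cl s *: e_i).
    exists (cl s) => //=; rewrite in_itv/= /cl le_max lexx/=.
    by rewrite ge_max ltW//= ge_min lexx orbT.
  have Lf : forall s t, `|phi (x + cl s *: e_i) - phi (x + cl t *: e_i)| <=
      `|c| * `|s - t|.
    move=> s t; apply: (le_trans (Hc _ _ (clK s) (clK t))).
    rewrite opprD addrACA subrr add0r -scalerBl normrZ.
    apply: (@le_trans _ _ (`|c| * (`|cl s - cl t| * `|e_i|))).
      by rewrite ler_wpM2r ?ler_norm// mulr_ge0.
    rewrite ler_wpM2l// (le_trans (ler_piMr _ (normr_delta_le1 i)))//.
    exact: clamp_lipschitz.
  have := lipschitz_ae_derivable Lf.
  apply: filterS; first exact: (ae_filter_ringOfSetsType lebesgue_measure).
  move=> s ds _ [<-] /= _; rewrite in_itv/= => /andP[as_ sb].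
  apply/derivable_line; apply: near_eq_derivable ds.
  near=> t; rewrite /cl min_l ?max_r//; apply: ltW; near: t.
    exact: lt_nbhsr.
  exact: lt_nbhsl.
have := @ae_foralln _ _ _ lebesgue_measure _ H.
apply: filterS.
move=> s Hs Os.
have /nbhs_ballP[e /= e0 eO] : nbhs s O by apply: open_nbhs_nbhs.
have [a] := rat_in_itvoo (ltac:(by rewrite ltrBlDr ltrDl) : s - e < s).
have [b] := rat_in_itvoo (ltac:(by rewrite ltrDl) : s < s + e).
rewrite !in_itv/= => /andP[sb be] /andP[ea as_].
apply: (Hs (pickle (a, b)) (a, b)); rewrite ?pickleK//=; last by rewrite in_itv/= as_ sb.
move=> t /=; rewrite in_itv/= => /andP[at_ tb]; apply: eO.
rewrite -ball_normE /= ltr_distlC (lt_le_trans ea at_) (le_lt_trans tb be)//.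
Unshelve. all: by end_near. Qed.
End partial_derivative_ae.

#[global] Instance leb_ae_filter (R : realType) n :
  Filter (nbhs (almost_everywhere (@leb R n))) := ae_filter_ringOfSetsType _.

(** Here completeness of [leb] enters: whatever the values on [N], the part of a preimage inside [N]
    is measurable. *)
Lemma measurable_fun_setD_null {R : realType} {n} d (T : measurableType d)
    (D N : set (lebT R n)) (f : lebT R n -> T) :
  measurable D -> measurable N -> leb N = 0%E ->
  measurable_fun (D `\` N) f -> measurable_fun D f.
Proof.
move=> mD mN N0 mf _ B mB.
rewrite (_ : D `&` f @^-1` B =
  ((D `\` N) `&` f @^-1` B) `|` (N `&` (D `&` f @^-1` B))); last first.
  apply/seteqP; split => x; last by move=> [[[]]|[]].
  by move=> [Dx fx]; have [Nx|Nx] := pselect (N x); [right|left].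
apply: measurableU; first by apply: mf => //; exact: measurableD.
by apply: (leb_complete mN N0); exact: subIsetl.
Qed.

(** * Existence almost everywhere and measurability of the gradient *)

Section grad.
Context {R : realType} {n : nat}.
Variables (Omega : set 'rV[R]_n).
Hypothesis openO : open Omega.
Variable phi : 'rV[R]_n -> R.
Hypothesis Lphi : Lip_loc Omega phi.
Local Notation e_ i := (delta_mx 0 i : 'rV[R]_n).

Lemma measurable_nonderiv_lebT i :
  measurable (nonderiv Omega i phi : set (lebT R n)).
Proof. by apply: borel_measurable_lebT; exact: measurable_nonderiv. Qed.

(** Each line in direction [i] meets the set in a null set, by the one-dimensional theorem. *)
Lemma leb_nonderiv i : leb (nonderiv Omega i phi : set (lebT R n)) = 0%E.
Proof.
rewrite leb_borelE; last exact: measurable_nonderiv.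
apply: (@borel_lebesgue_line_null _ _ i); first exact: measurable_nonderiv.
move=> x; apply/negligibleP.
  rewrite -[X in measurable X]setTI; apply: (measurable_line i x) => //.
  exact: measurable_nonderiv.
apply: negligibleS (ae_derivable_line i openO Lphi x) => s /= Ns Hs.
have Os : Omega (x + s *: e_ i).
  have [m _ [k _ /(_ 0%N I)[/core_sub + _]]] := Ns.
  by apply; apply: ballxx; rewrite invr_gt0.
exact: nonderivP Ns (Hs Os).
Qed.

Lemma ae_derivable : {ae (@leb R n), forall x, Omega x ->
  forall i, derivable phi x (e_ i)}.
Proof.
have : {ae (@leb R n), forall x, forall i, Omega x -> derivable phi x (e_ i)}.
  apply: filter_forall => i; exists (nonderiv Omega i phi).
  split; [exact: measurable_nonderiv_lebT|exact: leb_nonderiv|].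
  move=> x /= /not_implyP[Ox nd]; exact: not_derivable_nonderiv.
by apply: filterS => x H Ox i; exact: H.
Qed.

Lemma continuous_measurable_lebT (f : 'rV[R]_n -> R) (U : set 'rV[R]_n) :
  open U -> (forall x, U x -> {for x, continuous f}) -> measurable_on U f.
Proof.
move=> oU cf; apply: (@open_continuous_measurable_real _ _ _ (lebT R n) id) => //.
exact: open_measurable_lebT.
Qed.

Lemma Lip_loc_measurable : measurable_on Omega phi.
Proof.
by apply: continuous_measurable_lebT => // x; exact: Lip_loc_continuous.
Qed.

(** Off a null set the partial derivative is the limit of continuous difference quotients along a
    sequence of steps. *)
Lemma grad_measurable : vmeasurable_on Omega (grad phi).
Proof.
move=> i; pose N := nonderiv Omega i phi.
have mO : measurable (Omega : set (lebT R n)) by exact: open_measurable_lebT.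
have mN := measurable_nonderiv_lebT i.
apply: (measurable_fun_setD_null (N := N) mO mN (leb_nonderiv i)).
(* [j.+2] makes the step strictly smaller than [j.+1%:R^-1], the margin that [core Omega j]
   guarantees. *)
pose h (j : nat) : R := j.+2%:R^-1.
have hj j : 0 < h j < j.+1%:R^-1.
  by rewrite invr_gt0 ltr0n/= ltf_pV2 ?posrE// ltr_nat.
(* Quotients that could leave [Omega] are cut off to 0; a given point of [Omega] lies in
   [core Omega j] for all large [j]. *)
pose q j := (dquo i phi ^~ (h j)) \_ (core Omega j).
apply: (@measurable_fun_cvg _ (lebT R n) R _ q).
  move=> j; apply: (measurable_funS mO); first exact: subDsetl.
  have mC := open_measurable_lebT (@open_core _ _ Omega j).
  apply/(measurable_restrict _ mC mO).
  have -> : Omega `&` core Omega j = core Omega j.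
    apply/setIidr => x /core_sub; apply; apply: ballxx; by rewrite invr_gt0.
  apply: continuous_measurable_lebT => [|x cx]; first exact: open_core.
  apply: (dquo_continuous openO Lphi cx).
  by have /andP[h0 hlt] := hj j; rewrite gtr0_norm.
move=> x [Ox Nx].
have dx : derivable phi x (e_ i).
  by apply: contrapT => nd; apply: Nx; exact: not_derivable_nonderiv.
rewrite mxE.
have h0 : h j @[j --> \oo] --> (0 : R).
  apply/cvgrPdist_lt => e e0; near=> j; have /andP[hj0 hj1] := hj j.
  rewrite sub0r normrN gtr0_norm//; apply: lt_trans hj1 _.
  by near: j; exact: (near_infty_natSinv_lt (PosNum e0)).
have : dquo i phi x (h j) @[j --> \oo] --> 'D_(e_ i) phi x.
  apply: ((cvgr_dnbhsP _ _ _).1 dx); split => // j.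
  by rewrite invr_eq0 pnatr_eq0.
apply: cvg_trans; apply: near_eq_cvg.
have [m _ cx] : (\bigcup_m core Omega m) x by rewrite bigcup_core.
near=> j; rewrite /q patchE mem_set//.
have mj : (m <= j)%N by near: j; exact: nbhs_infty_ge.
apply: interiorS cx => y; apply: subset_trans; apply: le_ball.
by rewrite lef_pV2 ?posrE// ler_nat.
Unshelve. all: by end_near. Qed.
End grad.

(** * Linear combinations of locally Lipschitz functions *)

Section comb.
Context {R : realType} {n : nat}.
Variables (Omega : set 'rV[R]_n).
Hypothesis openO : open Omega.
Implicit Types phi psi : 'rV[R]_n -> R.

Lemma Lip_loc_comb phi psi k : Lip_loc Omega phi -> Lip_loc Omega psi ->
  Lip_loc Omega (fun x => phi x + k * psi x).
Proof.
move=> Lphi Lpsi K cK KO; apply/lipschitz_onP.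
have /lipschitz_onP[a Ha] := Lphi _ cK KO.
have /lipschitz_onP[b Hb] := Lpsi _ cK KO.
exists (a + `|k| * b) => x y Kx Ky.
rewrite opprD addrACA -mulrBr (le_trans (ler_normD _ _))// mulrDl lerD ?Ha//.
by rewrite normrM -mulrA ler_wpM2l// Hb.
Qed.

Lemma Lip0_comb phi psi k : Lip0 Omega phi -> Lip0 Omega psi ->
  Lip0 Omega (fun x => phi x + k * psi x).
Proof.
move=> [Lphi cphi sphi] [Lpsi cpsi spsi].
set A := closure _ in cphi sphi; set B := closure _ in cpsi spsi.
have sub : closure (Omega `&` [set x | phi x + k * psi x != 0]) `<=` A `|` B.
  rewrite /A /B -closureU; apply: closure_subset => x [Ox /= x0].
  have [p0|p0] := eqVneq (phi x) 0; last by left.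
  right; split => //=; apply: contra_neq x0 => ->.
  by rewrite p0 mulr0 addr0.
split; [exact: Lip_loc_comb| |].
- apply: (@subclosed_compact _ _ (A `|` B)) => //; first exact: closed_closure.
  exact: compactU.
- by apply: subset_trans sub _ => x [/sphi|/spsi].
Qed.

Lemma grad_comb_ae phi psi k : Lip_loc Omega phi -> Lip_loc Omega psi ->
  {ae (@leb R n), forall x, Omega x ->
    grad (fun x => phi x + k * psi x) x = grad phi x + k *: grad psi x}.
Proof.
move=> Lphi Lpsi; apply: filterS2 (ae_derivable openO Lphi) (ae_derivable openO Lpsi).
move=> x dphi dpsi Ox; apply/rowP => i; rewrite !mxE.
have e : (fun x => phi x + k * psi x) = phi + k \*: psi by [].
rewrite e deriveD ?deriveZ//; [exact: dpsi|exact: dphi|].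
by apply: derivableZ; exact: dpsi.
Qed.

End comb.

(** * The Euclidean inner product *)

Section dot.
Context {R : realType} {n : nat}.
Implicit Types (x y z : 'rV[R]_n) (A B : 'M[R]_n).

Lemma dotE x y : dot x y = (x *m y^T) 0 0.
Proof. by rewrite mxE; apply: eq_bigr => i _; rewrite mxE. Qed.

Lemma dotC x y : dot x y = dot y x.
Proof. by apply: eq_bigr => i _; rewrite mulrC. Qed.

Lemma dotDl x y z : dot (x + y) z = dot x z + dot y z.
Proof. by rewrite !dotE mulmxDl mxE. Qed.

Lemma dotZl k x y : dot (k *: x) y = k * dot x y.
Proof. by rewrite !dotE -scalemxAl mxE. Qed.

Lemma dotDr x y z : dot z (x + y) = dot z x + dot z y.
Proof. by rewrite dotC dotDl !(dotC z). Qed.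

Lemma dotZr k x y : dot y (k *: x) = k * dot y x.
Proof. by rewrite dotC dotZl (dotC y). Qed.

Lemma dotNl x y : dot (- x) y = - dot x y.
Proof. by rewrite -scaleN1r dotZl mulN1r. Qed.

Lemma dotNr x y : dot y (- x) = - dot y x.
Proof. by rewrite dotC dotNl dotC. Qed.

Lemma dot0l x : dot 0 x = 0.
Proof. by rewrite dotE mul0mx mxE. Qed.

Lemma dot_ge0 x : 0 <= dot x x.
Proof. by apply: sumr_ge0 => i _; rewrite -expr2 sqr_ge0. Qed.

Lemma dot_eq0 x : dot x x = 0 -> x = 0.
Proof.
move=> /eqP; rewrite psumr_eq0; last by move=> i _; rewrite -expr2 sqr_ge0.
move=> /allP H; apply/rowP => i; have := H i (mem_index_enum _).
by rewrite mxE -expr2 sqrf_eq0 => /eqP.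
Qed.

Lemma dot_mulmx A x y : dot (x *m A) y = dot x (y *m A^T).
Proof. by rewrite !dotE trmx_mul trmxK mulmxA. Qed.

Lemma dot_delta A (i j : 'I_n) :
  dot ((delta_mx 0 i : 'rV_n) *m A) (delta_mx 0 j) = A i j.
Proof. by rewrite dotE -rowE trmx_delta -colE !mxE. Qed.

End dot.

(** * Square roots of positive semidefinite matrices *)

Section sqrtmx.
Context {R : realType}.

Lemma psdmxP n (A : 'M[R]_n) :
  psdmx A <-> A^T = A /\ forall x, 0 <= dot (x *m A) x.
Proof.
split=> -[At H]; split => // x; last by rewrite /mulmxv At.
by have := H x; rewrite /mulmxv At.
Qed.

Lemma psdmxZ n (A : 'M[R]_n) c : 0 <= c -> psdmx A -> psdmx (c *: A).
Proof.
move=> c0 /psdmxP[At H]; apply/psdmxP; rewrite linearZ /= At; split => // x.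
by rewrite -scalemxAr dotZl mulr_ge0.
Qed.

Lemma cvg_bigsum (I : Type) (s : seq I) (u : I -> R^nat) (l : I -> R) :
  (forall i, u i k @[k --> \oo] --> l i) ->
  (\sum_(i <- s) u i k) @[k --> \oo] --> \sum_(i <- s) l i.
Proof.
move=> H; elim: s => [|i s IH].
  by under eq_fun do rewrite big_nil; rewrite big_nil; exact: cvg_cst.
by under eq_fun do rewrite big_cons; rewrite big_cons; exact: cvgD.
Qed.

Lemma quadratic_form_bound n (A : 'M[R]_n) :
  exists2 c, 0 < c & forall x, dot (x *m A) x <= c * dot x x.
Proof.
(* The 1 keeps the constant positive for [A = 0]; it will be inverted. *)
exists (1 + \sum_i \sum_j `|A i j|).
  by rewrite ltr_pwDl// sumr_ge0// => i _; apply: sumr_ge0.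
move=> x; rewrite mulrDl mul1r -[leLHS]add0r lerD ?dot_ge0//.
rewrite {1}/dot mulr_suml.
rewrite [leLHS](_ : _ = \sum_i \sum_j x 0 i * A i j * x 0 j); last first.
  rewrite exchange_big; apply: eq_bigr => j _; rewrite mxE mulr_suml.
  by apply: eq_bigr => i _.
apply: ler_sum => i _; rewrite mulr_suml; apply: ler_sum => j _.
have xle k : `|x 0 k| ^+ 2 <= dot x x.
  rewrite /dot (bigD1 k)//= real_normK ?num_real// -expr2 lerDl sumr_ge0// => l _.
  by rewrite -expr2 sqr_ge0.
apply: (le_trans (ler_norm _)); rewrite !normrM mulrAC mulrC ler_wpM2l//.
have := xle i; have := xle j; have := sqr_ge0 (`|x 0 i| - `|x 0 j|).
by rewrite sqrrB; nra.
Qed.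

Section contraction.
Variables (n : nat) (C : 'M[R]_n.+1).
Hypotheses (Csym : C^T = C) (C_ge0 : forall x, 0 <= dot (x *m C) x)
  (C_le1 : forall x, dot (x *m C) x <= dot x x).

Lemma horner_mx_sym p : (horner_mx C p)^T = horner_mx C p.
Proof.
elim/poly_ind: p => [|p c IH]; first by rewrite rmorph0 trmx0.
rewrite rmorphD rmorphM /= horner_mx_X horner_mx_C linearD /= tr_scalar_mx.
rewrite -[_ * C]/(_ *m C) trmx_mul IH Csym.
by congr (_ + _); exact: comm_mx_horner.
Qed.

Definition nneg_poly (p : {poly R}) := forall i, 0 <= p`_i.

Lemma nneg_polyD p q : nneg_poly p -> nneg_poly q -> nneg_poly (p + q).
Proof. by move=> p0 q0 i; rewrite coefD addr_ge0. Qed.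

Lemma nneg_polyM p q : nneg_poly p -> nneg_poly q -> nneg_poly (p * q).
Proof. by move=> p0 q0 i; rewrite coefM sumr_ge0// => j _; rewrite mulr_ge0. Qed.

Lemma nneg_polyZ c p : 0 <= c -> nneg_poly p -> nneg_poly (c *: p).
Proof. by move=> c0 p0 i; rewrite coefZ mulr_ge0. Qed.

(** An even power of [C] is the square of a symmetric matrix, an odd one is [C] between two equal
    powers: both have nonnegative forms, and so have their nonnegative combinations. *)
Lemma horner_mx_psd p x : nneg_poly p ->
  0 <= dot (x *m horner_mx C p) x.
Proof.
have symC k : (C ^+ k)^T = C ^+ k.
  by have := horner_mx_sym 'X^k; rewrite rmorphXn /= horner_mx_X.
have powC k : 0 <= dot (x *m C ^+ k) x.
  have [k' [-> | ->]] : exists k', k = k'.*2 \/ k = k'.*2.+1.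
    exists k./2; rewrite -{1 3}(odd_double_half k).
    by case: (odd k); [right|left].
  - by rewrite -addnn exprD mulmxA dot_mulmx symC dot_ge0.
  - by rewrite -addnn -addSn exprD exprSr !mulmxA dot_mulmx symC.
move=> p0; rewrite -[p]coefK poly_def rmorph_sum /= mulmx_sumr.
rewrite dotE mulmx_suml summxE sumr_ge0// => i _.
rewrite -mul_polyC rmorphM /= horner_mx_C rmorphXn /= horner_mx_X.
rewrite -[_ * _]/(_ *m _) mul_scalar_mx -scalemxAr -dotE dotZl.
by apply: mulr_ge0; [exact: p0|exact: powC].
Qed.

(* With [0 <= C <= 1], the iteration [X := (C + X^2) / 2] increases to
   [1 - sqrt (1 - C)].  Each iterate, and each difference of consecutive iterates,
   is a polynomial in [C] with nonnegative coefficients. *)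
Fixpoint sqrt_iter k : {poly R} :=
  if k is k'.+1 then 2^-1 *: ('X + sqrt_iter k' ^+ 2) else 0.

Lemma sqrt_iter_nneg k : nneg_poly (sqrt_iter k).
Proof.
elim: k => [|k IH] /=; first by move=> i; rewrite coef0.
apply: nneg_polyZ; first by rewrite invr_ge0.
by apply: nneg_polyD; [move=> i; rewrite coefX ler0n|exact: nneg_polyM].
Qed.

(** A difference of consecutive iterates is half a difference of squares, hence the previous
    difference times a sum of iterates. The factorization takes place in the commutative ring of
    polynomials. *)
Lemma sqrt_iter_nd k : nneg_poly (sqrt_iter k.+1 - sqrt_iter k).
Proof.
elim: k => [|k IH]; first by rewrite [sqrt_iter 0]/= subr0; exact: (sqrt_iter_nneg 1).
have E j : sqrt_iter j.+1 = 2^-1 *: ('X + sqrt_iter j ^+ 2) by [].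
rewrite (E k.+1) [X in nneg_poly (_ - X)]E -scalerBr.
rewrite opprD addrACA subrr add0r subr_sqr.
apply: nneg_polyZ; first by rewrite invr_ge0.
apply: nneg_polyM => //; apply: nneg_polyD; exact: sqrt_iter_nneg.
Qed.

Local Notation X k := (horner_mx C (sqrt_iter k)).

Let Xsym k : (X k)^T = X k. Proof. exact: horner_mx_sym. Qed.

Lemma sqrt_iterS k : X k.+1 = 2^-1 *: (C + X k *m X k).
Proof.
by rewrite /= -mul_polyC rmorphM /= horner_mx_C rmorphD /= horner_mx_X rmorphXn
  /= -[_ * _]/(_ *m _) mul_scalar_mx.
Qed.

Lemma sqrt_iter_le1 k x : dot (x *m X k) x <= dot x x.
Proof.
elim: k x => [|k IH] x; first by rewrite rmorph0 mulmx0 dot0l dot_ge0.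
rewrite sqrt_iterS -scalemxAr dotZl mulmxDr dotDl mulmxA.
rewrite (dot_mulmx (X k)) Xsym.
(* Positivity of [X k] at [x - x X] and the induction hypothesis at [x X] give [X^2 <= X], and
   [X <= 1] by induction. *)
have := horner_mx_psd (x - x *m X k) (sqrt_iter_nneg k).
rewrite mulmxBl !(dotDl, dotDr, dotNl, dotNr).
rewrite (dot_mulmx (X k) (x *m X k) x) Xsym.
have := IH (x *m X k); have := IH x; have := C_le1 x.
lra.
Qed.

(** The quadratic forms are nondecreasing and bounded; polarization transfers their convergence to
    the entries. *)
Lemma sqrt_iter_cvg : exists L : 'M[R]_n.+1, forall i j, X k i j @[k --> \oo] --> L i j.
Proof.
have cvgf x : cvg (dot (x *m X k) x @[k --> \oo]).
  apply: nondecreasing_is_cvgn.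
    apply/nondecreasing_seqP => k; rewrite -subr_ge0 -dotNl -dotDl -mulmxBr.
    by have := horner_mx_psd x (sqrt_iter_nd k); rewrite rmorphB.
  by exists (dot x x) => _ [k _ <-]; exact: sqrt_iter_le1.
have cvgX i j : cvg (X k i j @[k --> \oo]).
  pose e i := delta_mx 0 i : 'rV[R]_n.+1.
  rewrite (_ : (fun k => X k i j) = fun k => 2^-1 * (dot ((e i + e j) *m X k) (e i + e j)
     - dot (e i *m X k) (e i) - dot (e j *m X k) (e j))).
    by apply: is_cvgM; [exact: is_cvg_cst|apply: is_cvgB => //; exact: is_cvgB].
  apply/funext => k; rewrite mulmxDl !(dotDl, dotDr) !dot_delta.
  by rewrite -[in X k j i]Xsym mxE; lra.
by exists (\matrix_(i, j) lim (X k i j @[k --> \oo])) => i j; rewrite mxE.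
Qed.

Lemma contraction_sqrt : exists B : 'M[R]_n.+1, psdmx B /\ B *m B = 1%:M - C.
Proof.
have [L XL] := sqrt_iter_cvg.
have LE : L = 2^-1 *: (C + L *m L).
  apply/matrixP => i j; have XS : X k.+1 i j @[k --> \oo] --> L i j.
    by rewrite (cvg_shiftS (fun k => X k i j)).
  apply: (cvg_unique _ XS) => //.
  rewrite (_ : (fun k => X k.+1 i j) =
      fun k => 2^-1 * (C i j + \sum_l X k i l * X k l j)); last first.
    by apply/funext => k; rewrite sqrt_iterS !mxE.
  rewrite 3!mxE; apply: cvgM; first exact: cvg_cst.
  apply: cvgD; first exact: cvg_cst.
  by apply: cvg_bigsum => l; apply: cvgM; exact: XL.
have Lsym : L^T = L.
  apply/matrixP => i j; rewrite mxE; apply: (cvg_unique _ (XL j i)) => //.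
  rewrite (_ : (fun k => X k j i) = fun k => X k i j); first exact: XL.
  by apply/funext => k; rewrite -[in LHS]Xsym mxE.
(* The fixed point equation [2 L = C + L^2] amounts to [(1 - L)^2 = 1 - C]. *)
exists (1%:M - L); split.
  apply/psdmxP; split; first by rewrite linearB /= trmx1 Lsym.
  move=> x; rewrite mulmxBr mulmx1 dotDl dotNl subr_ge0.
  have cvgd : dot (x *m X k) x @[k --> \oo] --> dot (x *m L) x.
    apply: cvg_bigsum => i; apply: cvgM; last exact: cvg_cst.
    under eq_fun do rewrite mxE; rewrite mxE.
    by apply: cvg_bigsum => j; apply: cvgM; [exact: cvg_cst|exact: XL].
  rewrite -(cvg_lim _ cvgd)//; apply: limr_le; first by apply/cvg_ex; exists (dot (x *m L) x).
  by near=> k; exact: sqrt_iter_le1.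
have : L + L = C + L *m L.
  by rewrite {1 2}LE -scalerDl -mulr2n -[_ *+ 2]mulr_natl mulfV// scale1r.
move=> H; have -> : C = L + L - L *m L by rewrite H addrK.
rewrite mulmxBl mul1mx mulmxBr mulmx1 !opprB opprD -!addrA; congr (_ + _).
by rewrite addrCA.
Unshelve. all: by end_near. Qed.

End contraction.

Lemma psd_sqrt_exists n (A : 'M[R]_n) : psdmx A ->
  exists B : 'M[R]_n, psdmx B /\ B *m B = A.
Proof.
case: n A => [|n] A psdA.
  by exists A; split => //; apply/matrixP => -[].
have [c c0 cA] := quadratic_form_bound A.
have /psdmxP[At A0] := psdA.
(* Scaling puts the form of [C] between 0 and that of the identity; a root of [1 - C] is a root of
   [A / c]. *)
pose C := 1%:M - c^-1 *: A.
have CE x : dot (x *m C) x = dot x x - c^-1 * dot (x *m A) x.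
  by rewrite mulmxBr mulmx1 dotDl dotNl -scalemxAr dotZl.
have [||x|B [psdB BB]] := @contraction_sqrt n C.
- by rewrite linearB /= trmx1 linearZ /= At.
- by move=> x; rewrite CE subr_ge0 ler_pdivrMl// cA.
- by rewrite CE gerBl mulr_ge0// invr_ge0 ltW.
exists (Num.sqrt c *: B); split; first by apply: psdmxZ => //; exact: sqrtr_ge0.
rewrite -scalemxAl -scalemxAr scalerA -expr2 sqr_sqrtr ?(ltW c0)// BB.
by rewrite subKr scalerA divff ?scale1r// gt_eqF.
Qed.

Lemma sqrtmxP n (A : 'M[R]_n) : psdmx A ->
  psdmx (sqrtmx A) /\ sqrtmx A *m sqrtmx A = A.
Proof.
move=> /psd_sqrt_exists[B HB].
exact: (@xgetPex _ 0 [set B | psdmx B /\ B *m B = A] (ex_intro _ B HB)).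
Qed.

Lemma dot_sqrtmx n (A : 'M[R]_n) x y : psdmx A ->
  dot (mulmxv (sqrtmx A) x) (mulmxv (sqrtmx A) y) = dot (mulmxv A x) y.
Proof.
move=> psdA; have [/psdmxP[St _] SS] := sqrtmxP psdA.
rewrite /mulmxv St [RHS]dot_mulmx -[in RHS]SS.
by rewrite trmxK mulmxA dot_mulmx St.
Qed.

End sqrtmx.

(** * Measurable inverses and measurable solutions of linear systems *)

Section measurable_matrix.
Context {R : realType} d (T : measurableType d) (D : set T).

Lemma measurable_fun_inv (f : T -> R) :
  measurable_fun D f -> measurable_fun D (fun x => (f x)^-1).
Proof.
(* [powR] gives the inverse on nonnegative bases, hence the square; at [f x = 0] both sides are
   0. *)
move=> mf; apply: (eq_measurable_fun (fun x => f x * (f x ^+ 2) `^ (-1))).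
  move=> x _; rewrite powR_inv1 ?sqr_ge0//; have [->|f0] := eqVneq (f x) 0.
    by rewrite mul0r invr0.
  by rewrite expr2 invfM mulrA divff ?mul1r.
apply: measurable_funM => //; apply: (measurableT_comp (measurable_powR (-1))).
exact: measurable_funX.
Qed.

Lemma measurable_det n (M : T -> 'M[R]_n) :
  (forall i j, measurable_fun D (fun x => M x i j)) ->
  measurable_fun D (fun x => \det (M x)).
Proof.
move=> mM; apply: measurable_sum => s.
apply: measurable_funM; first exact: measurable_cst.
by apply: measurable_prod => i _; exact: mM.
Qed.

Lemma measurable_invmx n (M : T -> 'M[R]_n) :
  (forall x, D x -> M x \in unitmx) ->
  (forall i j, measurable_fun D (fun x => M x i j)) ->
  forall i j, measurable_fun D (fun x => invmx (M x) i j).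
Proof.
move=> uM mM i j.
apply: (eq_measurable_fun (fun x => (\det (M x))^-1 * cofactor (M x) j i)).
  by move=> x; rewrite inE => Dx; rewrite /invmx uM// !mxE.
apply: measurable_funM; first exact/measurable_fun_inv/measurable_det.
apply: measurable_funM; first exact: measurable_cst.
apply: measurable_det => k l; apply: (eq_measurable_fun (fun x => M x (lift j k) (lift i l))).
  by move=> x _; rewrite !mxE.
exact: mM.
Qed.

End measurable_matrix.

Section regularized_inverse.
Context {R : realType} {n : nat}.
Variable A : 'M[R]_n.
Hypothesis psdA : psdmx A.

Lemma psd_shift_unit (e : R) : 0 < e -> A + e%:M \in unitmx.
Proof.
move=> e0; have [_ A0] := (psdmxP A).1 psdA.
rewrite -row_free_unit; apply: inj_row_free => v.
rewrite mulmxDr mul_mx_scalar => /(congr1 (fun w => dot w v)).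
rewrite dotDl dotZl dot0l => H; apply: dot_eq0; apply/eqP.
have := A0 v; have := dot_ge0 v; rewrite eq_le => v0 Av.
by rewrite v0 andbT -(pmulr_rle0 _ e0); lra.
Qed.

(** A symmetric matrix and its square have the same kernel, since [dot (v A) (v A) = dot (v A A) v];
    comparing ranks, they have the same row space. *)
Lemma psd_range_square (x : 'rV[R]_n) : exists y, x *m A = y *m A *m A.
Proof.
have [At _] := (psdmxP A).1 psdA.
have kerS : (kermx (A *m A) <= kermx A)%MS.
  apply/rV_subP => v /sub_kermxP vAA; apply/sub_kermxP/dot_eq0.
  by rewrite dot_mulmx At -mulmxA vAA dotC dot0l.
have := mxrankS kerS; rewrite !mxrank_ker => rk.
have := mxrank_leqif_eq (submxMl A A) => -[rle req].
have : (A *m A == A)%MS.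
  rewrite -req eqn_leq rle /=.
  by rewrite -(leq_sub2lE _ (rank_leq_row A)).
move=> /andP[_ AAA]; have /submxP[B AE] := submx_trans (submxMl x A) AAA.
by exists B; rewrite -mulmxA.
Qed.

(** Tikhonov regularization. With [u = y A] the error is [e z], where [z = u (A + e)^-1] is bounded
    by the length of [y] for all [e]. *)
Lemma regularized_solution_cvg (x : 'rV[R]_n) : exists2 u : 'rV[R]_n,
  u *m A = x *m A & forall i,
  (x *m A *m invmx (A + k.+1%:R^-1%:M)) 0 i @[k --> \oo] --> u 0 i.
Proof.
have [At A0] := (psdmxP A).1 psdA.
have [y yE] := psd_range_square x; exists (y *m A) => // i.
rewrite yE; set u := y *m A.
have ui e : 0 < e -> `|u 0 i - (u *m A *m invmx (A + e%:M)) 0 i| <=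
    e * Num.sqrt (dot y y).
  move=> e0; have un := psd_shift_unit e0.
  set z := u *m invmx (A + e%:M).
  have zE : z *m A + e *: z = u.
    by rewrite -mul_mx_scalar -mulmxDr mulmxKV.
  rewrite (_ : _ - _ = e * z 0 i); last first.
    have : u - u *m A *m invmx (A + e%:M) = e *: z.
      rewrite -[X in X - _](mulmxK un) -mulmxBl mulmxDr addrAC subrr add0r.
      by rewrite mul_mx_scalar -scalemxAl.
    by move=> /(congr1 (fun w : 'rV_n => w 0 i)); rewrite !mxE.
  rewrite normrM gtr0_norm// ler_pM2l// -sqrtr_sqr ler_wsqrtr//.
  have zi : z 0 i ^+ 2 <= dot z z.
    rewrite /dot (bigD1 i)//= -expr2 lerDl sumr_ge0// => j _.
    by rewrite -expr2 sqr_ge0.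
  apply: (le_trans zi).
  (* The equation [z A + e z = y A] paired with [z - y]: positivity of [A] yields
     [dot z (z - y) <= 0], hence [dot z z <= dot y y]. *)
  have : dot (z *m A - y *m A) (z - y) + e * dot z (z - y) = 0.
    rewrite -dotZl -dotDl addrAC zE /u subrr dot0l//.
  rewrite -mulmxBl => H.
  have Azy := A0 (z - y).
  have : dot z (z - y) <= 0 by rewrite -(pmulr_rle0 _ e0); lra.
  have := dot_ge0 (z - y).
  rewrite !(dotDl, dotDr, dotNl, dotNr) (dotC y z); lra.
apply/cvgrPdist_lt => e e0.
have s0 : 0 <= Num.sqrt (dot y y) by exact: sqrtr_ge0.
have d0 : 0 < e / (Num.sqrt (dot y y) + 1) by rewrite divr_gt0// ltr_wpDl.
near=> k; apply: (le_lt_trans (ui _ _)); first by rewrite invr_gt0.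
apply: (@le_lt_trans _ _ (k.+1%:R^-1 * (Num.sqrt (dot y y) + 1))).
  by rewrite ler_wpM2l ?invr_ge0// lerDl.
rewrite -ltr_pdivlMr ?ltr_wpDl//; near: k.
exact: (near_infty_natSinv_lt (PosNum d0)).
Unshelve. all: by end_near. Qed.

End regularized_inverse.

(* [U] is the limit of [Z (Q + 1/k)^-1], the solution orthogonal to the kernel;
   this is how it is chosen measurably. *)
Lemma measurable_solution {R : realType} {n : nat} d (T : measurableType d)
    (D : set T) (Q : T -> 'M[R]_n) (Z : T -> 'rV[R]_n) : measurable D ->
  (forall i j, measurable_fun D (fun x => Q x i j)) ->
  (forall x, D x -> psdmx (Q x)) ->
  (forall i, measurable_fun D (fun x => Z x 0 i)) ->
  (forall x, D x -> exists y, Z x = y *m Q x) ->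
  exists2 U : T -> 'rV[R]_n, (forall i, measurable_fun D (fun x => U x 0 i)) &
    forall x, D x -> U x *m Q x = Z x.
Proof.
move=> mD mQ psdQ mZ rZ.
have H x : exists u, D x -> u *m Q x = Z x /\ forall i,
  (Z x *m invmx (Q x + k.+1%:R^-1%:M)) 0 i @[k --> \oo] --> u 0 i.
  have [Dx|nDx] := pselect (D x); last by exists 0.
  have [y ->] := rZ x Dx.
  by have [u uE uc] := regularized_solution_cvg (psdQ x Dx) y; exists u.
have [U UP] := choice H; exists U => [i|x Dx]; last by have [] := UP x Dx.
apply: (@measurable_fun_cvg _ T R D
  (fun k x => (Z x *m invmx (Q x + k.+1%:R^-1%:M)) 0 i)); last first.
  by move=> x Dx; have [_] := UP x Dx; apply.
move=> k; apply: (eq_measurable_fun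
   (fun x => \sum_j Z x 0 j * invmx (Q x + k.+1%:R^-1%:M) j i)).
  by move=> x _; rewrite mxE.
apply: measurable_sum => j; apply: measurable_funM; first exact: mZ.
apply: measurable_invmx => [x Dx|a b]; first exact: psd_shift_unit (psdQ x Dx) _ _.
apply: (eq_measurable_fun (fun x => Q x a b + (k.+1%:R^-1%:M : 'M[R]_n) a b)).
  by move=> x _; rewrite [RHS]mxE.
by apply: measurable_funD; [exact: mQ|exact: measurable_cst].
Qed.

(** * Convexity of the p-th power of the euclidean norm *)

Section enorm.
Context {R : realType} {n : nat}.
Implicit Types a b : 'rV[R]_n.

Lemma enorm_ge0 a : 0 <= enorm a. Proof. exact: sqrtr_ge0. Qed.

Lemma enorm_sqr a : enorm a ^+ 2 = dot a a.
Proof. by rewrite sqr_sqrtr// dot_ge0. Qed.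

Lemma enorm0 : enorm (0 : 'rV[R]_n) = 0.
Proof. by rewrite /enorm dot0l sqrtr0. Qed.

Lemma enorm_eq0 a : enorm a = 0 -> a = 0.
Proof. by move=> a0; apply: dot_eq0; rewrite -enorm_sqr a0 expr0n. Qed.

Lemma enormZ k a : enorm (k *: a) = `|k| * enorm a.
Proof.
by rewrite /enorm dotZl dotZr mulrA -expr2 sqrtrM ?sqr_ge0// sqrtr_sqr.
Qed.

Lemma enormN a : enorm (- a) = enorm a.
Proof. by rewrite -scaleN1r enormZ normrN1 mul1r. Qed.

Lemma dot_le_enorm a b : `|dot a b| <= enorm a * enorm b.
Proof.
suff H (c d : 'rV[R]_n) : dot c d <= enorm c * enorm d.
  by rewrite ler_norml lerNl -dotNl -{1}(enormN a) !H.
have [c0|c0] := eqVneq (enorm c) 0.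
  by rewrite c0 mul0r (enorm_eq0 c0) dot0l.
have [d0|d0] := eqVneq (enorm d) 0.
  by rewrite d0 mulr0 (enorm_eq0 d0) dotC dot0l.
have cp : 0 < enorm c by rewrite lt_neqAle eq_sym c0 enorm_ge0.
have dp : 0 < enorm d by rewrite lt_neqAle eq_sym d0 enorm_ge0.
have := dot_ge0 ((enorm d) *: c - (enorm c) *: d).
rewrite !(dotDl, dotDr, dotNl, dotNr, dotZl, dotZr) -!enorm_sqr (dotC d c).
have cd : 0 < enorm c * enorm d by rewrite mulr_gt0.
move=> H; rewrite -(ler_pM2l cd); nra.
Qed.

Lemma enormD a b : enorm (a + b) <= enorm a + enorm b.
Proof.
rewrite -(@ler_pXn2r _ 2) ?nnegrE ?addr_ge0 ?enorm_ge0//.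
rewrite sqrrD !enorm_sqr !(dotDl, dotDr) (dotC b a).
have := le_trans (ler_norm _) (dot_le_enorm a b); lra.
Qed.

Lemma enorm_le a i : `|a 0 i| <= enorm a.
Proof.
rewrite -(@ler_pXn2r _ 2) ?nnegrE ?enorm_ge0// enorm_sqr real_normK ?num_real//.
rewrite /dot (bigD1 i)//= -expr2 lerDl sumr_ge0// => j _.
by rewrite -expr2 sqr_ge0.
Qed.

End enorm.

Section power.
Context {R : realType}.
Variable p : R.
Hypothesis p1 : 1 < p.

Let p0 : 0 < p. Proof. exact: lt_trans p1. Qed.
Let pn0 : p != 0. Proof. by rewrite gt_eqF. Qed.
Let powR1E (q : R) : 1 `^ q = 1. Proof. by rewrite powR1. Qed.

Lemma powR_split (x : R) : 0 <= x -> x `^ (p - 1) * x = x `^ p.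
Proof.
move=> x0; have [->|xn0] := eqVneq x 0; first by rewrite mulr0 powR0.
by rewrite -{2}(powRr1 x0) -powRD ?subrK// xn0 implybT.
Qed.

(** Young's inequality with exponents [p / (p - 1)] and [p] for [x^(p-1)] and [y]. Rearranged it is
    the tangent inequality, from which convexity follows without derivatives. *)
Lemma young_powR (x y : R) : 0 <= x -> 0 <= y ->
  p * (x `^ (p - 1) * y) <= (p - 1) * x `^ p + y `^ p.
Proof.
move=> x0 y0.
have q0 : 0 < p / (p - 1) by rewrite divr_gt0// subr_gt0.
have pq : (p / (p - 1))^-1 + p^-1 = 1.
  by rewrite invf_div -{2}[p^-1]mul1r -mulrDl subrK divff.
have := conjugate_powR (powR_ge0 x (p - 1)) y0 q0 p0 pq.
have p10 : p - 1 != 0 by rewrite subr_eq0 gt_eqF.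
rewrite -powRrM mulrCA divff// mulr1.
rewrite -(ler_pM2l p0) => /le_trans; apply.
rewrite [leLHS](_ : _ = (p - 1) * x `^ p + y `^ p)//.
by field; rewrite p10 pn0.
Qed.

Lemma tangent_powR (x y : R) : 0 <= x -> 0 <= y ->
  x `^ p + p * x `^ (p - 1) * (y - x) <= y `^ p.
Proof.
move=> x0 y0; have := young_powR x0 y0; have := powR_split x0; nra.
Qed.

Lemma midpoint_powR (x y : R) : 0 <= x -> 0 <= y ->
  ((x + y) / 2) `^ p <= (x `^ p + y `^ p) / 2.
Proof.
move=> x0 y0; have m0 : 0 <= (x + y) / 2 by rewrite divr_ge0// addr_ge0.
have := tangent_powR m0 x0; have := tangent_powR m0 y0.
set K := p * _; have -> : x - (x + y) / 2 = - (y - (x + y) / 2) by field.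
rewrite mulrN.
move: (K * _) => L; lra.
Qed.

Lemma le_powR (x y : R) : 0 <= x -> x <= y -> x `^ p <= y `^ p.
Proof.
move=> x0 xy; apply: ge0_ler_powR => //; rewrite ?nnegrE ?(ltW p0)//.
exact: le_trans xy.
Qed.

Lemma lt_powR (q x y : R) : 0 < q -> 0 <= x -> x < y -> x `^ q < y `^ q.
Proof.
move=> q0 x0 xy; apply: gt0_ltr_powR => //; rewrite nnegrE//.
by rewrite ltW// (le_lt_trans x0).
Qed.

Lemma powR_add_le (x y : R) : 0 <= x -> 0 <= y ->
  (x + y) `^ p <= 2 `^ p * (x `^ p + y `^ p).
Proof.
move=> x0 y0; have m0 : 0 <= (x + y) / 2 by rewrite divr_ge0// addr_ge0.
have e : x + y = 2 * ((x + y) / 2) by field.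
rewrite [in leLHS]e powRM// ler_wpM2l ?powR_ge0//.
apply: (le_trans (midpoint_powR x0 y0)).
by rewrite ler_pdivrMr// ler_peMr// ?addr_ge0 ?powR_ge0// ler1n.
Qed.

(** Three tangents: at 1 for [y], at [1 + t] for [x], at 1 for [1 + t]. The gain is the change of
    slope from 1 to [1 + t], times the excess of [x] over [1 + t], which is at least [t]. *)
Lemma strict_convexity_powR (t x y : R) : 0 < t -> 0 <= x -> 0 <= y ->
  x + y = 2 -> 1 + 2 * t <= x ->
  1 + p * t * ((1 + t) `^ (p - 1) - 1) / 2 <= (x `^ p + y `^ p) / 2.
Proof.
move=> t0 x0 y0 xy tx.
have t10 : 0 <= 1 + t by rewrite addr_ge0// ltW.
have := tangent_powR t10 x0; have := tangent_powR ler01 t10.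
have := tangent_powR ler01 y0; rewrite !powR1.
have K1 : 1 <= (1 + t) `^ (p - 1).
  rewrite -[leLHS](powRr0 (1 + t)) ler_powR ?subr_ge0 ?(ltW p1)//.
  by rewrite lerDl ltW.
set K := (1 + t) `^ (p - 1) in K1 *.
set A := x `^ p; set B := y `^ p; set C := (1 + t) `^ p => H1 H2 H3.
have h : p * ((K - 1) * (x - 1 - 2 * t)) >= 0.
  by rewrite mulr_ge0 ?(ltW p0)// mulr_ge0; lra.
have yE : y = 2 - x by lra.
rewrite yE in H1.
rewrite ler_pdivlMr// mulrDl mul1r mulfVK ?pnatr_eq0//.
have h2 : 0 <= p * ((K - 1) * t) by rewrite mulr_ge0 ?(ltW p0)// mulr_ge0 ?(ltW t0)//; lra.
nra.
Qed.

Section vector.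
Context {n : nat}.
Implicit Types a b : 'rV[R]_n.

Definition pw a : R := enorm a `^ p.

(** The pairing of [|a|^(p-2) a] with [b], that is [p^-1] times the derivative of [pw] at [a] in the
    direction [b]. *)
Definition flux a b : R := enorm a `^ (p - 2) * dot a b.

Definition defect a b : R := (pw a + pw b) / 2 - pw (2^-1 *: (a + b)).

Lemma pw_ge0 a : 0 <= pw a. Proof. exact: powR_ge0. Qed.

Lemma pw_eq0 a : pw a = 0 -> a = 0.
Proof. by move/powR_eq0_eq0/enorm_eq0. Qed.

Lemma pwD a b : pw (a + b) <= 2 `^ p * (pw a + pw b).
Proof.
apply: (le_trans (le_powR (enorm_ge0 _) (enormD a b))).
by apply: powR_add_le; exact: enorm_ge0.
Qed.

Lemma pwZ k a : pw (k *: a) = `|k| `^ p * pw a.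
Proof. by rewrite /pw enormZ powRM// enorm_ge0. Qed.

Lemma flux_bound a b : `|flux a b| <= enorm a `^ (p - 1) * enorm b.
Proof.
have [a0|a0] := eqVneq (enorm a) 0.
  by rewrite /flux (enorm_eq0 a0) dot0l mulr0 normr0 mulr_ge0 ?powR_ge0 ?enorm_ge0.
rewrite /flux normrM (ger0_norm (powR_ge0 _ _)).
rewrite (_ : p - 1 = p - 2 + 1); last by ring.
rewrite (powRD (r := p - 2)) ?a0 ?implybT// powRr1 ?enorm_ge0// -mulrA.
by rewrite ler_wpM2l ?powR_ge0// dot_le_enorm.
Qed.

Lemma flux_young a b : p * `|flux a b| <= (p - 1) * pw a + pw b.
Proof.
apply: (le_trans _ (young_powR (enorm_ge0 a) (enorm_ge0 b))).
by rewrite ler_pM2l// flux_bound.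
Qed.

Lemma flux_pw a : flux a a = pw a.
Proof.
have [a0|a0] := eqVneq (enorm a) 0.
  by rewrite /flux /pw (enorm_eq0 a0) dot0l mulr0 enorm0 powR0.
rewrite /flux -enorm_sqr -powR_mulrn ?enorm_ge0// -powRD ?subrK// ?a0 ?implybT//.
Qed.

Lemma fluxDr a b c : flux a (b + c) = flux a b + flux a c.
Proof. by rewrite /flux dotDr mulrDr. Qed.

Lemma fluxZr a k b : flux a (k *: b) = k * flux a b.
Proof. by rewrite /flux dotZr mulrCA. Qed.

Lemma fluxBr a b c : flux a (b - c) = flux a b - flux a c.
Proof. by rewrite fluxDr -scaleN1r fluxZr mulN1r. Qed.

Lemma pw_tangent a b : pw a + p * flux a (b - a) <= pw b.
Proof.
rewrite fluxBr flux_pw; have := flux_young a b.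
have : p * flux a b <= p * `|flux a b| by rewrite ler_pM2l// ler_norm.
move: (flux a b) `|flux a b| (pw a) (pw b) => f g A B; lra.
Qed.

(** The tangent at the far end [a + b]. It bounds increments from above, so that a first variation
    is obtained as a limit of fluxes. *)
Lemma pw_secant a b : pw (a + b) <= pw a + p * flux (a + b) b.
Proof.
have := pw_tangent (a + b) a; rewrite opprD addNKr -scaleN1r fluxZr.
by move: (flux _ _) (pw _) (pw _) => f A B; lra.
Qed.

Lemma half_diff a b : 2^-1 *: (a + b) - a = 2^-1 *: (b - a).
Proof. by apply/rowP => i; rewrite !mxE; field. Qed.

Lemma defect_ge0 a b : 0 <= defect a b.
Proof.
rewrite /defect subr_ge0; set m := 2^-1 *: (a + b).
have := pw_tangent m a; have := pw_tangent m b.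
have -> : b - m = - (a - m).
  by apply/rowP => i; rewrite !mxE; field.
rewrite -scaleN1r fluxZr.
by move: (flux _ _) (pw a) (pw b) (pw m) => f A B C; lra.
Qed.

(** The tangents at [a] and [b] are both evaluated at the midpoint, which differs from either end by
    half of [a - b]; adding them up produces the factor [4 / p]. *)
Lemma flux_monotone a b : 4 / p * defect a b <= flux a (a - b) - flux b (a - b).
Proof.
set m := 2^-1 *: (a + b).
have := pw_tangent a m; have := pw_tangent b m.
rewrite {1 3}/m half_diff (_ : m - b = 2^-1 *: (a - b)); last first.
  by rewrite /m [a + b]addrC half_diff.
rewrite -(opprB a b) -(scaleN1r (a - b)) !fluxZr /defect -/m.
rewrite mulrAC ler_pdivrMr//.
move: (flux a _) (flux b _) (pw m) (pw a) (pw b) => f g A B C; nra.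
Qed.

(** By the parallelogram law a large [a - b] has one of two effects. Either the midpoint is clearly
    shorter than the mean [N] of the two lengths, whose power is already at most the mean of the
    powers; or the lengths differ, and the strict convexity of the power applies. *)
Lemma defect_large (e : R) : 0 < e -> e <= 1 -> exists2 c, 0 < c & forall a b,
  e * (enorm a + enorm b) <= enorm (a - b) ->
  c * (enorm a + enorm b) `^ p <= defect a b.
Proof.
(* If the midpoint is longer than [(1 - th) N], the parallelogram law leaves
   [|x - y| >= (e / 2) (x + y) = e N], so that the longer vector has length at least
   [(1 + 2 t) N]. *)
move=> e0 e1; pose th := e ^+ 2 / 4; pose t := e / 4.
have th0 : 0 < th by rewrite divr_gt0// exprn_gt0.
have t0 : 0 < t by rewrite divr_gt0.
have th1 : th < 1.
  rewrite ltr_pdivrMr// mul1r (@le_lt_trans _ _ 1)// ?ltr1n//.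
  by rewrite expr_le1// ltW.
pose c1 := 1 - (1 - th) `^ p.
pose c2 := p * t * ((1 + t) `^ (p - 1) - 1) / 2.
have c10 : 0 < c1.
  by rewrite subr_gt0 -[ltRHS](powR1E p) lt_powR ?subr_ge0 ?(ltW th1)// gtrBl.
have c20 : 0 < c2.
  rewrite divr_gt0// mulr_gt0 ?mulr_gt0// subr_gt0 -[ltLHS](powR1E (p - 1)).
  by rewrite lt_powR ?subr_gt0// ltrDl.
exists (2^-1 `^ p * Num.min c1 c2).
  by rewrite mulr_gt0 ?powR_gt0 ?invr_gt0// lt_min c10.
move=> a b; set x := enorm a; set y := enorm b; set d := enorm (a - b) => ed.
have x0 : 0 <= x by exact: enorm_ge0.
have y0 : 0 <= y by exact: enorm_ge0.
have d0 : 0 <= d by exact: enorm_ge0.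
have [xy0|xy0] := eqVneq (x + y) 0.
  by rewrite xy0 powR0// mulr0 defect_ge0.
have s0 : 0 < x + y by rewrite lt_neqAle eq_sym xy0 addr_ge0.
pose N := (x + y) / 2; have N0 : 0 < N by rewrite divr_gt0.
have -> : 2^-1 `^ p * Num.min c1 c2 * (x + y) `^ p = Num.min c1 c2 * N `^ p.
  rewrite /N [in RHS]powRM ?invr_ge0 ?(ltW s0)//.
  by rewrite -!mulrA mulrCA [_ * (x + y) `^ p]mulrC.
set m := enorm (2^-1 *: (a + b)).
have parallelogram : m ^+ 2 = (x ^+ 2 + y ^+ 2) / 2 - d ^+ 2 / 4.
  rewrite /m /x /y /d !enorm_sqr !(dotZl, dotZr, dotDl, dotDr, dotNl, dotNr).
  by rewrite (dotC b a); field.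
have m0 : 0 <= m by exact: enorm_ge0.
have mid := midpoint_powR x0 y0; rewrite -/N in mid.
rewrite /defect /pw -/x -/y -/m.
have xd : x <= d + y by have := enormD (a - b) b; rewrite subrK.
have yd : y <= d + x.
  by have := enormD (b - a) a; rewrite subrK -(opprB a) enormN.
have NE : N = (x + y) / 2 by [].
clearbody N m d x y.
have [mN|mN] := leP m ((1 - th) * N).
  have : m `^ p <= ((1 - th) * N) `^ p by exact: le_powR.
  rewrite powRM ?subr_ge0 ?(ltW th1) ?(ltW N0)// => mp.
  have : Num.min c1 c2 * N `^ p <= c1 * N `^ p.
    by rewrite ler_wpM2r ?powR_ge0// ge_min lexx.
  move=> /le_trans; apply; rewrite /c1 mulrBl mul1r.
  by move: mid mp; move: (N `^ p) (m `^ p) ((x `^ p + y `^ p) / 2) (_ * _) => *; lra.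
have : Num.min c1 c2 * N `^ p <= c2 * N `^ p.
  by rewrite ler_wpM2r ?powR_ge0// ge_min lexx orbT.
move=> /le_trans; apply.
have m1 : m `^ p <= N `^ p.
  apply: le_powR => //; rewrite -(@ler_pXn2r _ 2) ?nnegrE ?(ltW N0)//.
  rewrite parallelogram NE.
  have : (x - y) ^+ 2 <= d ^+ 2.
    have : 0 <= (d - (x - y)) * (d + (x - y)) by apply: mulr_ge0; lra.
    lra.
  nra.
have dist : e / 2 * (x + y) <= `|x - y|.
  rewrite -(@ler_pXn2r _ 2) ?nnegrE ?mulr_ge0 ?divr_ge0 ?addr_ge0 ?(ltW e0)//.
  rewrite real_normK ?num_real//.
  have : ((1 - th) * N) ^+ 2 <= m ^+ 2.
    by rewrite ler_pXn2r ?nnegrE ?(ltW mN)// mulr_ge0 ?subr_ge0 ?(ltW th1) ?(ltW N0).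
  have : (e * (x + y)) ^+ 2 <= d ^+ 2.
    by rewrite ler_pXn2r ?nnegrE ?d0 ?mulr_ge0 ?(ltW e0) ?(ltW s0).
  have := sqr_ge0 (th * N); have := sqr_ge0 (e * (x + y)).
  rewrite parallelogram NE /th; lra.
suff : c2 * N `^ p <= (x `^ p + y `^ p) / 2 - N `^ p by move: m1; lra.
(* Division by [N] reduces to lengths with sum 2; the roles of [x] and [y] are exchanged according
   to which is longer. *)
have scale u v : 0 <= u -> 0 <= v -> u + v = x + y -> N * (1 + 2 * t) <= u ->
    c2 * N `^ p <= (u `^ p + v `^ p) / 2 - N `^ p.
  move=> u0 v0 uv Nu.
  have : 1 + c2 <= ((u / N) `^ p + (v / N) `^ p) / 2.
    apply: strict_convexity_powR => //.
    - by rewrite divr_ge0// ltW.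
    - by rewrite divr_ge0// ltW.
    - by rewrite -mulrDl uv NE invf_div mulrCA divff ?mulr1.
    - by rewrite ler_pdivlMr// mulrC.
  have Np : 0 < N `^ p by rewrite powR_gt0.
  have uE : u `^ p = N `^ p * (u / N) `^ p.
    by rewrite -powRM ?divr_ge0 ?(ltW N0)// mulrCA divff ?mulr1 ?gt_eqF.
  have vE : v `^ p = N `^ p * (v / N) `^ p.
    by rewrite -powRM ?divr_ge0 ?(ltW N0)// mulrCA divff ?mulr1 ?gt_eqF.
  rewrite uE vE -(ler_pM2l Np).
  by move: (N `^ p) (_ `^ p) (_ `^ p) => *; lra.
have [xy|xy] := leP y x.
  apply: scale => //; rewrite NE /t; move: dist; rewrite ger0_norm ?subr_ge0//; lra.
rewrite [X in X / 2]addrC; apply: scale => //; first by rewrite addrC.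
rewrite NE /t; move: dist; rewrite ltr0_norm ?subr_lt0//; lra.
Qed.

(* The alternative: either |a - b| is small with respect to |a| + |b|, or the
   defect controls the p-th powers. *)
Lemma uniform_convexity (e : R) : 0 < e -> exists2 C, 0 <= C & forall a b,
  pw (a - b) <= e * (pw a + pw b) + C * defect a b.
Proof.
(* [h] satisfies [h^p 2^p <= e], and is at most 1 as [defect_large] requires. *)
move=> e0; pose h := Num.min 1 (e `^ p^-1 / 2).
have h0 : 0 < h by rewrite lt_min ltr01 divr_gt0// powR_gt0.
have h1 : h <= 1 by rewrite ge_min lexx.
have [c c0 cP] := defect_large h0 h1; exists c^-1; first by rewrite invr_ge0 ltW.
move=> a b; have s0 : 0 <= enorm a + enorm b by rewrite addr_ge0 ?enorm_ge0.
have [small|/ltW large] := leP (enorm (a - b)) (h * (enorm a + enorm b)).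
  apply: ler_wpDr; first by rewrite mulr_ge0 ?invr_ge0 ?(ltW c0) ?defect_ge0.
  apply: (le_trans (le_powR (enorm_ge0 _) small)).
  rewrite powRM ?(ltW h0)//.
  have : h `^ p <= e / 2 `^ p.
    apply: (@le_trans _ _ ((e `^ p^-1 / 2) `^ p)).
      by apply: le_powR; [exact: ltW|rewrite ge_min lexx orbT].
    rewrite powRM ?powR_ge0 ?invr_ge0// -powRrM mulVf// powRr1 ?(ltW e0)//.
    by rewrite -powR_inv1// -powRrM mulN1r powRN.
  move=> hp; apply: (le_trans (ler_pM (powR_ge0 _ _) (powR_ge0 _ _) hp
    (powR_add_le (enorm_ge0 a) (enorm_ge0 b)))).
  by rewrite mulrA mulfVK ?gt_eqF ?powR_gt0.
apply: ler_wpDl; first by rewrite mulr_ge0 ?addr_ge0 ?pw_ge0 ?(ltW e0).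
rewrite mulrC ler_pdivlMr// mulrC.
apply: le_trans (cP _ _ large); rewrite ler_pM2l//; apply: le_powR; first exact: enorm_ge0.
by rewrite (le_trans (enormD _ _))// enormN.
Qed.

End vector.
End power.

(** * Young's inequality with a parameter *)

Section young.
Context {R : realType} {n : nat}.
Variable p : R.
Hypothesis p1 : 1 < p.
Implicit Types a b : 'rV[R]_n.

Let p0 : 0 < p. Proof. exact: lt_trans p1. Qed.

(** Young's inequality for [a] and [s *: b], divided by [p * s]. Small [s] favours the term in [b],
    large [s] the one in [a]; the two lemmas below solve for [s]. *)
Lemma flux_young_scaled (s : R) a b : 0 < s ->
  `|flux p a b| <= (p - 1) / (p * s) * pw p a + s `^ (p - 1) / p * pw p b.
Proof.
move=> s0; have := flux_young p1 a (s *: b).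
rewrite fluxZr normrM (gtr0_norm s0) pwZ (gtr0_norm s0) -(powR_split p1 (ltW s0)).
move: `|flux p a b| (pw p a) (pw p b) (s `^ (p - 1)) => f A B S H.
have ps : 0 < p * s by rewrite mulr_gt0.
rewrite -(ler_pM2l ps) (le_trans _ (le_trans H _))//; first by rewrite mulrA.
rewrite le_eqVlt; apply/orP; left; apply/eqP; field.
by rewrite !gt_eqF.
Qed.

Lemma flux_young_right (e : R) : 0 < e -> exists2 K, 0 <= K &
  forall a b, `|flux p a b| <= K * pw p a + e * pw p b.
Proof.
move=> e0; pose s := (p * e) `^ (p - 1)^-1.
have s0 : 0 < s by rewrite powR_gt0// mulr_gt0.
exists ((p - 1) / (p * s)).
  by rewrite divr_ge0 ?subr_ge0 ?(ltW p1)// mulr_ge0 ?(ltW p0)// ltW.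
move=> a b; have := flux_young_scaled a b s0.
have -> : s `^ (p - 1) / p = e; last by [].
rewrite /s -powRrM mulVf ?subr_eq0 ?(gt_eqF p1)// powRr1.
  by rewrite mulrAC divff ?gt_eqF// mul1r.
by rewrite mulr_ge0 ?(ltW e0) ?(ltW p0).
Qed.

Lemma flux_young_left (e : R) : 0 < e -> exists2 K, 0 <= K &
  forall a b, `|flux p a b| <= e * pw p a + K * pw p b.
Proof.
move=> e0; pose s := (p - 1) / (p * e).
have s0 : 0 < s by rewrite divr_gt0 ?subr_gt0 ?mulr_gt0.
exists (s `^ (p - 1) / p).
  by rewrite divr_ge0 ?powR_ge0 ?(ltW p0).
move=> a b; have := flux_young_scaled a b s0.
have -> : (p - 1) / (p * s) = e; last by [].
rewrite /s; field; rewrite subr_eq0 !gt_eqF//.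
Qed.
End young.

(** * Pointwise limits of powers and fluxes *)

Section limits.
Context {R : realType} {n : nat}.

Lemma powR_cvg_gt0 (x : R^nat) (l q : R) : 0 < l ->
  x k @[k --> \oo] --> l -> x k `^ q @[k --> \oo] --> l `^ q.
Proof.
move=> lp xl.
have cq : {for l, continuous (@powR R ^~ q)}.
  apply: differentiable_continuous; apply/derivable1_diffP.
  by apply: derivable_powR; rewrite in_itv/= lp.
exact: (continuous_cvg _ cq xl).
Qed.

Lemma powR_cvg_nneg (x : R^nat) (l q : R) : 0 < q -> (forall k, 0 <= x k) ->
  x k @[k --> \oo] --> l -> x k `^ q @[k --> \oo] --> l `^ q.
Proof.
move=> q0 x0 xl.
have l0 : 0 <= l.
  by rewrite -(cvg_lim _ xl)//; apply: limr_ge; [exact: cvgP xl|exact: nearW].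
have [l00|ln0] := eqVneq l 0.
  rewrite l00 powR0 ?gt_eqF//; rewrite l00 in xl.
  apply/cvgrPdist_lt => e e0; near=> k.
  rewrite sub0r normrN ger0_norm ?powR_ge0//.
  rewrite (_ : e = (e `^ q^-1) `^ q); last first.
    by rewrite -powRrM mulVf ?gt_eqF// powRr1// ltW.
  apply: lt_powR => //; near: k.
  by apply: (cvgr_lt _ xl); rewrite powR_gt0.
have lp : 0 < l by rewrite lt_neqAle eq_sym ln0.
exact: powR_cvg_gt0.
Unshelve. all: by end_near. Qed.

Variables (a : ('rV[R]_n)^nat) (b : 'rV[R]_n).
Hypothesis ab : forall i, a k 0 i @[k --> \oo] --> b 0 i.

Lemma dot_cvg c : dot (a k) c @[k --> \oo] --> dot b c.
Proof.
by apply: cvg_bigsum => i; apply: cvgM; [exact: ab|exact: cvg_cst].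
Qed.

Lemma enorm_cvg : enorm (a k) @[k --> \oo] --> enorm b.
Proof.
have H : dot (a k) (a k) @[k --> \oo] --> dot b b.
  by apply: cvg_bigsum => i; apply: cvgM; exact: ab.
by apply: (cvg_comp _ _ H); exact: sqrt_continuous.
Qed.

Lemma pw_cvg (p : R) : 0 < p -> pw p (a k) @[k --> \oo] --> pw p b.
Proof.
move=> p0; apply: powR_cvg_nneg => // [k|]; [exact: enorm_ge0|exact: enorm_cvg].
Qed.

Lemma flux_cvg (p : R) c : 1 < p -> flux p (a k) c @[k --> \oo] --> flux p b c.
Proof.
move=> p1; have [b0|bn0] := eqVneq (enorm b) 0; last first.
  apply: cvgM; last exact: dot_cvg.
  apply: powR_cvg_gt0; last exact: enorm_cvg.
  by rewrite lt_neqAle eq_sym bn0 enorm_ge0.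
(* [p - 2] may be negative: at [b = 0] the product is dominated through [enorm (a k) ^ (p - 1)],
   whose exponent is positive. *)
rewrite /flux [X in _ --> _ * dot X _](enorm_eq0 b0) dot0l mulr0.
have H : enorm (a k) `^ (p - 1) * enorm c @[k --> \oo] --> (0 : R).
  rewrite -[X in _ --> X](mul0r (enorm c)); apply: cvgM; last exact: cvg_cst.
  rewrite -[X in _ --> X](@powR0 _ (p - 1)) ?subr_eq0 ?(gt_eqF p1)// -b0.
  apply: powR_cvg_nneg; [by rewrite subr_gt0|by move=> k; exact: enorm_ge0|].
  exact: enorm_cvg.
apply/norm_cvg0P; apply: (squeeze_cvgr _ _ H); last exact: (@cvg_cst _ (0 : R)).
by apply: nearW => k; rewrite normr_ge0 /= flux_bound.
Qed.

End limits.

(** * Energies of vector fields *)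

(** Arithmetic of the continuity of the energy: [E0] and [Ek] are the energies of the limit and of a
    term, [h] that of their difference, [f] and [g] the fluxes at the limit and at the term against
    this difference, [P] the constant of the quasi-triangle inequality. *)
Lemma En_cvg_arith {R : realType} (p e E0 Ek h P K f g : R) : 0 < p -> 0 <= e ->
  0 <= E0 -> 0 <= h -> 0 <= P ->
  E0 + p * f <= Ek -> Ek <= E0 + p * g -> Ek <= P * (E0 + h) ->
  `|g| <= e * Ek + K * h -> `|f| <= e * E0 + K * h ->
  `|Ek - E0| <= e * (p * (P * E0 + E0)) + p * (e * P + K) * h.
Proof.
move=> p0 e0 E00 h0 P0 tg sc Bk /(le_trans (ler_norm _)) gb.
rewrite ler_norml => /andP[fb _].
have pf : p * - (e * E0 + K * h) <= p * f by rewrite ler_pM2l.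
have pg : p * g <= p * (e * Ek + K * h) by rewrite ler_pM2l.
have pk : p * (e * Ek) <= p * (e * (P * (E0 + h))).
  by rewrite ler_pM2l// ler_wpM2l.
have pz : 0 <= p * (e * E0) by rewrite !mulr_ge0// ltW.
have pz2 : 0 <= p * (e * (P * (E0 + h))).
  by rewrite mulr_ge0 ?(ltW p0)// mulr_ge0// mulr_ge0// addr_ge0.
rewrite ler_norml; apply/andP; split; lra.
Qed.

Lemma geometric_diff_cvg {R : realType} (u : R^nat) (c : R) :
  (forall k, `|u k.+1 - u k| <= c / (2 ^ k.+1)%:R) -> cvgn u.
Proof.
move=> uc.
have H : cvgn (series (telescope u)).
  apply: (@normed_cvg R R^o); rewrite /normed_series_of.
  apply: (@series_le_cvg _ _ (geometric (`|c| / 2) 2^-1)).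
  - by move=> k /=; exact: normr_ge0.
  - by move=> k /=; rewrite mulr_ge0 ?divr_ge0 ?exprn_ge0 ?invr_ge0.
  - move=> k /=; apply: (le_trans (uc k)).
    rewrite expnS natrM natrX invfM mulrA exprVn.
    by rewrite ler_wpM2r ?invr_ge0 ?exprn_ge0// ler_wpM2r ?invr_ge0// ler_norm.
  - by apply: is_cvg_geometric_series; rewrite ger0_norm ?invr_ge0// invf_lt1// ltr1n.
rewrite (_ : u = (fun k => series (telescope u) k + u 0%N)); last first.
  by apply/funext => k; rewrite telescopeK /= subrK.
by apply: is_cvgD => //; exact: is_cvg_cst.
Qed.

Section fields.
Context {R : realType} d (T : measurableType d) (mu : {measure set T -> \bar R}).
Variables (D : set T) (p : R) (n : nat).
Implicit Types A B C : T -> 'rV[R]_n.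

Definition energy A : \bar R := (\int[mu]_(x in D) (pw p (A x))%:E)%E.
Definition En A : R := \int[mu]_(x in D) pw p (A x).
Definition Fl A B : R := \int[mu]_(x in D) flux p (A x) (B x).

Hypothesis mD : measurable D.
Hypothesis p1 : 1 < p.
(** The intended fields are [sqrtmx (Q x)] times a measurable field. Measurability is asked of their
    dot products only, which suffices for [pw] and [flux]. *)
Variable M : set (T -> 'rV[R]_n).
Hypothesis M_comb : forall A B (k : R), M A -> M B -> M (fun x => A x + k *: B x).
Hypothesis M_dot : forall A B, M A -> M B ->
  measurable_fun D (fun x => dot (A x) (B x)).

Definition finE A := M A /\ (energy A < +oo)%E.

Let p0 : 0 < p. Proof. exact: lt_trans p1. Qed.

Lemma add_scaleN1E A B : (fun x => A x + -1 *: B x) = (fun x => A x - B x).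
Proof. by apply/funext => x; rewrite scaleN1r. Qed.

Lemma add_scale1BE A B : (fun x => B x + 1 *: (A x - B x)) = A.
Proof. by apply/funext => x; rewrite scale1r addrC subrK. Qed.

Lemma M_sub A B : M A -> M B -> M (fun x => A x - B x).
Proof.
by move=> MA MB; have := M_comb (-1) MA MB; rewrite add_scaleN1E.
Qed.

Lemma powR_enormE (a : 'rV[R]_n) q : enorm a `^ q = dot a a `^ (2^-1 * q).
Proof. by rewrite powRrM powR12_sqrt// dot_ge0. Qed.

Lemma measurable_enorm_powR A q : M A -> measurable_fun D (fun x => enorm (A x) `^ q).
Proof.
move=> MA; under eq_fun do rewrite powR_enormE.
apply: (measurableT_comp (measurable_powR (2^-1 * q))); exact: M_dot.
Qed.

Lemma measurable_pw A : M A -> measurable_fun D (fun x => pw p (A x)).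
Proof. exact: measurable_enorm_powR. Qed.

Lemma measurable_flux A B : M A -> M B ->
  measurable_fun D (fun x => flux p (A x) (B x)).
Proof.
move=> MA MB; apply: measurable_funM; first exact: measurable_enorm_powR.
exact: M_dot.
Qed.

Lemma integrable_pw A : finE A -> mu.-integrable D (EFin \o (fun x => pw p (A x))).
Proof.
move=> [MA EA]; apply/integrableP; split.
  by apply/measurable_EFinP; exact: measurable_pw.
by under eq_integral do rewrite /= ger0_norm ?pw_ge0//.
Qed.

Lemma energyE A : finE A -> energy A = (En A)%:E.
Proof.
move=> fA; rewrite /En /Rintegral fineK//.
by have := integrable_fin_num mD (integrable_pw fA).
Qed.

Lemma le_integrable_real (f g : T -> R) : measurable_fun D f ->
  (forall x, D x -> `|f x| <= g x) -> mu.-integrable D (EFin \o g) ->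
  mu.-integrable D (EFin \o f).
Proof.
move=> mf fg; apply: le_integrable => //; first exact/measurable_EFinP.
move=> x Dx /=; rewrite lee_fin; apply: (le_trans (fg x Dx)); exact: ler_norm.
Qed.

Lemma integrable_comb (f g : T -> R) (k l : R) : mu.-integrable D (EFin \o f) ->
  mu.-integrable D (EFin \o g) ->
  mu.-integrable D (EFin \o (fun x => k * f x + l * g x)).
Proof.
move=> intf intg; rewrite (_ : EFin \o _ =
  ((fun x => k%:E * (EFin \o f) x) \+ (fun x => l%:E * (EFin \o g) x))%E)//.
by apply: integrableD => //; exact: integrableZl.
Qed.

Lemma integrable_scale (f : T -> R) (k : R) : mu.-integrable D (EFin \o f) ->
  mu.-integrable D (EFin \o (fun x => k * f x)).
Proof.
move=> intf; rewrite (_ : EFin \o _ = (fun x => k%:E * (EFin \o f) x)%E)//.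
exact: integrableZl.
Qed.

Lemma integrable_sub (f g : T -> R) : mu.-integrable D (EFin \o f) ->
  mu.-integrable D (EFin \o g) -> mu.-integrable D (EFin \o (fun x => f x - g x)).
Proof.
move=> intf intg.
rewrite (_ : EFin \o _ = (EFin \o (fun x => 1 * f x + -1 * g x))).
  exact: integrable_comb.
by apply/funext => x /=; rewrite mul1r mulN1r.
Qed.

Lemma integrable_finE A : M A -> mu.-integrable D (EFin \o (fun x => pw p (A x))) ->
  finE A.
Proof.
move=> MA /integrableP[_ intA]; split => //; apply: le_lt_trans intA.
by rewrite le_eqVlt; apply/orP; left; apply/eqP/eq_integral => x _; rewrite /= ger0_norm ?pw_ge0.
Qed.

Lemma finE_comb A B k : finE A -> finE B -> finE (fun x => A x + k *: B x).
Proof.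
move=> fA fB; apply: integrable_finE; first by apply: M_comb; [exact: fA.1|exact: fB.1].
apply: (le_integrable_real _ _ (integrable_comb (2 `^ p) (2 `^ p * `|k| `^ p)
  (integrable_pw fA) (integrable_pw fB))).
  by apply: measurable_pw; apply: M_comb; [exact: fA.1|exact: fB.1].
move=> x _; rewrite ger0_norm ?pw_ge0// -mulrA -mulrDr -pwZ.
exact: pwD.
Qed.

Lemma integrable_flux A B : finE A -> finE B ->
  mu.-integrable D (EFin \o (fun x => flux p (A x) (B x))).
Proof.
move=> fA fB; have [K K0 HK] := @flux_young_left R n p p1 1 ltr01.
apply: (le_integrable_real _ _ (integrable_comb 1 K
  (integrable_pw fA) (integrable_pw fB))) => [|x _]; last exact: HK.
by apply: measurable_flux; [exact: fA.1|exact: fB.1].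
Qed.

Lemma Rintegral_comb (f g : T -> R) (k l : R) : mu.-integrable D (EFin \o f) ->
  mu.-integrable D (EFin \o g) ->
  \int[mu]_(x in D) (k * f x + l * g x) =
  k * \int[mu]_(x in D) f x + l * \int[mu]_(x in D) g x.
Proof.
move=> intf intg; rewrite RintegralD ?RintegralZl//.
  by have := integrableZl mD k intf.
by have := integrableZl mD l intg.
Qed.

Lemma En_ge0 A : 0 <= En A.
Proof. by apply: Rintegral_ge0 => x _; exact: pw_ge0. Qed.

Lemma Fl_comb A B C k : finE A -> finE B -> finE C ->
  Fl A (fun x => B x + k *: C x) = Fl A B + k * Fl A C.
Proof.
move=> fA fB fC; rewrite -[Fl A B]mul1r -Rintegral_comb ?integrable_flux//.
by apply: eq_Rintegral => x _; rewrite mul1r fluxDr fluxZr.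
Qed.

Lemma Fl_diag A : Fl A A = En A.
Proof. by apply: eq_Rintegral => x _; rewrite flux_pw. Qed.

Lemma abs_Fl_le A B c e : finE A -> finE B ->
  (forall a b : 'rV_n, `|flux p a b| <= c * pw p a + e * pw p b) ->
  `|Fl A B| <= c * En A + e * En B.
Proof.
move=> fA fB H; rewrite -Rintegral_comb ?integrable_pw//.
apply: (le_trans (le_normr_Rintegral mD (integrable_flux fA fB))).
apply: le_Rintegral => //.
- by have := integrable_abse (integrable_flux fA fB).
- exact: integrable_comb (integrable_pw fA) (integrable_pw fB).
Qed.

Lemma Fl_young_left (e : R) : 0 < e -> exists2 K, 0 <= K & forall A B,
  finE A -> finE B -> `|Fl A B| <= e * En A + K * En B.
Proof.
move=> /(@flux_young_left _ n _ p1)[K K0 HK]; exists K => // A B fA fB.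
exact: abs_Fl_le.
Qed.

Lemma Fl_young_right (e : R) : 0 < e -> exists2 K, 0 <= K & forall A B,
  finE A -> finE B -> `|Fl A B| <= K * En A + e * En B.
Proof.
move=> /(@flux_young_right _ n _ p1)[K K0 HK]; exists K => // A B fA fB.
exact: abs_Fl_le.
Qed.

Lemma le_EnD A B k : finE A -> finE B ->
  En (fun x => A x + k *: B x) <= 2 `^ p * (En A + `|k| `^ p * En B).
Proof.
move=> fA fB; rewrite mulrDr mulrA -Rintegral_comb ?integrable_pw//.
apply: le_Rintegral => //.
- exact/integrable_pw/finE_comb.
- exact: integrable_comb (integrable_pw fA) (integrable_pw fB).
- by move=> x _; rewrite -mulrA -mulrDr -pwZ; exact: pwD.
Qed.

Lemma EnZ A k : finE A -> En (fun x => k *: A x) = `|k| `^ p * En A.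
Proof.
move=> fA; rewrite -RintegralZl//; last exact: integrable_pw.
by apply: eq_Rintegral => x _; rewrite pwZ.
Qed.

Lemma En_secant A B k : finE A -> finE B ->
  En (fun x => A x + k *: B x) <= En A + p * k * Fl (fun x => A x + k *: B x) B.
Proof.
move=> fA fB; have fC := finE_comb k fA fB.
rewrite -[En A]mul1r -Rintegral_comb ?integrable_pw ?integrable_flux//.
apply: le_Rintegral => //; first exact: integrable_pw.
- by apply: integrable_comb; [exact: integrable_pw|exact: integrable_flux].
- move=> x _; rewrite mul1r -mulrA -fluxZr; exact: pw_secant.
Qed.

Lemma En_tangent A B k : finE A -> finE B ->
  En A + p * k * Fl A B <= En (fun x => A x + k *: B x).
Proof.
move=> fA fB; have fC := finE_comb k fA fB.
rewrite -[En A]mul1r -Rintegral_comb ?integrable_pw ?integrable_flux//.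
apply: le_Rintegral => //; last first.
  move=> x _; rewrite mul1r -mulrA -fluxZr.
  by have := pw_tangent p1 (A x) (A x + k *: B x); rewrite addrAC subrr add0r.
- exact: integrable_pw.
- by apply: integrable_comb; [exact: integrable_pw|exact: integrable_flux].
Qed.

Lemma finE_sub A B : finE A -> finE B -> finE (fun x => A x - B x).
Proof.
by move=> fA fB; have := finE_comb (-1) fA fB; rewrite add_scaleN1E.
Qed.

Lemma finE_scale A k : finE A -> finE (fun x => k *: A x).
Proof.
move=> fA; have := finE_comb (k - 1) fA fA.
by congr finE; apply/funext => x; rewrite scalerBl scale1r addrCA subrr addr0.
Qed.

Lemma finE_mid A B : finE A -> finE B -> finE (fun x => 2^-1 *: (A x + B x)).
Proof.
move=> fA fB; have := finE_scale 2^-1 (finE_comb 1 fA fB).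
by congr finE; apply/funext => x; rewrite scale1r.
Qed.

Lemma le_EnB A B : finE A -> finE B ->
  En (fun x => A x - B x) <= 2 `^ p * (En A + En B).
Proof.
move=> fA fB; have := le_EnD (-1) fA fB.
by rewrite normrN1 powR1 mul1r add_scaleN1E.
Qed.

Lemma Fl_sub A B C : finE A -> finE B -> finE C ->
  Fl A (fun x => B x - C x) = Fl A B - Fl A C.
Proof.
move=> fA fB fC; have := Fl_comb (-1) fA fB fC; rewrite mulN1r => <-.
by rewrite add_scaleN1E.
Qed.

(** Young's inequality yields errors of this shape, with [K] depending on [d]: [d] is fixed first,
    and then [k] is taken large. *)
Lemma young_cvg (x e : R^nat) (l c : R) :
  (forall d, 0 < d -> exists2 K, 0 <= K & forall k, `|x k - l| <= d * c + K * e k) ->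
  e k @[k --> \oo] --> (0 : R) -> x k @[k --> \oo] --> l.
Proof.
move=> H e0; apply/cvgrPdist_lt => r r0.
have c1 : 0 < `|c| + 1 by rewrite ltr_wpDl.
have d0 : 0 < r / 2 / (`|c| + 1) by rewrite !divr_gt0.
have [K K0 HK] := H _ d0; have K1 : 0 < K + 1 by rewrite ltr_wpDl.
near=> k; rewrite distrC; apply: (le_lt_trans (HK k)).
have e1 : `|e k| < r / 2 / (K + 1).
  rewrite -normrN -[- _]add0r; near: k.
  by move/cvgrPdist_lt : e0; apply; rewrite !divr_gt0.
have h1 : r / 2 / (`|c| + 1) * c <= r / 2.
  rewrite -mulrA ler_piMr ?divr_ge0 ?(ltW r0)//.
  rewrite mulrC ler_pdivrMr// mul1r (le_trans (ler_norm c))// lerDl//.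
have h2 : K * e k < r / 2.
  apply: (@le_lt_trans _ _ ((K + 1) * `|e k|)).
    apply: (@le_trans _ _ (K * `|e k|)); first by rewrite ler_wpM2l// ler_norm.
    by rewrite ler_wpM2r// lerDl.
  by rewrite -ltr_pdivlMl// mulrC.
by rewrite [ltRHS](splitr r) ler_ltD.
Unshelve. all: by end_near. Qed.

Section convergence.
Variables (B : nat -> T -> 'rV[R]_n) (B0 : T -> 'rV[R]_n).
Hypotheses (fB : forall k, finE (B k)) (fB0 : finE B0)
  (BB0 : En (fun x => B k x - B0 x) @[k --> \oo] --> (0 : R)).

Lemma Fl_cvg_r A : finE A -> Fl A (B k) @[k --> \oo] --> Fl A B0.
Proof.
move=> fA; apply: (@young_cvg _ _ _ (En A) _ BB0) => d' d0.
have [K K0 HK] := Fl_young_left d0; exists K => // k.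
by rewrite -(Fl_sub fA (fB k) fB0); exact: HK fA (finE_sub (fB k) fB0).
Qed.

(** Tangent at the limit from below, tangent at the term from above; in both fluxes the second
    argument is the small difference. *)
Lemma En_cvg : En (B k) @[k --> \oo] --> En B0.
Proof.
apply: (@young_cvg _ _ _ (p * (2 `^ p * En B0 + En B0)) _ BB0) => e e0.
have [K K0 HK] := Fl_young_left e0.
exists (p * (e * 2 `^ p + K)).
  by rewrite mulr_ge0 ?(ltW p0)// addr_ge0// mulr_ge0 ?powR_ge0 ?(ltW e0).
move=> k; set ek := En (fun x => B k x - B0 x).
have fek := finE_sub (fB k) fB0.
have Bk : En (B k) <= 2 `^ p * (En B0 + ek).
  by have := le_EnD 1 fB0 fek; rewrite normr1 powR1 mul1r add_scale1BE.
have tg : En B0 + p * Fl B0 (fun x => B k x - B0 x) <= En (B k).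
  by have := En_tangent 1 fB0 fek; rewrite mulr1 add_scale1BE.
have sc : En (B k) <= En B0 + p * Fl (B k) (fun x => B k x - B0 x).
  by have := En_secant 1 fB0 fek; rewrite mulr1 add_scale1BE.
have P0 : 0 <= 2 `^ p :> R by exact: powR_ge0.
exact: (En_cvg_arith p0 (ltW e0) (En_ge0 _) (En_ge0 _) P0 tg sc Bk
  (HK _ _ (fB k) fek) (HK _ _ fB0 fek)).
Qed.

End convergence.

Lemma integral_defect A B : finE A -> finE B ->
  mu.-integrable D (EFin \o (fun x => defect p (A x) (B x))) /\
  \int[mu]_(x in D) defect p (A x) (B x) =
    (En A + En B) / 2 - En (fun x => 2^-1 *: (A x + B x)).
Proof.
move=> fA fB; have fm := finE_mid fA fB.
have H1 := integrable_comb 2^-1 2^-1 (integrable_pw fA) (integrable_pw fB).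
have H2 := integrable_comb 1 (-1) H1 (integrable_pw fm).
have -> : (fun x => defect p (A x) (B x)) = (fun x =>
    1 * (2^-1 * pw p (A x) + 2^-1 * pw p (B x)) + -1 * pw p (2^-1 *: (A x + B x))).
  by apply/funext => x; rewrite /defect mul1r mulN1r -mulrDr mulrC.
split; first exact: H2.
rewrite Rintegral_comb ?integrable_pw// Rintegral_comb ?integrable_pw//.
by rewrite mul1r mulN1r -mulrDr mulrC.
Qed.

Lemma En_midpoint A B : finE A -> finE B ->
  En (fun x => 2^-1 *: (A x + B x)) <= (En A + En B) / 2.
Proof.
move=> fA fB; rewrite -subr_ge0 -(integral_defect fA fB).2.
by apply: Rintegral_ge0 => x _; exact: defect_ge0.
Qed.

Lemma En_uniform_convexity (e : R) : 0 < e -> exists2 K, 0 <= K & forall A B,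
  finE A -> finE B -> En (fun x => A x - B x) <=
    e * (En A + En B) + K * ((En A + En B) / 2 - En (fun x => 2^-1 *: (A x + B x))).
Proof.
move=> e0; have [K K0 HK] := @uniform_convexity R p p1 n e e0; exists K => // A B fA fB.
have [id dE] := integral_defect fA fB.
have H1 := integrable_comb e e (integrable_pw fA) (integrable_pw fB).
rewrite -dE -[e * _]mul1r mulrDr -Rintegral_comb ?integrable_pw// -Rintegral_comb//.
apply: le_Rintegral => //; first exact/integrable_pw/finE_sub.
  exact: integrable_comb.
by move=> x _; rewrite mul1r -mulrDr; exact: HK.
Qed.

Lemma Fl_monotone A B : finE A -> finE B ->
  4 / p * ((En A + En B) / 2 - En (fun x => 2^-1 *: (A x + B x))) <=
  Fl A (fun x => A x - B x) - Fl B (fun x => A x - B x).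
Proof.
move=> fA fB; have [id dE] := integral_defect fA fB; have fs := finE_sub fA fB.
rewrite -dE -RintegralZl// -RintegralB ?integrable_flux//.
apply: le_Rintegral => //.
- exact: integrable_scale.
- by apply: integrable_sub; exact: integrable_flux.
- by move=> x _; exact: flux_monotone.
Qed.

(** Continuity in the left argument along one segment is enough for the first variation. Young's and
    the quasi-triangle inequality provide a dominating function. *)
Lemma Fl_cvg_l A B : finE A -> finE B ->
  Fl (fun x => A x + k.+1%:R^-1 *: B x) B @[k --> \oo] --> Fl A B.
Proof.
move=> fA fB.
have fk k := finE_comb (k.+1%:R^-1) fA fB.
have [K K0 HK] := @flux_young_left R n p p1 1 ltr01.
pose g x := 2 `^ p * pw p (A x) + (2 `^ p + K) * pw p (B x).
have ig : mu.-integrable D (EFin \o g).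
  exact: integrable_comb (integrable_pw fA) (integrable_pw fB).
pose s k : R := k.+1%:R^-1.
have s1 k : `|s k| `^ p <= 1.
  have s01 : 0 <= s k <= 1 by rewrite invr_ge0 ler0n/= invf_le1// ler1n.
  have /andP[s00 s11] := s01.
  have := le_powR p1 (normr_ge0 (s k)) (_ : `|s k| <= 1).
  by rewrite powR1; apply; rewrite ger0_norm.
have lim x : flux p (A x + s k *: B x) (B x) @[k --> \oo] --> flux p (A x) (B x).
  apply: flux_cvg => // i.
  rewrite (_ : (fun k => _) = (fun k => A x 0 i + s k * B x 0 i)); last first.
    by apply/funext => k; rewrite 2!mxE.
  suff : A x 0 i + s k * B x 0 i @[k --> \oo] --> A x 0 i + 0 * B x 0 i.
    by rewrite mul0r addr0.
  apply: cvgD; first exact: cvg_cst.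
  by apply: cvgM; [exact: cvg_harmonic|exact: cvg_cst].
have dom x k : D x -> (`|(flux p (A x + s k *: B x) (B x))%:E| <= (EFin \o g) x)%E.
  move=> _ /=; rewrite lee_fin (le_trans (HK _ _))// mul1r /g mulrDl addrA lerD2r.
  rewrite (le_trans (pwD p1 _ _))// mulrDr lerD2l ler_wpM2l ?powR_ge0//.
  by rewrite pwZ ler_piMl ?pw_ge0.
have mf k := (measurable_EFinP _ _).2 (measurable_flux (fk k).1 fB.1).
have mf0 := (measurable_EFinP _ _).2 (measurable_flux fA.1 fB.1).
have lim' x : D x -> (flux p (A x + s k *: B x) (B x))%:E @[k --> \oo] -->
    (flux p (A x) (B x))%:E.
  by move=> _; apply: cvg_EFin; [exact: nearW|exact: lim].
have [_ _ cv] := @dominated_convergence _ _ _ mu D mD _ _ (EFin \o g) mf mf0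
  (aeW _ lim') ig (aeW _ dom).
have := fine_cvg; apply.
rewrite fineK; first exact: cv.
by have := integrable_fin_num mD (integrable_flux fA fB).
Qed.

Lemma En_eq0 A : finE A -> En A = 0 -> {ae mu, forall x, D x -> A x = 0}.
Proof.
move=> fA A0; have mA := measurable_pw fA.1.
have : (\int[mu]_(x in D) `|(pw p (A x))%:E| = 0)%E.
  under eq_integral do rewrite /= ger0_norm ?pw_ge0//.
  by rewrite -/(energy A) energyE// A0.
move/ae_eq_integral_abs => /(_ mD) H.
have /H : measurable_fun D (fun x => (pw p (A x))%:E) by exact/measurable_EFinP.
by apply: filterS => x Hx Dx; apply: (@pw_eq0 _ p); have [] := Hx Dx.
Qed.

(** * Completeness *)

Section completeness.
Variable A : nat -> T -> 'rV[R]_n.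
Hypothesis fA : forall k, finE (A k).
Hypothesis cauchyA : forall e, 0 < e -> exists N, forall k l, (N <= k)%N ->
  (N <= l)%N -> En (fun x => A k x - A l x) < e.

(** Riesz-Fischer without Minkowski's inequality: the consecutive differences, rescaled by
    [2^(k+1)], still have summable energies. At almost every point the p-th powers are then
    summable, hence bounded, and the differences decay geometrically. *)
Lemma cauchy_subsequence : exists th : nat -> nat, (forall k, (k <= th k)%N) /\
  {ae mu, forall x, D x -> forall i, cvgn (fun k => A (th k) x 0 i)}.
Proof.
pose q k : R := (2 ^ k.+1)%:R^-1.
have q0 k : 0 < q k by rewrite invr_gt0 ltr0n expn_gt0.
(* An energy below [q * q^p] stays below [q], a summable sequence, after the rescaling by [q^-1]. *)
have r0 k : 0 < q k * q k `^ p by rewrite mulr_gt0 ?powR_gt0.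
have [N NP] := choice (fun k => cauchyA (r0 k)).
(* The sum puts both [th k] and [th k.+1] beyond [N k], and the added [k] gives [k <= th k]. *)
pose th k := (\sum_(j < k.+1) N j + k)%N.
have Nth k : (N k <= th k)%N by rewrite /th big_ord_recr /= addnAC leq_addl.
have thS k : (N k <= th k.+1)%N.
  by rewrite /th 2!big_ord_recr /= -!addnA addnCA leq_addr.
exists th; split; first by move=> k; rewrite /th leq_addl.
pose C k x := (q k)^-1 *: (A (th k.+1) x - A (th k) x).
have fC k : finE (C k) by apply: finE_scale; exact: finE_sub.
have EC k : En (C k) <= q k.
  have := EnZ (q k)^-1 (finE_sub (fA (th k.+1)) (fA (th k))).
  rewrite -/(C k) => ->.
  rewrite gtr0_norm ?invr_gt0// -powR_inv1 ?(ltW (q0 k))// -powRrM mulN1r powRN.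
  by rewrite mulrC ler_pdivrMr ?powR_gt0// ltW// NP.
pose h k x : \bar R := (pw p (C k x))%:E.
have h0 k x : D x -> (0 <= h k x)%E by move=> _; rewrite lee_fin pw_ge0.
have mh k : measurable_fun D (h k).
  by apply/measurable_EFinP; apply: measurable_pw; exact: (fC k).1.
have H1 : (\int[mu]_(x in D) (\sum_(k <oo) h k x) < +oo)%E.
  rewrite integral_nneseries//.
  apply: (@le_lt_trans _ _ (\sum_(k <oo) (1 / (2 ^ k.+1)%:R)%:E)%E); last first.
    by apply: le_lt_trans (epsilon_trick0 xpredT ler01) _; rewrite ltry.
  apply: lee_nneseries => k _; first by move=> _; apply: integral_ge0 => x; exact: h0.
  by rewrite -/(energy (C k)) energyE// lee_fin div1r.
have intS : mu.-integrable D (fun x => \sum_(k <oo) h k x)%E.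
  apply/integrableP; split.
    by apply: (ge0_emeasurable_sum (P := xpredT)) => [k x Dx _|k _]; [exact: h0|exact: mh].
  rewrite (eq_integral (fun x => \sum_(k <oo) h k x)%E)// => x; rewrite inE => Dx.
  by rewrite gee0_abs// nneseries_ge0// => k _ _; exact: h0.
have := integrable_ae mD intS; apply: filterS => x Hx Dx i.
have := Hx Dx; set S := (\sum_(k <oo) _)%E => fS.
apply: (@geometric_diff_cvg _ _ (fine S `^ p^-1)) => k.
have hS : pw p (C k x) <= fine S.
  rewrite -lee_fin fineK//.
  apply: (@le_trans _ _ (\sum_(0 <= j < k.+1) h j x)%E).
    rewrite big_nat_recr//= leeDr// sume_ge0// => j _; exact: h0.
  by apply: nneseries_lim_ge => j _ _; exact: h0.
have : enorm (C k x) <= fine S `^ p^-1.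
  have S0 : 0 <= fine S by exact: le_trans (pw_ge0 _ _) hS.
  rewrite leNgt; apply/negP => /(lt_powR p0 (powR_ge0 _ _)).
  by rewrite -powRrM mulVf ?gt_eqF// powRr1// ltNge hS.
move=> /(le_trans (enorm_le _ i)).
rewrite /C 2!mxE normrM gtr0_norm ?invr_gt0// ler_pdivrMl// mulrC.
by rewrite !mxE.
Qed.

(** Only the subsequence converges almost everywhere. Fatou's lemma along it, with [k] fixed, turns
    the Cauchy property into a bound on the distance from [A k] to [B]. *)
Lemma fatou_limit (th : nat -> nat) B : (forall k, (k <= th k)%N) -> M B ->
  {ae mu, forall x, D x -> forall i, A (th k) x 0 i @[k --> \oo] --> B x 0 i} ->
  finE B /\ En (fun x => A k x - B x) @[k --> \oo] --> (0 : R).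
Proof.
move=> thk MB AB.
have key e N k : (forall l, (N <= l)%N -> En (fun x => A k x - A l x) < e) ->
    (energy (fun x => A k x - B x)%R <= e%:E)%E.
  move=> HN.
  pose f l x : \bar R := (pw p (A k x - A (th l) x))%:E.
  have mf l : measurable_fun D (f l).
    apply/measurable_EFinP/measurable_pw/M_sub; [exact: (fA _).1|exact: (fA _).1].
  have f0 l x : D x -> (0 <= f l x)%E by move=> _; rewrite lee_fin pw_ge0.
  have mlim : measurable_fun D (fun x => limn_einf (f ^~ x)).
    apply: measurableT_comp; first exact: oppe_measurable.
    by apply: measurable_fun_limn_esup => l; apply: measurableT_comp (mf l).
  have -> : energy (fun x => A k x - B x) = (\int[mu]_(x in D) limn_einf (f ^~ x))%E.
    apply: ge0_ae_eq_integral => //.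
    - by apply/measurable_EFinP/measurable_pw/M_sub => //; exact: (fA _).1.
    - by move=> x _; rewrite lee_fin pw_ge0.
    - move=> x Dx; rewrite limn_einf_lim; apply: lime_ge; first exact: is_cvg_einfs.
      by apply: nearW => m; apply: le_ereal_inf_tmp => _ [l _ <-]; exact: f0.
    move: AB; apply: filterS => x Hx Dx.
    have : f l x @[l --> \oo] --> (pw p (A k x - B x))%:E.
      apply: cvg_EFin; first exact: nearW.
      apply: pw_cvg => // i.
      rewrite (_ : (fun l => _) = (fun l => A k x 0 i - A (th l) x 0 i)); last first.
        by apply/funext => l; rewrite !mxE.
      by rewrite !mxE; apply: cvgB; [exact: cvg_cst|exact: Hx].
    by move=> /cvg_limn_einf_sup[->].
  apply: (le_trans (fatou mu mD mf f0)).
  rewrite limn_einf_lim; apply: lime_le; first exact: is_cvg_einfs.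
  apply: nearW => m; apply: (@le_trans _ _ (\int[mu]_(x in D) f (maxn m N) x)%E).
    apply: ereal_inf_lbound; exists (maxn m N) => //=; exact: leq_maxl.
  have ef := finE_sub (fA k) (fA (th (maxn m N))).
  rewrite -[leLHS]/(energy (fun x => A k x - A (th (maxn m N)) x)) energyE//.
  by rewrite lee_fin ltW// HN// (leq_trans _ (thk _))// leq_maxr.
have [N HN] := cauchyA ltr01.
have fNB : finE (fun x => A N x - B x).
  split; first by apply: M_sub => //; exact: (fA N).1.
  by apply: le_lt_trans (key 1 N N _) _; [move=> l; exact: HN|rewrite ltry].
have fB : finE B.
  have := finE_sub (fA N) fNB.
  by rewrite (_ : (fun x => _ - _) = B)//; apply/funext => x; rewrite subKr.
split => //; apply/cvgrPdist_lt => e e0.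
have e20 : 0 < e / 2 by rewrite divr_gt0.
have [N' HN'] := cauchyA e20; near=> k.
rewrite sub0r normrN ger0_norm ?En_ge0//; apply: (@le_lt_trans _ _ (e / 2)).
  rewrite -lee_fin -(energyE (finE_sub (fA k) fB)).
  have N'k : (N' <= k)%N by near: k; exact: nbhs_infty_ge.
  exact: (key _ N' k (fun l => HN' k l N'k)).
by rewrite ltr_pdivrMr// ltr_pMr// ltr1n.
Unshelve. all: by end_near. Qed.

End completeness.

Lemma ae_eq_integral_real (f g : T -> R) : measurable_fun D f ->
  measurable_fun D g -> {ae mu, forall x, D x -> f x = g x} ->
  (\int[mu]_(x in D) (f x)%:E = \int[mu]_(x in D) (g x)%:E)%E.
Proof.
move=> /measurable_EFinP mf /measurable_EFinP mg fg.
apply: (@ae_eq_integral _ _ _ mu D (EFin \o g) (EFin \o f) mD mf mg).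
by apply: filterS fg => x fgx Dx; rewrite /= (fgx Dx).
Qed.

Lemma ae_eq_energy A B : M A -> M B -> {ae mu, forall x, D x -> A x = B x} ->
  energy A = energy B.
Proof.
move=> MA MB AB; rewrite /energy.
rewrite (ae_eq_integral_real (measurable_pw MA) (measurable_pw MB))//.
by apply: filterS AB => x ABx Dx; rewrite (ABx Dx).
Qed.

Lemma ae_eq_En A B : M A -> M B -> {ae mu, forall x, D x -> A x = B x} ->
  En A = En B.
Proof.
move=> MA MB AB; rewrite /En /Rintegral -/(energy A) -/(energy B).
by rewrite (ae_eq_energy MA MB AB).
Qed.

Lemma ae_eq_Fl A B C : M A -> M B -> M C -> {ae mu, forall x, D x -> A x = B x} ->
  Fl C A = Fl C B.
Proof.
move=> MA MB MC AB; rewrite /Fl /Rintegral.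
rewrite (ae_eq_integral_real (measurable_flux MC MA) (measurable_flux MC MB))//.
by apply: filterS AB => x ABx Dx; rewrite (ABx Dx).
Qed.

Lemma ae_eq_finE A B : M B -> finE A -> {ae mu, forall x, D x -> A x = B x} ->
  finE B.
Proof.
move=> MB [MA EA] AB; split; first exact: MB.
by rewrite -(ae_eq_energy MA MB AB).
Qed.

End fields.

(** * The variational problem *)

Lemma ler_cvg {R : realType} (x y : R^nat) (a b : R) :
  x k @[k --> \oo] --> a -> y k @[k --> \oo] --> b -> (forall k, x k <= y k) -> a <= b.
Proof. by move=> xa yb xy; apply: ler_cvg_to xa yb _; exact: nearW. Qed.

Lemma cvg0_le_harmonic {R : realType} (x : R^nat) :
  (forall k, 0 <= x k <= k.+1%:R^-1) -> x k @[k --> \oo] --> (0 : R).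
Proof.
move=> H; apply: (@squeeze_cvgr _ _ _ _ (fun=> 0) (fun k => k.+1%:R^-1)).
- exact: nearW.
- exact: cvg_cst.
- exact: cvg_harmonic.
Qed.

Lemma le0_of_le_eps {R : realType} (x c : R) :
  (forall e, 0 < e -> x <= e * c) -> x <= 0.
Proof.
move=> H; rewrite leNgt; apply/negP => x0.
have c1 : 0 < `|c| + 1 by rewrite ltr_wpDl.
have := H _ (divr_gt0 x0 c1); rewrite leNgt => /negP; apply.
rewrite -mulrA gtr_pMr// mulrC ltr_pdivrMr// mul1r.
by rewrite (le_lt_trans (ler_norm c))// ltrDl.
Qed.

Section energy_form.
Context {R : realType} (p : R) {V : lmodType R}.

(* [E] stands for the p-th power of an L^p norm, finite on [fin], and [F a] for
   [p^-1] times its differential at [a].  Young's inequality takes the place of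
   Hoelder's. *)
Record energy_form (fin : set V) (E : V -> R) (F : V -> V -> R) : Prop := {
  form_comb : forall a b k, fin a -> fin b -> fin (a + k *: b) ;
  form_ge0 : forall a, 0 <= E a ;
  form_homog : forall a k, fin a -> E (k *: a) = `|k| `^ p * E a ;
  form_linear : forall a b c k, fin a -> fin b -> fin c ->
    F a (b + k *: c) = F a b + k * F a c ;
  form_diag : forall a, F a a = E a ;
  form_young_left : forall e, 0 < e -> exists2 K, 0 <= K &
    forall a b, fin a -> fin b -> `|F a b| <= e * E a + K * E b ;
  form_young_right : forall e, 0 < e -> exists2 K, 0 <= K &
    forall a b, fin a -> fin b -> `|F a b| <= K * E a + e * E b ;
  form_secant : forall a b k, fin a -> fin b ->
    E (a + k *: b) <= E a + p * k * F (a + k *: b) b ;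
  form_cvg : forall (b : nat -> V) b0, (forall k, fin (b k)) -> fin b0 ->
    E (b k - b0) @[k --> \oo] --> (0 : R) -> E (b k) @[k --> \oo] --> E b0 ;
  form_cvg_r : forall (b : nat -> V) b0 a, (forall k, fin (b k)) -> fin b0 ->
    E (b k - b0) @[k --> \oo] --> (0 : R) -> fin a ->
    F a (b k) @[k --> \oo] --> F a b0 ;
  form_cvg_l : forall a b, fin a -> fin b ->
    F (a + k.+1%:R^-1 *: b) b @[k --> \oo] --> F a b ;
  form_midpoint : forall a b, fin a -> fin b ->
    E (2^-1 *: (a + b)) <= (E a + E b) / 2 ;
  form_quasi : forall a b, fin a -> fin b -> E (a - b) <= 2 `^ p * (E a + E b) ;
  form_convex : forall e, 0 < e -> exists2 K, 0 <= K & forall a b,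
    fin a -> fin b ->
    E (a - b) <= e * (E a + E b) + K * ((E a + E b) / 2 - E (2^-1 *: (a + b))) ;
  form_monotone : forall a b, fin a -> fin b ->
    4 / p * ((E a + E b) / 2 - E (2^-1 *: (a + b))) <= F a (a - b) - F b (a - b) ;
  form_complete : forall a : nat -> V, (forall k, fin (a k)) ->
    (forall e, 0 < e -> exists N, forall k l, (N <= k)%N -> (N <= l)%N ->
      E (a k - a l) < e) ->
    exists2 a0, fin a0 & E (a k - a0) @[k --> \oo] --> (0 : R)
}.

Variables (fin : set V) (E : V -> R) (F : V -> V -> R).
Hypothesis EF : energy_form fin E F.

Lemma form_sub a b : fin a -> fin b -> fin (a - b).
Proof. by move=> fa fb; rewrite -scaleN1r; exact: (form_comb EF). Qed.

Lemma form_scale a k : fin a -> fin (k *: a).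
Proof.
move=> fa; have := form_comb EF (k - 1) fa fa.
by rewrite scalerBl scale1r addrCA subrr addr0.
Qed.

Lemma form0 a : fin a -> fin 0.
Proof. by move=> /(form_scale 0); rewrite scale0r. Qed.

Lemma form_opp a b : fin a -> fin b -> E (a - b) = E (b - a).
Proof.
move=> fa fb; have -> : a - b = -1 *: (b - a) by rewrite scaleN1r opprB.
by rewrite (form_homog EF) ?normrN1 ?powR1 ?mul1r//; exact: form_sub.
Qed.

Lemma form_linearB a b c : fin a -> fin b -> fin c -> F a (b - c) = F a b - F a c.
Proof. by move=> fa fb fc; rewrite -scaleN1r (form_linear EF)// mulN1r. Qed.

Lemma form_linearZ a b k : fin a -> fin b -> F a (k *: b) = k * F a b.
Proof.
move=> fa fb; have := form_linear EF (k - 1) fa fb fb.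
by rewrite scalerBl scale1r addrCA subrr addr0 => ->; ring.
Qed.

(** Uniform convexity for every [e], where the defect contributes nothing positive. *)
Lemma form_convex0 a b : fin a -> fin b ->
  (E a + E b) / 2 - E (2^-1 *: (a + b)) <= 0 -> E (a - b) = 0.
Proof.
move=> fa fb H; apply/eqP; rewrite eq_le (form_ge0 EF) andbT.
apply: (@le0_of_le_eps _ _ (E a + E b)) => e e0.
have [K K0 HK] := form_convex EF e0.
apply: (le_trans (HK _ _ fa fb)).
by rewrite gerDl mulr_ge0_le0.
Qed.

End energy_form.

(** * The abstract Dirichlet problem *)

Section variational.
Context {R : realType} (p : R) (V W : lmodType R).
Variables (finV : set V) (EV : V -> R) (FV : V -> V -> R).
Variables (finW : set W) (EW : W -> R) (FW : W -> W -> R).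
Hypotheses (p1 : 1 < p) (HV : energy_form p finV EV FV)
  (HW : energy_form p finW EW FW).

(* [S a b g] reads: [a], [b] and [g] are a test function, its gradient and its
   derivative along the subunit field.  For the Dirichlet problem [c], below, is
   multiplication by [F^(1/p)]. *)
Variable S : V -> W -> V -> Prop.
Hypotheses (S_fin : forall a b g, S a b g -> [/\ finV a, finW b & finV g])
  (S_comb : forall a b g a' b' g' k, S a b g -> S a' b' g' ->
    S (a + k *: a') (b + k *: b') (g + k *: g'))
  (S0 : S 0 0 0).

Let p0 : 0 < p. Proof. exact: lt_trans p1. Qed.

Definition in_closure a b := [/\ finV a, finW b & forall e, 0 < e ->
  exists a' b' g', S a' b' g' /\ EV (a - a') + EW (b - b') < e].

Lemma in_closureP a b : in_closure a b -> exists a_ b_ g_,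
  [/\ forall k : nat, S (a_ k) (b_ k) (g_ k),
    EV (a_ k - a) @[k --> \oo] --> (0 : R) &
    EW (b_ k - b) @[k --> \oo] --> (0 : R)].
Proof.
move=> [fa fb H].
have /choice[x Hx] : forall k : nat, exists x : V * W * V, S x.1.1 x.1.2 x.2 /\
    EV (a - x.1.1) + EW (b - x.1.2) < k.+1%:R^-1.
  move=> k; have k0 : 0 < k.+1%:R^-1 :> R by rewrite invr_gt0.
  by have [a' [b' [g' H']]] := H _ k0; exists (a', b', g').
exists (fun k => (x k).1.1), (fun k => (x k).1.2), (fun k => (x k).2); split.
- by move=> k; exact: (Hx k).1.
- apply: cvg0_le_harmonic => k; have [/S_fin[fa' _ _] lt] := Hx k.
  rewrite (form_ge0 HV)/= (form_opp HV)//; apply: le_trans (ltW lt).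
  by rewrite lerDl (form_ge0 HW).
- apply: cvg0_le_harmonic => k; have [/S_fin[_ fb' _] lt] := Hx k.
  rewrite (form_ge0 HW)/= (form_opp HW)//; apply: le_trans (ltW lt).
  by rewrite lerDr (form_ge0 HV).
Qed.

Lemma S_sub a b g a' b' g' : S a b g -> S a' b' g' -> S (a - a') (b - b') (g - g').
Proof. by move=> s s'; have := S_comb (-1) s s'; rewrite !scaleN1r. Qed.

Lemma S_scale a b g k : S a b g -> S (k *: a) (k *: b) (k *: g).
Proof. by move=> s; have := S_comb k S0 s; rewrite !add0r. Qed.

Lemma S_mid a b g a' b' g' : S a b g -> S a' b' g' ->
  S (2^-1 *: (a + a')) (2^-1 *: (b + b')) (2^-1 *: (g + g')).
Proof. by move=> s s'; have := S_scale 2^-1 (S_comb 1 s s'); rewrite !scale1r. Qed.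

Lemma in_closure_sub a b a' b' : in_closure a b -> in_closure a' b' ->
  exists a_ b_ g_, [/\ forall k : nat, S (a_ k) (b_ k) (g_ k),
    EV (a_ k - (a - a')) @[k --> \oo] --> (0 : R) &
    EW (b_ k - (b - b')) @[k --> \oo] --> (0 : R)].
Proof.
move=> cab ca'b'; have [fa fb _] := cab; have [fa' fb' _] := ca'b'.
have [a_ [b_ [g_ [Sk Ea Eb]]]] := in_closureP cab.
have [a'_ [b'_ [g'_ [Sk' Ea' Eb']]]] := in_closureP ca'b'.
have aux (U : lmodType R) fin (E : U -> R) F (x_ x'_ : nat -> U) x x' :
    energy_form p fin E F -> (forall k, fin (x_ k)) -> (forall k, fin (x'_ k)) ->
    fin x -> fin x' -> E (x_ k - x) @[k --> \oo] --> (0 : R) ->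
    E (x'_ k - x') @[k --> \oo] --> (0 : R) ->
    E (x_ k - x'_ k - (x - x')) @[k --> \oo] --> (0 : R).
  move=> H fk f'k fx fx' Ex Ex'.
  apply: (@squeeze_cvgr _ _ _ _ (fun=> 0)
    (fun k => 2 `^ p * (E (x_ k - x) + E (x'_ k - x')))).
  - apply: nearW => k; rewrite (form_ge0 H)/=.
    have -> : x_ k - x'_ k - (x - x') = (x_ k - x) - (x'_ k - x').
      by rewrite !opprB addrACA [RHS]addrACA [- x'_ k - x]addrC.
    by apply: (form_quasi H); exact: (form_sub H).
  - exact: cvg_cst.
  - rewrite -[X in _ --> X](mulr0 (2 `^ p)); apply: cvgMl_tmp.
    by rewrite -[X in _ --> X](addr0 0); exact: cvgD.
exists (fun k => a_ k - a'_ k), (fun k => b_ k - b'_ k), (fun k => g_ k - g'_ k).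
split; first by move=> k; exact: S_sub.
- apply: (aux _ _ _ _ _ _ _ _ HV) => // k; first by have [] := S_fin (Sk k).
  by have [] := S_fin (Sk' k).
- apply: (aux _ _ _ _ _ _ _ _ HW) => // k; first by have [] := S_fin (Sk k).
  by have [] := S_fin (Sk' k).
Qed.

Section sobolev.
Variable K : R.
Hypothesis sobolev : forall a b g, S a b g -> EV a <= K * EW b.

Lemma sobolev_closure a b : in_closure a b -> EV a <= K * EW b.
Proof.
move=> cab; have [fa fb _] := cab.
have [a_ [b_ [g_ [Sk Ea Eb]]]] := in_closureP cab.
have fa_ k : finV (a_ k) by have [] := S_fin (Sk k).
have fb_ k : finW (b_ k) by have [] := S_fin (Sk k).
apply: (ler_cvg (form_cvg HV fa_ fa Ea) (cvgMl_tmp (a := K) (form_cvg HW fb_ fb Eb))) => k.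
exact: sobolev (Sk k).
Qed.

Variable C : R.
Hypothesis subunit : forall a b g, S a b g -> EV g <= C * EW b.

(** Coercivity: the Sobolev and subunit bounds control [a] and [g] by [b], so the linear form of the
    data costs only a small multiple of the gradient energy. *)
Lemma young_data e : 0 < e -> exists2 K', 0 <= K' & forall f h a b g,
  finV f -> finV h -> S a b g ->
  FV f a + FV h g <= K' * (EV f + EV h) + e * EW b.
Proof.
move=> e0; pose d : R := e / (`|K| + `|C| + 1).
have KC : 0 < `|K| + `|C| + 1 by rewrite ltr_wpDl// addr_ge0.
have d0 : 0 < d by rewrite divr_gt0.
have [K' K'0 HK'] := form_young_right HV d0; exists K' => // f h a b g ff fh Sabg.
have [fa fb fg] := S_fin Sabg.
have h1 := le_trans (ler_norm _) (HK' _ _ ff fa).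
have h2 := le_trans (ler_norm _) (HK' _ _ fh fg).
have b0 := form_ge0 HW b.
have h3 : d * (EV a + EV g) <= e * EW b.
  rewrite /d -mulrA ler_pM2l// mulrC ler_pdivrMr//.
  have := lerD (sobolev Sabg) (subunit Sabg).
  rewrite -mulrDl => /le_trans; apply; rewrite [leRHS]mulrC ler_wpM2r//.
  have := ler_norm K; have := ler_norm C; lra.
rewrite mulrDr in h3; lra.
Qed.

Section solution.
Variables (c : V -> V).
Hypotheses (c_lin : forall a b k, c (a + k *: b) = c a + k *: c b)
  (c_fin : forall a, finV a -> finV (c a))
  (c_bound : exists K, forall a, finV a -> EV (c a) <= K * EV a).

Definition solves f h a b := in_closure a b /\ forall a' b' g', S a' b' g' ->
  FW b b' + FV (c a) (c a') = FV f a' + FV h g'.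

Lemma c_sub a b : c (a - b) = c a - c b.
Proof. by have := c_lin a b (-1); rewrite !scaleN1r. Qed.

Lemma c_cvg (a_ : nat -> V) a : (forall k, finV (a_ k)) -> finV a ->
  EV (a_ k - a) @[k --> \oo] --> (0 : R) ->
  EV (c (a_ k) - c a) @[k --> \oo] --> (0 : R).
Proof.
move=> fa_ fa Ea; have [K' HK'] := c_bound.
apply: (@squeeze_cvgr _ _ _ _ (fun=> 0) (fun k => K' * EV (a_ k - a))).
- apply: nearW => k; rewrite (form_ge0 HV)/= -c_sub HK'//; exact: (form_sub HV).
- exact: cvg_cst.
- by rewrite -[X in _ --> X](mulr0 K'); exact: cvgMl_tmp.
Qed.

Lemma solution_bound : exists2 K', 0 <= K' & forall f h a b, finV f -> finV h ->
  solves f h a b -> EV a <= K' * (EV f + EV h).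
Proof.
(* With parameter [2^-1] half of [EW b] is absorbed on the left, whence the factor 2; the Sobolev
   inequality on the closure contributes [|K|]. *)
have h2 : 0 < 2^-1 :> R by rewrite invr_gt0.
have [K' K'0 HK'] := young_data h2; exists (`|K| * (2 * K')).
  by rewrite !mulr_ge0.
move=> f h a b ff fh [cab sol]; have [fa fb _] := cab.
have [a_ [b_ [g_ [Sk Ea Eb]]]] := in_closureP cab.
have fa_ k : finV (a_ k) by have [] := S_fin (Sk k).
have fb_ k : finW (b_ k) by have [] := S_fin (Sk k).
have cv1 : FW b (b_ k) + FV (c a) (c (a_ k)) @[k --> \oo] --> EW b + EV (c a).
  rewrite -(form_diag HW b) -(form_diag HV (c a)).
  apply: cvgD; first exact: (form_cvg_r HW).
  by apply: (form_cvg_r HV); [move=> k; exact: c_fin|exact: c_fin|exact: c_cvg|exact: c_fin].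
have cv2 : K' * (EV f + EV h) + 2^-1 * EW (b_ k) @[k --> \oo] -->
    K' * (EV f + EV h) + 2^-1 * EW b.
  by apply: cvgD; [exact: cvg_cst|apply: cvgMl_tmp; exact: (form_cvg HW)].
have : EW b + EV (c a) <= K' * (EV f + EV h) + 2^-1 * EW b.
  by apply: (ler_cvg cv1 cv2) => k; rewrite (sol _ _ _ (Sk k)); exact: HK' (Sk k).
have ca0 := form_ge0 HV (c a); have b0 := form_ge0 HW b => le1.
apply: (le_trans (sobolev_closure cab)); apply: (@le_trans _ _ (`|K| * EW b)).
  by rewrite ler_wpM2r// ler_norm.
rewrite -mulrA ler_wpM2l//; lra.
Qed.

Lemma solution_unique f h a b a' b' : solves f h a b -> solves f h a' b' ->
  EV (a - a') = 0 /\ EW (b - b') = 0.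
Proof.
move=> [cab sol] [cab' sol']; have [fa fb _] := cab; have [fa' fb' _] := cab'.
have [a_ [b_ [g_ [Sk Ea Eb]]]] := in_closure_sub cab cab'.
have fa_ k : finV (a_ k) by have [] := S_fin (Sk k).
have fb_ k : finW (b_ k) by have [] := S_fin (Sk k).
have fca := c_fin fa; have fca' := c_fin fa'.
have fda := form_sub HV fa fa'; have fdb := form_sub HW fb fb'.
have cv x y : finV x -> finW y -> FW y (b_ k) + FV (c x) (c (a_ k)) @[k --> \oo] -->
    FW y (b - b') + FV (c x) (c a - c a').
  move=> fx fy; rewrite -c_sub; apply: cvgD; first exact: (form_cvg_r HW).
  by apply: (form_cvg_r HV); [move=> k; exact: c_fin|exact: c_fin|exact: c_cvg|exact: c_fin].
(* Both equations have the same right-hand side at the approximants of the difference; the limit is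
   taken on the left only. *)
have e : FW b (b - b') + FV (c a) (c a - c a') = FW b' (b - b') + FV (c a') (c a - c a').
  apply: (@cvg_unique _ _ _ _ _ _ _ (cv a' b' fa' fb')).
    by [].
  rewrite (_ : (fun k => FW b' _ + _) = (fun k => FW b (b_ k) + FV (c a) (c (a_ k)))).
    exact: cv.
  by apply/funext => k; rewrite (sol _ _ _ (Sk k)) (sol' _ _ _ (Sk k)).
have m1 := form_monotone HW fb fb'; have m2 := form_monotone HV fca fca'.
have d1 := form_midpoint HW fb fb'; have d2 := form_midpoint HV fca fca'.
(* The two defects are nonnegative and, by monotonicity, their sum is at most 0. That of [b], [b']
   therefore vanishes; as [c] may be 0, [a - a'] is then controlled through Sobolev. *)
have EB0 : EW (b - b') = 0.
  apply: (form_convex0 HW fb fb').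
  set x := _ - EW _ in m1 *; set y := _ - EV _ in m2.
  have y0 : 0 <= y by rewrite subr_ge0.
  have p4 : 0 < 4 / p by rewrite divr_gt0.
  have : 4 / p * x <= 0.
    have : 0 <= 4 / p * y by rewrite mulr_ge0// ltW.
    by lra.
  by rewrite pmulr_rle0.
split=> //; apply/eqP; rewrite eq_le (form_ge0 HV) andbT.
have := ler_cvg (form_cvg HV fa_ fda Ea) (cvgMl_tmp (a := K) (form_cvg HW fb_ fdb Eb)).
by rewrite EB0 mulr0; apply => k; exact: sobolev (Sk k).
Qed.

Lemma c_scale a k : c (k *: a) = k *: c a.
Proof.
have := c_lin a a (k - 1).
by rewrite !scalerBl !scale1r !(addrCA _ (k *: _)) !subrr !addr0.
Qed.

Lemma c_mid a b : c (2^-1 *: (a + b)) = 2^-1 *: (c a + c b).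
Proof. by rewrite c_scale; have := c_lin a b 1; rewrite !scale1r => ->. Qed.

(** * Existence by minimization *)

Section existence.
Variables f h : V.
Hypotheses (ff : finV f) (fh : finV h).

Let L a g := FV f a + FV h g.
Let J a b g := p^-1 * (EW b + EV (c a)) - L a g.

Let L_comb a b g a' b' g' k : S a b g -> S a' b' g' ->
  L (a + k *: a') (g + k *: g') = L a g + k * L a' g'.
Proof.
move=> /S_fin[fa _ fg] /S_fin[fa' _ fg'].
by rewrite /L !(form_linear HV)// mulrDr addrACA.
Qed.

Let L_mid a b g a' b' g' : S a b g -> S a' b' g' ->
  L (2^-1 *: (a + a')) (2^-1 *: (g + g')) = 2^-1 * (L a g + L a' g').
Proof.
move=> s s'; have := L_comb 1 s s'; have := L_comb 2^-1 S0 (S_comb 1 s s').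
rewrite !add0r !scale1r mul1r => -> ->.
have f0 : finV 0 := form0 HV ff.
have L0 : L 0 0 = 0.
  by rewrite /L -(subrr 0) !(form_linearB HV)// !subrr addr0.
by rewrite L0 add0r.
Qed.

(** The parameter [(2 * p)^-1] spends half of the coefficient [p^-1] of the gradient energy on the
    linear form. *)
Let J_bound : exists2 B, 0 <= B & forall a b g, S a b g -> (2 * p)^-1 * EW b - B <= J a b g.
Proof.
have e0 : 0 < (2 * p)^-1 by rewrite invr_gt0 mulr_gt0.
have [K' K'0 HK'] := young_data e0; exists (K' * (EV f + EV h)).
  by rewrite mulr_ge0// addr_ge0 ?(form_ge0 HV).
move=> a b g s; have := HK' _ _ _ _ _ ff fh s; rewrite /J -/(L a g).
have ca := form_ge0 HV (c a).
have : 0 <= p^-1 * EV (c a) by rewrite mulr_ge0// invr_ge0 ltW.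
have -> : (2 * p)^-1 = p^-1 / 2 by rewrite invfM mulrC.
lra.
Qed.

Let minimizing : exists (m : R) (a_ : nat -> V) (b_ : nat -> W) (g_ : nat -> V),
  (forall a b g, S a b g -> m <= J a b g) /\
  forall k, S (a_ k) (b_ k) (g_ k) /\ J (a_ k) (b_ k) (g_ k) < m + k.+1%:R^-1.
Proof.
pose X := [set r | exists a b g, S a b g /\ r = J a b g].
have Xinf : has_inf X.
  split; first by exists (J 0 0 0), 0, 0, 0.
  have [B B0 HB] := J_bound; exists (- B) => _ [a [b [g [s ->]]]].
  apply: le_trans (HB _ _ _ s); rewrite lerDr mulr_ge0 ?(form_ge0 HW)//.
  by rewrite invr_ge0 mulr_ge0// ltW.
have mJ a b g : S a b g -> inf X <= J a b g.
  by move=> s; apply: (inf_lbound Xinf.2); exists a, b, g.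
have /choice[x Hx] : forall k : nat, exists x : V * W * V, S x.1.1 x.1.2 x.2 /\
    J x.1.1 x.1.2 x.2 < inf X + k.+1%:R^-1.
  move=> k; have k0 : 0 < k.+1%:R^-1 :> R by rewrite invr_gt0.
  by have [_ [a [b [g [s ->]]]] lt] := inf_adherent k0 Xinf; exists (a, b, g).
by exists (inf X), (fun k => (x k).1.1), (fun k => (x k).1.2), (fun k => (x k).2).
Qed.

(** The linear form cancels between [J] at the midpoint and the mean of [J] at the ends, and the
    term in [c] is convex as well: what is left is the defect of the gradients. *)
Let J_defect m a b g a' b' g' d : (forall a b g, S a b g -> m <= J a b g) ->
  S a b g -> S a' b' g' -> J a b g <= m + d -> J a' b' g' <= m + d ->
  (EW b + EW b') / 2 - EW (2^-1 *: (b + b')) <= p * d.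
Proof.
move=> mJ s s' le le'; have := mJ _ _ _ (S_mid s s').
have [fa _ _] := S_fin s; have [fa' _ _] := S_fin s'.
have := form_midpoint HV (c_fin fa) (c_fin fa').
rewrite /J c_mid (L_mid s s') in le le' *.
set x := EW (_ *: _); set y := EV (_ *: _) => yle mle.
rewrite -ler_pdivrMl//.
have : p^-1 * y <= p^-1 * ((EV (c a) + EV (c a')) / 2) by rewrite ler_pM2l// invr_gt0.
lra.
Qed.

Lemma solution_exists : exists a b, solves f h a b.
Proof.
have [m [a_ [b_ [g_ [mJ Hk]]]]] := minimizing.
have Sk k := (Hk k).1; have [B B0 JB] := J_bound.
have fa_ k : finV (a_ k) by have [] := S_fin (Sk k).
have fb_ k : finW (b_ k) by have [] := S_fin (Sk k).
(* From [(2 * p)^-1 * EW b - B <= J <= m + 1]. *)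
pose r := 2 * p * (m + 1 + B).
have p20 : 0 < 2 * p by rewrite mulr_gt0.
have br k : EW (b_ k) <= r.
  rewrite /r mulrC -ler_pdivrMr// [leLHS]mulrC.
  have := JB _ _ _ (Sk k); have := (Hk k).2.
  have : k.+1%:R^-1 <= 1 :> R by rewrite invf_le1// ler1n.
  set q := k.+1%:R^-1; set j := J _ _ _; set w := _ * EW _.
  by move: q j w => q j w; lra.
have r0 : 0 <= r by exact: le_trans (form_ge0 HW _) (br 0%N).
have cauchyb e : 0 < e -> exists N, forall k l, (N <= k)%N -> (N <= l)%N ->
    EW (b_ k - b_ l) < e.
  (* [e1] handles the energies and [d] below the defect, half of [e] for each. *)
  move=> e0; pose e1 : R := e / 2 / (r + r + 1).
  have rr : 0 < r + r + 1 by rewrite ltr_wpDl// addr_ge0.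
  have e10 : 0 < e1 by rewrite !divr_gt0.
  have [K' K'0 HK'] := form_convex HW e10.
  pose d : R := e / 2 / (K' * p + 1).
  have Kp : 0 < K' * p + 1 by rewrite ltr_wpDl// mulr_ge0// ltW.
  have d0 : 0 < d by rewrite !divr_gt0.
  have [N HN] : exists N : nat, forall k, (N <= k)%N -> k.+1%:R^-1 <= d.
    have /cvgrPdist_le/(_ _ d0)[N _ HN] := @cvg_harmonic R.
    exists N => k Nk; have := HN k Nk.
    by rewrite /= sub0r normrN ger0_norm// invr_ge0.
  exists N => k l Nk Nl; apply: (le_lt_trans (HK' _ _ (fb_ k) (fb_ l))).
  have Jd j : (N <= j)%N -> J (a_ j) (b_ j) (g_ j) <= m + d.
    by move=> Nj; apply: (le_trans (ltW (Hk j).2)); rewrite lerD2l HN.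
  have := J_defect mJ (Sk k) (Sk l) (Jd k Nk) (Jd l Nl).
  set x := _ / 2 - _ => xd.
  have h1 : e1 * (EW (b_ k) + EW (b_ l)) < e / 2.
    have -> : e / 2 = e1 * (r + r + 1) by rewrite /e1 divfK// gt_eqF.
    by rewrite ltr_pM2l//; have := br k; have := br l; lra.
  have h2 : K' * x <= e / 2.
    apply: (@le_trans _ _ (K' * (p * d))); first exact: ler_wpM2l.
    have -> : e / 2 = (K' * p + 1) * d by rewrite [RHS]mulrC /d divfK// gt_eqF.
    by rewrite mulrA ler_pM2r// lerDl.
  by rewrite [ltRHS](splitr e) ltr_leD.
have cauchya e : 0 < e -> exists N, forall k l, (N <= k)%N -> (N <= l)%N ->
    EV (a_ k - a_ l) < e.
  move=> e0; have K1 : 0 < `|K| + 1 by rewrite ltr_wpDl.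
  have [N HN] := cauchyb _ (divr_gt0 e0 K1); exists N => k l Nk Nl.
  apply: (le_lt_trans (sobolev (S_sub (Sk k) (Sk l)))).
  have := HN k l Nk Nl; rewrite ltr_pdivlMr// mulrC; apply: le_lt_trans.
  rewrite ler_wpM2r ?(form_ge0 HW)// (le_trans (ler_norm K))// lerDl//.
have [a fa Ea] := form_complete HV fa_ cauchya.
have [b fb Eb] := form_complete HW fb_ cauchyb.
exists a, b; split.
  split=> // e e0.
  have e2 : 0 < e / 2 by rewrite divr_gt0.
  have /cvgrPdist_lt/(_ _ e2)[N _ HN] := Ea.
  have /cvgrPdist_lt/(_ _ e2)[N' _ HN'] := Eb.
  pose k := maxn N N'; exists (a_ k), (b_ k), (g_ k); split; first exact: Sk.
  have := HN k (leq_maxl _ _); have := HN' k (leq_maxr _ _).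
  rewrite /= !sub0r !normrN !ger0_norm ?(form_ge0 HV) ?(form_ge0 HW)//.
  rewrite (form_opp HV fa)// (form_opp HW fb)// => lt1 lt2.
  by rewrite [ltRHS](splitr e) ltrD.
have fca := c_fin fa.
(* No limit of [g_] is taken and [J] is not evaluated at [(a, b)]: [J] at the [k]-th term is
   compared with [J] at this term displaced by [s] times a test function, and [L (a_ k) (g_ k)]
   cancels before [k] tends to infinity. *)
have step a' b' g' s : 0 < s -> S a' b' g' ->
    L a' g' <= FW (b + s *: b') b' + FV (c a + s *: c a') (c a').
  move=> s0 St; have [fa' fb' fg'] := S_fin St; have fca' := c_fin fa'.
  have cvb : EW (b_ k + s *: b') @[k --> \oo] --> EW (b + s *: b').
    apply: (form_cvg HW); first by move=> k; exact: (form_comb HW).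
      exact: (form_comb HW).
    by rewrite (_ : (fun k => _) = (fun k => EW (b_ k - b)))//;
       apply/funext => k; rewrite opprD addrACA subrr addr0.
  have cva : EV (c (a_ k) + s *: c a') @[k --> \oo] --> EV (c a + s *: c a').
    apply: (form_cvg HV).
    - by move=> k; apply: (form_comb HV) => //; exact: c_fin.
    - exact: (form_comb HV).
    - rewrite (_ : (fun k => _) = (fun k => EV (c (a_ k) - c a))); first exact: c_cvg.
      by apply/funext => k; rewrite opprD addrACA subrr addr0.
  have cvb0 := form_cvg HW fb_ fb Eb.
  have cva0 : EV (c (a_ k)) @[k --> \oo] --> EV (c a).
    by apply: (form_cvg HV) => //; [move=> k; exact: c_fin|exact: c_cvg].
  have lim1 : p^-1 * (EW (b_ k) + EV (c (a_ k))) - k.+1%:R^-1 @[k --> \oo] -->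
      p^-1 * (EW b + EV (c a)) - 0.
    by apply: cvgB; [apply: cvgMl_tmp; exact: cvgD|exact: cvg_harmonic].
  have lim2 : p^-1 * (EW (b_ k + s *: b') + EV (c (a_ k) + s *: c a')) - s * L a' g'
      @[k --> \oo] --> p^-1 * (EW (b + s *: b') + EV (c a + s *: c a')) - s * L a' g'.
    by apply: cvgB; [apply: cvgMl_tmp; exact: cvgD|exact: cvg_cst].
  have : p^-1 * (EW b + EV (c a)) - 0 <=
      p^-1 * (EW (b + s *: b') + EV (c a + s *: c a')) - s * L a' g'.
    apply: (ler_cvg lim1 lim2) => k.
    have := mJ _ _ _ (S_comb s (Sk k) St); have := (Hk k).2.
    rewrite /J c_lin (L_comb s (Sk k) St).
    set q := k.+1%:R^-1; set x := _ * _; set y := L (a_ k) _; set z := s * _.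
    set w := _ * (_ + _); by move: q x y z w => q x y z w; lra.
  have := form_secant HW s fb fb'; have := form_secant HV s fca fca'.
  set x := EV (_ + _); set y := EW (_ + _); set u := FV (c a + _) _; set w := FW (b + _) _.
  move=> xle yle; rewrite subr0 => mle.
  rewrite -(ler_pM2l s0).
  have : p^-1 * (y + x) <= p^-1 * (EW b + p * s * w + (EV (c a) + p * s * u)).
    by rewrite ler_pM2l ?invr_gt0// lerD.
  have -> : p^-1 * (EW b + p * s * w + (EV (c a) + p * s * u)) =
      p^-1 * (EW b + EV (c a)) + s * (w + u).
    by field; rewrite gt_eqF.
  lra.
(* As [s] tends to 0 the fluxes at the displaced point return to those at the limit. *)
have ineq a' b' g' : S a' b' g' -> L a' g' <= FW b b' + FV (c a) (c a').
  move=> St; have [fa' fb' fg'] := S_fin St; have fca' := c_fin fa'.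
  have lim : FW (b + k.+1%:R^-1 *: b') b' +
      FV (c a + k.+1%:R^-1 *: c a') (c a') @[k --> \oo] -->
      FW b b' + FV (c a) (c a').
    exact: cvgD (form_cvg_l HW fb fb') (form_cvg_l HV fca fca').
  have lim0 : L a' g' @[k --> \oo] --> L a' g' by exact: cvg_cst.
  apply: (ler_cvg lim0 lim) => k.
  by apply: step St; rewrite invr_gt0.
move=> a' b' g' St; have [fa' fb' fg'] := S_fin St; have fca' := c_fin fa'.
apply/eqP; rewrite eq_le -/(L a' g') (ineq _ _ _ St) andbT.
(* The opposite test function reverses the inequality. *)
have := ineq _ _ _ (S_scale (-1) St).
rewrite /L c_scale !(form_linearZ HV)// !(form_linearZ HW)//; lra.
Qed.

End existence.

End solution.
End sobolev.

Lemma sobolev_of_solutions (K : R) :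
  (forall a b g, S a b g -> exists a0 b0, [/\ in_closure a0 b0,
    EV a0 <= K * EV a & forall a' b' g', S a' b' g' -> FW b0 b' = FV a a']) ->
  exists2 K', 0 <= K' & forall a b g, S a b g -> EV a <= K' * EW b.
Proof.
move=> H; have [K1 K10 HK1] := form_young_left HV ltr01.
have M0 : 0 < 1 + K1 * `|K| by rewrite ltr_pwDl// mulr_ge0.
(* [EW b0] will be at most [(1 + K1 |K|) EV a]; this parameter reduces its contribution to half of
   [EV a], which is absorbed and leaves the factor 2. *)
have d0 : 0 < 2^-1 / (1 + K1 * `|K|) by rewrite divr_gt0.
have [K2 K20 HK2] := form_young_left HW d0.
exists (2 * K2) => [|a b g s]; first by rewrite mulr_ge0.
have [fa fb fg] := S_fin s.
have [a0 [b0 [cab le0 sol]]] := H _ _ _ s; have [fa0 fb0 _] := cab.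
have [a_ [b_ [g_ [Sk Ea Eb]]]] := in_closureP cab.
have fa_ k : finV (a_ k) by have [] := S_fin (Sk k).
have fb_ k : finW (b_ k) by have [] := S_fin (Sk k).
(* The equation tested with the approximants of its own solution, in the limit. *)
have b0E : EW b0 = FV a a0.
  rewrite -(form_diag HW); apply: (@cvg_unique _ _ _ _ _ _ _ (form_cvg_r HV fa_ fa0 Ea fa)).
    by [].
  rewrite (_ : (fun k => FV a (a_ k)) = (fun k => FW b0 (b_ k))).
    exact: (form_cvg_r HW).
  by apply/funext => k; rewrite (sol _ _ _ (Sk k)).
have b0le : EW b0 <= (1 + K1 * `|K|) * EV a.
  rewrite b0E; apply: (le_trans (ler_norm _)); apply: (le_trans (HK1 _ _ fa fa0)).
  rewrite mul1r mulrDl mul1r lerD2l -mulrA ler_wpM2l//.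
  by apply: (le_trans le0); rewrite ler_wpM2r ?(form_ge0 HV)// ler_norm.
have aE : EV a = FW b0 b by rewrite (sol _ _ _ s) (form_diag HV).
have := le_trans (ler_norm _) (HK2 _ _ fb0 fb); rewrite -aE.
have : 2^-1 / (1 + K1 * `|K|) * EW b0 <= 2^-1 * EV a.
  by rewrite -mulrA ler_pM2l// mulrC ler_pdivrMr// mulrC.
lra.
Qed.

End variational.

(** * Weighted spaces *)

Section fields_form.
Context {R : realType} d (T : measurableType d) (mu : {measure set T -> \bar R}).
Variables (D : set T) (p : R) (n : nat).
Hypotheses (mD : measurable D) (p1 : 1 < p).
Variable M : set (T -> 'rV[R]_n).
Hypothesis M_comb : forall A B (k : R), M A -> M B -> M (fun x => A x + k *: B x).
Hypothesis M_dot : forall A B, M A -> M B ->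
  measurable_fun D (fun x => dot (A x) (B x)).
Hypothesis M_limit : forall A : nat -> T -> 'rV[R]_n, (forall k, M (A k)) ->
  {ae mu, forall x, D x -> forall i, cvgn (fun k => A k x 0 i)} ->
  exists2 B, M B &
    {ae mu, forall x, D x -> forall i, A k x 0 i @[k --> \oo] --> B x 0 i}.

Lemma field_energy_form :
  energy_form p (finE mu D p M) (@En R d T mu D p n) (@Fl R d T mu D p n).
Proof.
split.
- by move=> A B k fA fB; exact: (finE_comb mD p1 M_comb M_dot k fA fB).
- by move=> A; exact: En_ge0.
- by move=> A k fA; exact: (EnZ mD M_dot k fA).
- by move=> A B C k fA fB fC; exact: (Fl_comb mD p1 M_dot k fA fB fC).
- by move=> A; exact: (Fl_diag mu D p1 A).
- by move=> e e0; exact: (Fl_young_left mu mD p1 M_dot e0).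
- by move=> e e0; exact: (Fl_young_right mu mD p1 M_dot e0).
- by move=> A B k fA fB; exact: (En_secant mD p1 M_comb M_dot k fA fB).
- by move=> B B0 fB fB0 EB; exact: (En_cvg mD p1 M_comb M_dot fB fB0 EB).
- by move=> B B0 A fB fB0 EB fA; exact: (Fl_cvg_r mD p1 M_comb M_dot fB fB0 EB fA).
- by move=> A B fA fB; exact: (Fl_cvg_l mD p1 M_comb M_dot fA fB).
- by move=> A B fA fB; exact: (En_midpoint mD p1 M_comb M_dot fA fB).
- by move=> A B fA fB; exact: (le_EnB mD p1 M_comb M_dot fA fB).
- by move=> e e0; exact: (En_uniform_convexity mu mD p1 M_comb M_dot e0).
- by move=> A B fA fB; exact: (Fl_monotone mD p1 M_comb M_dot fA fB).
- move=> A fA cA.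
  have [th [thk cvA]] := cauchy_subsequence mD p1 M_comb M_dot fA cA.
  have [B MB AB] := M_limit (fun k => (fA (th k)).1) cvA.
  exists B; have [fB EB] := fatou_limit mD p1 M_comb M_dot fA cA thk MB AB.
    exact: fB.
  exact: EB.
Qed.

End fields_form.

(** The sequence is cut off to 0 on a measurable null set, after which it converges everywhere on
    [D]; [mu] need not be complete. *)
Lemma measurable_ae_limit {R : realType} d (T : measurableType d)
    (mu : {measure set T -> \bar R}) (D : set T) (f : nat -> T -> R) :
  measurable D -> (forall k, measurable_fun D (f k)) ->
  {ae mu, forall x, D x -> cvgn (f ^~ x)} ->
  exists2 g : T -> R, measurable_fun D g &
    {ae mu, forall x, D x -> f k x @[k --> \oo] --> g x}.
Proof.
move=> mD mf [N [mN N0 subN]].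
pose h k := f k \_ (D `\` N).
have cvh x : D x -> cvgn (h ^~ x).
  move=> Dx; have [xN|xN] := pselect (N x).
    rewrite (_ : h ^~ x = cst 0); first exact: is_cvg_cst.
    by apply/funext => k; rewrite /h patchE; case: ifPn => //; rewrite inE => -[].
  rewrite (_ : h ^~ x = f ^~ x); last first.
    by apply/funext => k; rewrite /h patchE mem_set.
  by apply: contrapT => H; apply: xN; apply: subN => /(_ Dx).
exists (fun x => limn (h ^~ x)).
  apply: (@measurable_fun_cvg _ _ _ _ h) => [k|x Dx]; last exact: cvh.
  apply: measurable_funTS; apply/(measurable_restrictT _ (measurableD mD mN)).
  by apply: measurable_funS (mf k) => // x [].
exists N; split=> // x; apply: contra_notP => xN Dx; have := cvh x Dx.
rewrite (_ : h ^~ x = f ^~ x)//.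
by apply/funext => k; rewrite /h patchE mem_set.
Qed.

(** The row space of [B] is the kernel of [cokermx B], and this linear condition passes to the
    limit. *)
Lemma row_image_closed {R : realType} n (B : 'M[R]_n) (y : nat -> 'rV[R]_n) (a : 'rV[R]_n) :
  (forall i, (y k *m B) 0 i @[k --> \oo] --> a 0 i) -> exists z, a = z *m B.
Proof.
move=> ya; apply/submxP; rewrite submxE; apply/eqP/rowP => j; rewrite [RHS]mxE.
have : ((y k *m B) *m cokermx B) 0 j @[k --> \oo] --> (a *m cokermx B) 0 j.
  rewrite mxE (_ : (fun k => (y k *m B *m cokermx B) 0 j) =
      (fun k => \sum_i (y k *m B) 0 i * cokermx B i j)); last first.
    by apply/funext => k; rewrite mxE.
  by apply: cvg_bigsum => i; apply: cvgMr_tmp; exact: ya.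
move=> /cvg_unique; apply => //.
rewrite (_ : (fun k => (y k *m B *m cokermx B) 0 j) = cst 0); first exact: cvg_cst.
by apply/funext => k; rewrite -mulmxA mulmx_coker mulmx0 mxE.
Qed.

Lemma measurable_fun_mulmxv {R : realType} d (T : measurableType d) n (D : set T)
    (Q : T -> 'M[R]_n) (U : T -> 'rV[R]_n) :
  (forall i j, measurable_fun D (fun x => Q x i j)) ->
  (forall i, measurable_fun D (fun x => U x 0 i)) ->
  forall i, measurable_fun D (fun x => mulmxv (Q x) (U x) 0 i).
Proof.
move=> mQ mU i.
rewrite (_ : (fun x => _) = (fun x => \sum_j U x 0 j * Q x i j)); last first.
  by apply/funext => x; rewrite mxE; apply: eq_bigr => j _; rewrite mxE.
by apply: measurable_sum => j; exact: measurable_funM.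
Qed.

Lemma measurable_fun_dot {R : realType} d (T : measurableType d) n (D : set T)
    (A B : T -> 'rV[R]_n) :
  (forall i, measurable_fun D (fun x => A x 0 i)) ->
  (forall i, measurable_fun D (fun x => B x 0 i)) ->
  measurable_fun D (fun x => dot (A x) (B x)).
Proof. by move=> mA mB; apply: measurable_sum => j; exact: measurable_funM. Qed.

Section weighted_fields.
Context {R : realType} d (T : measurableType d) (mu : {measure set T -> \bar R}).
Variables (D : set T) (p : R).
Hypotheses (mD : measurable D) (p1 : 1 < p).

Section scalar.
Variable V : T -> R.
Hypotheses (mV : measurable_fun D V) (V_ge0 : forall x, D x -> 0 <= V x).

(** The isometry of the weighted space into unweighted [L^p], written with one-component rows so
    that scalars and vectors share one theory. *)
Definition wfield (u : T -> R) (x : T) : 'rV[R]_1 := (V x `^ p^-1 * u x)%:M.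

Definition wfields : set (T -> 'rV[R]_1) :=
  [set A | exists2 u, measurable_fun D u & A = wfield u].

Let p0 : 0 < p. Proof. exact: lt_trans p1. Qed.

Lemma enorm_scalar (a : R) : enorm (a%:M : 'rV[R]_1) = `|a|.
Proof. by rewrite /enorm /dot big_ord1 mxE eqxx mulr1n -expr2 sqrtr_sqr. Qed.

Lemma dot_scalar (a b : R) : dot (a%:M : 'rV[R]_1) b%:M = a * b.
Proof. by rewrite /dot big_ord1 !mxE eqxx !mulr1n. Qed.

Lemma pw_wfield u x : D x -> pw p (wfield u x) = `|u x| `^ p * V x.
Proof.
move=> Dx; rewrite /pw enorm_scalar normrM powRM// mulrC (ger0_norm (powR_ge0 _ _)).
by rewrite -powRrM mulVf ?gt_eqF// powRr1// V_ge0.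
Qed.

Lemma flux_wfield u phi x : D x -> flux p (wfield u x) (wfield phi x) =
  `|u x| `^ (p - 2) * u x * phi x * V x.
Proof.
move=> Dx; rewrite /flux enorm_scalar dot_scalar.
have := V_ge0 Dx; rewrite le_eqVlt => /predU1P[<-|V0].
  by rewrite powR0 ?invr_eq0 ?gt_eqF// !mul0r !mulr0.
set w := V x `^ p^-1; have w0 : 0 <= w by exact: powR_ge0.
(* The flux is homogeneous of degree [p - 1] in one argument and 1 in the other: the powers of the
   weight recombine to [V x]. *)
have -> : V x = w `^ (p - 2) * (w * w).
  rewrite -expr2 -powR_mulrn// -powRD; last by rewrite (gt_eqF (powR_gt0 _ V0)) implybT.
  by rewrite subrK /w -powRrM mulVf ?gt_eqF// powRr1 ?ltW.
rewrite normrM powRM// ger0_norm//; ring.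
Qed.

Lemma wfieldD u phi k : wfield (fun x => u x + k * phi x) =
  (fun x => wfield u x + k *: wfield phi x).
Proof.
apply/funext => x; apply/rowP => i; rewrite !ord1 !mxE eqxx !mulr1n; ring.
Qed.

Lemma wfields_comb A B (k : R) : wfields A -> wfields B ->
  wfields (fun x => A x + k *: B x).
Proof.
move=> [u mu' ->] [w mw ->]; exists (fun x => u x + k * w x); last by rewrite wfieldD.
by apply: measurable_funD => //; apply: measurable_funM => //; exact: measurable_cst.
Qed.

Lemma measurable_weight : measurable_fun D (fun x => V x `^ p^-1).
Proof. exact: (measurableT_comp (measurable_powR p^-1)). Qed.

Lemma wfields_dot A B : wfields A -> wfields B ->
  measurable_fun D (fun x => dot (A x) (B x)).
Proof.
move=> [u mu' ->] [w mw ->].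
under eq_fun do rewrite dot_scalar.
have mw' := measurable_weight.
by apply: measurable_funM; exact: measurable_funM.
Qed.

Lemma wfields_limit (A : nat -> T -> 'rV[R]_1) : (forall k, wfields (A k)) ->
  {ae mu, forall x, D x -> forall i, cvgn (fun k => A k x 0 i)} ->
  exists2 B, wfields B &
    {ae mu, forall x, D x -> forall i, A k x 0 i @[k --> \oo] --> B x 0 i}.
Proof.
move=> MA cvA.
have /choice[u Hu] : forall k, exists u, measurable_fun D u /\ A k = wfield u.
  by move=> k; have [u mu' ->] := MA k; exists u.
have AE k x : A k x 0 0 = V x `^ p^-1 * u k x.
  by rewrite (Hu k).2 mxE eqxx mulr1n.
have mw := measurable_weight.
have mf k : measurable_fun D (fun x => V x `^ p^-1 * u k x).
  by apply: measurable_funM => //; exact: (Hu k).1.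
have cvf : {ae mu, forall x, D x -> cvgn (fun k => V x `^ p^-1 * u k x)}.
  apply: filterS cvA => x H Dx; have := H Dx 0.
  by rewrite (_ : (fun k => A k x 0 0) = (fun k => V x `^ p^-1 * u k x))//;
     apply/funext => k; rewrite AE.
have [g mg fg] := measurable_ae_limit mD mf cvf.
(* Where the weight vanishes all terms are 0, and so is the limit; elsewhere the division is
   exact. *)
exists (wfield (fun x => (V x `^ p^-1)^-1 * g x)).
  exists (fun x => (V x `^ p^-1)^-1 * g x) => //.
  by apply: measurable_funM => //; exact: measurable_fun_inv.
apply: filterS fg => x + Dx i => /(_ Dx); rewrite !ord1.
rewrite (_ : (fun k => A k x 0 0) = (fun k => V x `^ p^-1 * u k x)); last first.
  by apply/funext => k; rewrite AE.
rewrite mxE eqxx mulr1n; have [w0|w0] := eqVneq (V x `^ p^-1) 0.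
  rewrite w0 mul0r; under eq_fun do rewrite mul0r.
  by move=> _; exact: cvg_cst.
by rewrite mulVKf.
Qed.

Lemma wfield_form : energy_form p (finE mu D p wfields)
  (@En R d T mu D p 1) (@Fl R d T mu D p 1).
Proof.
have H := field_energy_form mD p1 (@wfields_comb) (@wfields_dot) wfields_limit.
exact: H.
Qed.

End scalar.

Section matrix.
Variables (n : nat) (Q : T -> 'M[R]_n).
Hypotheses (mQ : forall i j, measurable_fun D (fun x => Q x i j))
  (Q_psd : forall x, D x -> psdmx (Q x)).

Definition qfield (U : T -> 'rV[R]_n) (x : T) : 'rV[R]_n := mulmxv (sqrtmx (Q x)) (U x).

Implicit Types (U W : T -> 'rV[R]_n) (A B : T -> 'rV[R]_n).

Definition qfields : set (T -> 'rV[R]_n) :=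
  [set A | exists2 U : T -> 'rV[R]_n, (forall i, measurable_fun D (fun x => U x 0 i)) & A = qfield U].

Lemma qfieldD U W k : qfield (fun x => U x + k *: W x) =
  (fun x => qfield U x + k *: qfield W x).
Proof. by apply/funext => x; rewrite /qfield /mulmxv mulmxDl -scalemxAl. Qed.

Lemma qfields_comb A B (k : R) : qfields A -> qfields B ->
  qfields (fun x => A x + k *: B x).
Proof.
move=> [U mU ->] [W mW ->]; exists (fun x => U x + k *: W x); last by rewrite qfieldD.
move=> i; under eq_fun do rewrite 2!mxE.
apply: measurable_funD; first exact: mU.
by apply: measurable_funM; [exact: measurable_cst|exact: mW].
Qed.

(** The two square roots recombine into [Q x], whose entries are measurable. *)
Lemma qfields_dot A B : qfields A -> qfields B ->
  measurable_fun D (fun x => dot (A x) (B x)).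
Proof.
move=> [U mU ->] [W mW ->].
apply: (eq_measurable_fun (fun x => dot (mulmxv (Q x) (U x)) (W x))).
  by move=> x; rewrite inE => Dx; rewrite dot_sqrtmx//; exact: Q_psd.
by apply: measurable_fun_dot => //; exact: measurable_fun_mulmxv.
Qed.

(* [sqrtmx (Q x)] is not known to be measurable in [x]: the representative of the
   limit is obtained by solving [U Q = Z] where [Z] is the limit of [Q U_k]. *)
Lemma qfields_limit (A : nat -> T -> 'rV[R]_n) : (forall k, qfields (A k)) ->
  {ae mu, forall x, D x -> forall i, cvgn (fun k => A k x 0 i)} ->
  exists2 B, qfields B &
    {ae mu, forall x, D x -> forall i, A k x 0 i @[k --> \oo] --> B x 0 i}.
Proof.
move=> MA cvA.
have /choice[U HU] : forall k, exists U : T -> 'rV[R]_n, (forall i, measurable_fun D (fun x => U x 0 i)) /\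
    A k = qfield U.
  by move=> k; have [U mU ->] := MA k; exists U.
have sym x : D x -> (sqrtmx (Q x))^T = sqrtmx (Q x).
  by move=> Dx; have [[]] := sqrtmxP (Q_psd Dx).
have sq x : D x -> sqrtmx (Q x) *m sqrtmx (Q x) = Q x.
  by move=> Dx; have [] := sqrtmxP (Q_psd Dx).
have AE k x : D x -> A k x = U k x *m sqrtmx (Q x).
  by move=> Dx; rewrite (HU k).2 /qfield /mulmxv sym.
have mf i k : measurable_fun D (fun x => mulmxv (Q x) (U k x) 0 i).
  by apply: measurable_fun_mulmxv => //; exact: (HU k).1.
have fE k x : D x -> mulmxv (Q x) (U k x) = A k x *m sqrtmx (Q x).
  by move=> Dx; rewrite AE// -mulmxA sq// /mulmxv (Q_psd Dx).1.
have fcvg x (a : 'rV[R]_n) i : D x -> (forall i, A k x 0 i @[k --> \oo] --> a 0 i) ->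
    mulmxv (Q x) (U k x) 0 i @[k --> \oo] --> (a *m sqrtmx (Q x)) 0 i.
  move=> Dx Ax; rewrite mxE (_ : (fun k => _) =
    (fun k => \sum_j A k x 0 j * sqrtmx (Q x) j i)); last first.
    by apply/funext => k; rewrite fE// mxE.
  by apply: cvg_bigsum => j; apply: cvgMr_tmp; exact: Ax.
have Acvg x : (forall i, cvgn (fun k => A k x 0 i)) ->
    forall i, A k x 0 i @[k --> \oo] -->
      (\row_j limn (fun k => A k x 0 j) : 'rV[R]_n) 0 i.
  by move=> H i; rewrite mxE; exact: H.
have cvf i : {ae mu, forall x, D x -> cvgn (fun k => mulmxv (Q x) (U k x) 0 i)}.
  apply: filterS cvA => x H Dx; apply/cvg_ex.
  by exists ((\row_j limn (fun k => A k x 0 j) *m sqrtmx (Q x)) 0 i); exact: fcvg (Acvg _ (H Dx)).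
have /choice[g Hg] : forall i, exists g : T -> R, measurable_fun D g /\
    {ae mu, forall x, D x -> mulmxv (Q x) (U k x) 0 i @[k --> \oo] --> g x}.
  by move=> i; have [g mg fg] := measurable_ae_limit mD (mf i) (cvf i); exists g.
have := filterI cvA (@filter_forall _ _ _ _ _ (fun i => (Hg i).2)).
move=> [N [mN N0 subN]].
have HN x : D x -> ~ N x -> (forall i, cvgn (fun k => A k x 0 i)) /\
    forall i, mulmxv (Q x) (U k x) 0 i @[k --> \oo] --> g i x.
  move=> Dx xN; have : ~ ~ _ := fun H => xN (subN x H).
  by move=> /contrapT[H1 H2]; split=> [|i]; [exact: H1|exact: H2].
pose Z x : 'rV[R]_n := \row_i (g i \_ (D `\` N)) x.
have mZ i : measurable_fun D (fun x => Z x 0 i).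
  under eq_fun do rewrite mxE.
  apply: measurable_funTS; apply/(measurable_restrictT _ (measurableD mD mN)).
  by apply: measurable_funS (Hg i).1 => // x [].
pose a x : 'rV[R]_n := \row_i limn (fun k => A k x 0 i).
have ZN x : D x -> N x -> Z x = 0.
  move=> Dx Nx; apply/rowP => i; rewrite !mxE patchE; case: ifPn => //.
  by rewrite inE => -[].
have Za x : D x -> ~ N x -> Z x = a x *m sqrtmx (Q x).
  move=> Dx xN; have [H1 H2] := HN x Dx xN; apply/rowP => i.
  rewrite mxE patchE mem_set//; apply: (cvg_unique _ (H2 i)) => //.
  exact: fcvg (Acvg _ H1).
have arange x : D x -> ~ N x -> exists y, a x = y *m sqrtmx (Q x).
  move=> Dx xN; have [H1 _] := HN x Dx xN.
  apply: (@row_image_closed _ _ _ (U ^~ x)) => i.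
  rewrite (_ : (fun k => (U k x *m sqrtmx (Q x)) 0 i) = (fun k => A k x 0 i)); first exact: Acvg.
  by apply/funext => k; rewrite AE.
(* The limit of the [A k x] stays in the row space of [sqrtmx (Q x)], which is closed; one more
   factor [sqrtmx (Q x)] brings it into that of [Q x]. *)
have Zrange x : D x -> exists y, Z x = y *m Q x.
  move=> Dx; have [Nx|xN] := pselect (N x); first by exists 0; rewrite mul0mx ZN.
  have [y ya] := arange x Dx xN; exists y.
  by rewrite Za// ya -mulmxA sq.
have [W mW WQ] := measurable_solution mD mQ Q_psd mZ Zrange.
exists (qfield W); first by exists W.
exists N; split=> // x; apply: contra_notP => xN Dx i.
have [H1 _] := HN x Dx xN.
suff -> : qfield W x = a x by exact: Acvg.
have [y ya] := arange x Dx xN.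
(* [W x] and [y] have the same image under [Q x], hence under its square root: the two have the same
   kernel. *)
rewrite /qfield /mulmxv sym// ya; apply/eqP; rewrite -subr_eq0 -mulmxBl; apply/eqP.
apply: dot_eq0; rewrite dot_mulmx sym// -mulmxA sq// mulmxBl WQ// Za// ya -mulmxA sq//.
by rewrite subrr dotC dot0l.
Qed.

Lemma qfield_form : energy_form p (finE mu D p qfields)
  (@En R d T mu D p n) (@Fl R d T mu D p n).
Proof.
have H := field_energy_form mD p1 (@qfields_comb) (@qfields_dot) qfields_limit.
exact: H.
Qed.

End matrix.
End weighted_fields.

(** * The Dirichlet problem *)

(** With [k = F^(1/p)], the factor that comes out is [F]. *)
Lemma flux_homog {R : realType} n (p k : R) (a b : 'rV[R]_n) : 1 < p -> 0 <= k ->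
  flux p (k *: a) (k *: b) = k `^ p * flux p a b.
Proof.
move=> p1; rewrite le_eqVlt => /predU1P[<-|k0].
  by rewrite /flux !scale0r dot0l mulr0 powR0 ?mul0r// gt_eqF// (lt_trans _ p1).
rewrite /flux enormZ dotZl dotZr gtr0_norm// powRM ?enorm_ge0 ?ltW//.
have -> : k `^ p = k `^ (p - 2) * (k * k); last by ring.
rewrite -expr2 -powR_mulrn ?ltW// -powRD ?subrK//.
by rewrite (gt_eqF k0) implybT.
Qed.

Section dirichlet.
Context {R : realType} (n : nat) (Omega : set 'rV[R]_n) (p : R).
Variables (v : 'rV[R]_n -> R) (Q : 'rV[R]_n -> 'M[R]_n).
Hypotheses (openO : open Omega) (p1 : 1 < p) (mv : measurable_on Omega v)
  (v_ge0 : forall x, Omega x -> 0 <= v x)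
  (mQ : forall i j, measurable_on Omega (fun x => Q x i j))
  (Q_psd : forall x, Omega x -> psdmx (Q x)).
Implicit Types (u f g phi F : 'rV[R]_n -> R) (U t : 'rV[R]_n -> 'rV[R]_n).

Local Notation T := (lebT R n).
Local Notation mu := (@leb R n).
Local Notation D := (Omega : set T).

Let p0 : 0 < p. Proof. exact: lt_trans p1. Qed.

Let mD : measurable D. Proof. exact: open_measurable_lebT. Qed.

Definition vfield u : T -> 'rV[R]_1 := @wfield R _ T p v u.
Definition Qfield U : T -> 'rV[R]_n := @qfield R _ T n Q U.
Definition fin_v : set (T -> 'rV[R]_1) := finE mu D p (@wfields R _ T D p v).
Definition fin_Q : set (T -> 'rV[R]_n) := finE mu D p (@qfields R _ T D n Q).
Definition Ev : (T -> 'rV[R]_1) -> R := @En R _ T mu D p 1.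
Definition EQ : (T -> 'rV[R]_n) -> R := @En R _ T mu D p n.
Definition Fv : (T -> 'rV[R]_1) -> (T -> 'rV[R]_1) -> R := @Fl R _ T mu D p 1.
Definition FQ : (T -> 'rV[R]_n) -> (T -> 'rV[R]_n) -> R := @Fl R _ T mu D p n.

Lemma vform : energy_form p fin_v Ev Fv.
Proof.
have H := @wfield_form R _ T mu D p mD p1 v mv.
rewrite /fin_v /Ev /Fv.
exact H.
Qed.

Lemma Qform : energy_form p fin_Q EQ FQ.
Proof.
have H := @qfield_form R _ T mu D p mD p1 n Q mQ Q_psd.
rewrite /fin_Q /EQ /FQ.
exact H.
Qed.

Lemma LpnormE u : Lpnorm p v Omega u = (energy mu D p (vfield u) `^ p^-1)%E.
Proof.
congr (_ `^ _)%E; apply: eq_integral => x; rewrite inE => Dx.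
by rewrite (@pw_wfield R _ T D p p1 v v_ge0).
Qed.

Lemma QLpnormE U : QLpnorm p Q Omega U = (energy mu D p (Qfield U) `^ p^-1)%E.
Proof. by []. Qed.

Lemma energy_poweR_lty m (A : T -> 'rV[R]_m) :
  (energy mu D p A `^ p^-1 < +oo)%E -> (energy mu D p A < +oo)%E.
Proof. by apply: lty_poweRy; rewrite invr_neq0 ?gt_eqF. Qed.

Lemma vfield_in u : measurable_on Omega u -> @wfields R _ T D p v (vfield u).
Proof. move=> mu'; exact (ex_intro2 _ _ u mu' erefl). Qed.

Lemma Qfield_in U : vmeasurable_on Omega U -> @qfields R _ T D n Q (Qfield U).
Proof. move=> mU; exact (ex_intro2 _ _ U mU erefl). Qed.

Lemma Lp_fin u : Lp p v Omega u -> fin_v (vfield u).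
Proof.
move=> [mu']; rewrite LpnormE => /energy_poweR_lty Eu.
exact (conj (vfield_in mu') Eu).
Qed.

Lemma fin_Lp u : measurable_on Omega u -> fin_v (vfield u) -> Lp p v Omega u.
Proof. by move=> mu' [_ Eu]; split=> //; rewrite LpnormE; exact: poweR_lty. Qed.

Lemma QLp_fin U : QLp p Q Omega U -> fin_Q (Qfield U).
Proof.
move=> [mU]; rewrite QLpnormE => /energy_poweR_lty EU.
exact (conj (Qfield_in mU) EU).
Qed.

Lemma fin_QLp U : vmeasurable_on Omega U -> fin_Q (Qfield U) -> QLp p Q Omega U.
Proof. by move=> mU [_ EU]; split=> //; rewrite QLpnormE; exact: poweR_lty. Qed.

Lemma Lpnorm_Ev u : fin_v (vfield u) -> Lpnorm p v Omega u = (Ev (vfield u) `^ p^-1)%:E.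
Proof.
move=> fu; rewrite LpnormE.
by rewrite (energyE mD (@wfields_dot R _ T D p v mv) fu) poweR_EFin.
Qed.

Lemma QLpnorm_EQ U : fin_Q (Qfield U) -> QLpnorm p Q Omega U = (EQ (Qfield U) `^ p^-1)%:E.
Proof.
move=> fU; rewrite QLpnormE.
by rewrite (energyE mD (@qfields_dot R _ T D n Q mQ Q_psd) fU) poweR_EFin.
Qed.

Lemma powR_invK (x : R) : 0 <= x -> (x `^ p^-1) `^ p = x.
Proof. by move=> x0; rewrite -powRrM mulVf ?gt_eqF// powRr1. Qed.

Lemma powR_Kinv (x : R) : 0 <= x -> (x `^ p) `^ p^-1 = x.
Proof. by move=> x0; rewrite -powRrM mulfV ?gt_eqF// powRr1. Qed.

Lemma le_root (x y C : R) : 0 <= x -> 0 <= y -> 0 <= C ->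
  x `^ p^-1 <= C * y `^ p^-1 <-> x <= C `^ p * y.
Proof.
move=> x0 y0 C0; have yr : 0 <= C * y `^ p^-1 by rewrite mulr_ge0// powR_ge0.
split=> [/(le_powR p1 (powR_ge0 _ _))|xle].
  by rewrite powRM// ?powR_ge0// !powR_invK.
rewrite -(powR_Kinv C0) -powRM ?powR_ge0//.
apply: ge0_ler_powR; rewrite ?nnegrE ?invr_ge0 ?(ltW p0)//.
by rewrite mulr_ge0// powR_ge0.
Qed.

(** With [sum_root_small] below, this matches the two notions of closure: sums of norms in [QH0],
    sums of p-th powers in [in_closure]. *)
Lemma root_sum_small (x y e : R) : 0 <= x -> 0 <= y -> 0 < e ->
  x `^ p^-1 + y `^ p^-1 < (e / 2) `^ p^-1 -> x + y < e.
Proof.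
move=> x0 y0 e0 lt; have rx := powR_ge0 x p^-1; have ry := powR_ge0 y p^-1.
have e2 : ((e / 2) `^ p^-1) `^ p = e / 2 by rewrite powR_invK// ltW// divr_gt0.
rewrite [ltRHS](splitr e) -e2 -(powR_invK x0) -(powR_invK y0).
apply: ltrD; apply: lt_powR => //; apply: le_lt_trans lt.
  by rewrite lerDl.
by rewrite lerDr.
Qed.

Lemma sum_root_small (x y e : R) : 0 <= x -> 0 <= y -> 0 < e ->
  x + y < (e / 2) `^ p -> x `^ p^-1 + y `^ p^-1 < e.
Proof.
move=> x0 y0 e0 lt; have p'0 : 0 < p^-1 by rewrite invr_gt0.
have e2 : ((e / 2) `^ p) `^ p^-1 = e / 2 by rewrite powR_Kinv// ltW// divr_gt0.
rewrite [ltRHS](splitr e) -e2; apply: ltrD; apply: lt_powR => //.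
  by apply: le_lt_trans lt; rewrite lerDl.
by apply: le_lt_trans lt; rewrite lerDr.
Qed.

Lemma QLip0_Lp phi : QLip0 p v Q Omega phi ->
  Lp p v Omega phi /\ QLp p Q Omega (grad phi).
Proof.
move=> [[Lphi _ _] [_ lt]].
have vq : (0 <= Lpnorm p v Omega phi)%E by rewrite LpnormE poweR_ge0.
have qq : (0 <= QLpnorm p Q Omega (grad phi))%E by rewrite QLpnormE poweR_ge0.
split; split.
- exact: Lip_loc_measurable.
- by apply: le_lt_trans lt; rewrite leeDl.
- exact: grad_measurable.
- by apply: le_lt_trans lt; rewrite leeDr.
Qed.

Lemma QLip0_fin phi : QLip0 p v Q Omega phi ->
  fin_v (vfield phi) /\ fin_Q (Qfield (grad phi)).
Proof. by move=> /QLip0_Lp[/Lp_fin ? /QLp_fin ?]. Qed.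

Lemma vfield_comb phi psi k :
  vfield (fun x => phi x + k * psi x) = vfield phi + k *: vfield psi.
Proof. exact: (@wfieldD R _ T p v phi psi k). Qed.

Lemma Qfield_comb_ae phi psi k : QLip0 p v Q Omega phi -> QLip0 p v Q Omega psi ->
  {ae mu, forall x, D x -> (Qfield (grad phi) + k *: Qfield (grad psi)) x =
    Qfield (grad (fun x => phi x + k * psi x)) x}.
Proof.
move=> [[Lphi _ _] _] [[Lpsi _ _] _].
apply: filterS (grad_comb_ae openO k Lphi Lpsi) => x H Dx.
rewrite [LHS]/GRing.add /= /GRing.scale /=.
by rewrite /Qfield /qfield (H Dx) /mulmxv mulmxDl -scalemxAl.
Qed.

Lemma QLip0_comb phi psi k : QLip0 p v Q Omega phi -> QLip0 p v Q Omega psi ->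
  QLip0 p v Q Omega (fun x => phi x + k * psi x).
Proof.
move=> qphi qpsi; have [fphi gphi] := QLip0_fin qphi; have [fpsi gpsi] := QLip0_fin qpsi.
have L0 := Lip0_comb k qphi.1 qpsi.1; split=> //; have [Lc _ _] := L0; split=> //.
have fv : fin_v (vfield (fun x => phi x + k * psi x)).
  by rewrite vfield_comb; exact: (form_comb vform k fphi fpsi).
have fQ : fin_Q (Qfield (grad (fun x => phi x + k * psi x))).
  (* The gradient of the combination agrees with the combination of gradients almost everywhere
     only, so finiteness is transferred along that equality. *)
  apply: (ae_eq_finE mD (@qfields_dot R _ T D n Q mQ Q_psd) _
    (form_comb Qform k gphi gpsi) (Qfield_comb_ae k qphi qpsi)).
  exact: (Qfield_in (grad_measurable openO Lc)).
by rewrite (Lpnorm_Ev fv) (QLpnorm_EQ fQ) -EFinD ltry.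
Qed.

Lemma vfield0 : vfield (fun=> 0) = 0.
Proof. by apply/funext => x; apply/rowP => i; rewrite ord1 !mxE eqxx mulr1n mulr0. Qed.

Lemma Qfield0 : Qfield (fun=> 0) = 0.
Proof. by apply/funext => x; rewrite /Qfield /qfield /mulmxv mul0mx. Qed.

Lemma measurable_cst_on (k : R) : measurable_on Omega (fun=> k).
Proof. exact: measurable_cst. Qed.

Lemma vmeasurable_cst_on (k : 'rV[R]_n) : vmeasurable_on Omega (fun=> k).
Proof. by move=> i; exact: measurable_cst. Qed.

Lemma energy0 m : energy mu D p (0 : T -> 'rV[R]_m) = 0%E.
Proof.
rewrite /energy; under eq_integral do rewrite /pw enorm0 powR0 ?gt_eqF//.
exact: integral0.
Qed.

Lemma fin_v0 : fin_v 0.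
Proof.
split; first by rewrite -vfield0; exact: (vfield_in (measurable_cst_on 0)).
by rewrite energy0 ltry.
Qed.

Lemma fin_Q0 : fin_Q 0.
Proof.
split; first by rewrite -Qfield0; exact: (Qfield_in (vmeasurable_cst_on 0)).
by rewrite energy0 ltry.
Qed.

Lemma grad0 : grad (fun=> 0 : R) = (fun=> 0) :> ('rV[R]_n -> 'rV[R]_n).
Proof. by apply/funext => x; apply/rowP => i; rewrite !mxE derive_cst. Qed.

Lemma QLip0_0 : QLip0 p v Q Omega (fun=> 0).
Proof.
have L : Lip_loc Omega (fun=> 0 : R).
  move=> K _ _; apply/lipschitz_onP; exists 0 => x y _ _.
  by rewrite subrr normr0 mul0r.
have E0 : Omega `&` [set x | (0 : R) != 0] = set0.
  by apply/seteqP; split=> x //= -[_]; rewrite eqxx.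
split; first by split; [exact: L|rewrite E0 closure0; exact: compact0|rewrite E0 closure0].
split; first exact: L.
rewrite LpnormE QLpnormE vfield0 grad0 Qfield0 !energy0.
by rewrite poweR_EFin powR0 ?invr_neq0 ?gt_eqF// -EFinD ltry.
Qed.

Definition along t phi (x : 'rV[R]_n) : R := dot (t x) (grad phi x).

Lemma along_measurable t phi : vmeasurable_on Omega t -> QLip0 p v Q Omega phi ->
  measurable_on Omega (along t phi).
Proof.
move=> mt [[Lphi _ _] _]; have mg := grad_measurable openO Lphi.
exact: (@measurable_fun_dot R _ T n D t (grad phi) mt mg).
Qed.

Lemma Qnorm_fin phi : QLip0 p v Q Omega phi ->
  QLpnorm p Q Omega (grad phi) = (EQ (Qfield (grad phi)) `^ p^-1)%:E.
Proof. by move=> /QLip0_fin[_]; exact: QLpnorm_EQ. Qed.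

Lemma Qenergy_ge0 B : 0 <= EQ B.
Proof. exact: (form_ge0 Qform). Qed.

Lemma venergy_ge0 A : 0 <= Ev A.
Proof. exact: (form_ge0 vform). Qed.

Lemma subunit_energy t : subunit p v Q Omega t -> exists2 C, 0 <= C &
  forall phi, QLip0 p v Q Omega phi -> fin_v (vfield (along t phi)) /\
    Ev (vfield (along t phi)) <= C * EQ (Qfield (grad phi)).
Proof.
move=> [mt [C HC]]; exists (`|C| `^ p) => [|phi qphi]; first exact: powR_ge0.
have mtphi := along_measurable mt qphi; have := HC _ qphi; rewrite Qnorm_fin// => le.
have r0 : 0 <= EQ (Qfield (grad phi)) `^ p^-1 by exact: powR_ge0.
have fin : fin_v (vfield (along t phi)).
  apply: Lp_fin; split=> //; apply: (le_lt_trans le).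
  by rewrite -EFinM ltry.
split=> //; move: le; rewrite (Lpnorm_Ev fin) -EFinM lee_fin => le.
apply/(le_root (venergy_ge0 _) (Qenergy_ge0 _) (normr_ge0 C)).
by apply: (le_trans le); rewrite ler_wpM2r// ler_norm.
Qed.

Lemma sobolev_energy : p_Sobolev p v Q Omega <-> exists2 K, 0 <= K &
  forall phi, QLip0 p v Q Omega phi ->
    Ev (vfield phi) <= K * EQ (Qfield (grad phi)).
Proof.
split=> [[S [S0 HS]]|[K K0 HK]].
  exists (S `^ p) => [|phi qphi]; first exact: powR_ge0.
  have [fin _] := QLip0_fin qphi.
  have := HS _ qphi; rewrite (Lpnorm_Ev fin) Qnorm_fin// -EFinM lee_fin => le.
  exact/(le_root (venergy_ge0 _) (Qenergy_ge0 _) (ltW S0)).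
(* [K] may be 0, while the Sobolev constant has to be positive. *)
have K10 : 0 < K + 1 by rewrite ltr_wpDl.
exists ((K + 1) `^ p^-1); split=> [|phi qphi]; first exact: powR_gt0.
have [fin _] := QLip0_fin qphi.
rewrite (Lpnorm_Ev fin) Qnorm_fin// -EFinM lee_fin.
apply/(le_root (venergy_ge0 _) (Qenergy_ge0 _) (powR_ge0 _ _)).
rewrite powR_invK ?(ltW K10)//; apply: (le_trans (HK _ qphi)).
by rewrite ler_wpM2r ?Qenergy_ge0// lerDl.
Qed.

Section tests.
Variable t : 'rV[R]_n -> 'rV[R]_n.
Hypothesis subt : subunit p v Q Omega t.

(* closed under linear combinations although [grad] is linear almost everywhere only *)
Definition tests (a : T -> 'rV[R]_1) (b : T -> 'rV[R]_n) (g : T -> 'rV[R]_1) : Prop :=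
  exists2 phi, QLip0 p v Q Omega phi & [/\ a = vfield phi,
    fin_Q b /\ {ae mu, forall x, D x -> b x = Qfield (grad phi) x} &
    fin_v g /\ {ae mu, forall x, D x -> g x = vfield (along t phi) x}].

Lemma tests_of phi : QLip0 p v Q Omega phi ->
  tests (vfield phi) (Qfield (grad phi)) (vfield (along t phi)).
Proof.
move=> qphi; have [C _ HC] := subunit_energy subt; have [fin _] := HC _ qphi.
have [_ fQ] := QLip0_fin qphi.
exists phi => //; split; [by []|split; first exact: fQ|split; first exact: fin].
  by apply: aeW.
by apply: aeW.
Qed.

Lemma tests_fin a b h : tests a b h -> [/\ fin_v a, fin_Q b & fin_v h].
Proof.
move=> [phi qphi [-> [fb _] [fg _]]]; have [fa _] := QLip0_fin qphi.
by split; [exact: fa|exact: fb|exact: fg].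
Qed.

Lemma tests0 : tests 0 0 0.
Proof.
exists (fun=> 0); first exact: QLip0_0.
split; first by rewrite vfield0.
  by split; [exact: fin_Q0|apply: aeW => x _; rewrite grad0 Qfield0].
split; first exact: fin_v0.
apply: aeW => x _; rewrite (_ : along t _ = fun=> 0) ?vfield0//.
by apply/funext => y; rewrite /along grad0 dotC dot0l.
Qed.

Lemma tests_comb a b h a' b' h' k : tests a b h -> tests a' b' h' ->
  tests (a + k *: a') (b + k *: b') (h + k *: h').
Proof.
move=> [phi qphi [-> [fb bE] [fg gE]]] [psi qpsi [-> [fb' b'E] [fg' g'E]]].
exists (fun x => phi x + k * psi x); first exact: QLip0_comb.
split; first by rewrite vfield_comb.
  split; first exact: (form_comb Qform k fb fb').
  apply: filterS (filterI (filterI bE b'E) (Qfield_comb_ae k qphi qpsi)).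
  move=> x [[Hb Hb'] Hx] Dx; rewrite -(Hx Dx).
  change (b x + k *: b' x = Qfield (grad phi) x + k *: Qfield (grad psi) x).
  by rewrite (Hb Dx) (Hb' Dx).
split; first exact: (form_comb vform k fg fg').
have [[Lphi _ _] _] := qphi; have [[Lpsi _ _] _] := qpsi.
apply: filterS (filterI (filterI gE g'E) (grad_comb_ae openO k Lphi Lpsi)).
move=> x [[Hg Hg'] Hx] Dx.
change (h x + k *: h' x = vfield (along t (fun x => phi x + k * psi x)) x).
rewrite (Hg Dx) (Hg' Dx).
have := congr1 (@^~ x) (vfield_comb (along t phi) (along t psi) k).
change (vfield (along t phi) x + k *: vfield (along t psi) x) with
  ((vfield (along t phi) + k *: vfield (along t psi)) x).
move=> <-.
by rewrite /vfield /wfield; congr ((_ * _)%:M); rewrite /along Hx// dotDr dotZr.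
Qed.

Let mdot_v := @wfields_dot R _ T D p v mv.
Let mdot_Q := @qfields_dot R _ T D n Q mQ Q_psd.

(** Energies and fluxes do not see null sets, so [b] and [h] can be replaced by the fields of a
    genuine test function. *)
Lemma testsE a b h : tests a b h -> exists2 phi, QLip0 p v Q Omega phi &
  [/\ a = vfield phi,
    EQ b = EQ (Qfield (grad phi)) /\ Ev h = Ev (vfield (along t phi)),
    forall B, fin_Q B -> FQ B b = FQ B (Qfield (grad phi)) /\
      EQ (B - b) = EQ (B - Qfield (grad phi)) &
    forall A, fin_v A -> Fv A h = Fv A (vfield (along t phi))].
Proof.
move=> [phi qphi [-> [fb bE] [fh hE]]]; exists phi; first exact: qphi.
have [_ fB] := QLip0_fin qphi; have [_ _ fH] := tests_fin (tests_of qphi).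
split; [by []| |move=> B fB'|move=> A fA].
- split; first exact: (ae_eq_En p mD mdot_Q fb.1 fB.1 bE).
  exact: (ae_eq_En p mD mdot_v fh.1 fH.1 hE).
- split; first exact: (ae_eq_Fl p mD mdot_Q fb.1 fB.1 fB'.1 bE).
  apply: (ae_eq_En p mD mdot_Q (form_sub Qform fB' fb).1 (form_sub Qform fB' fB).1).
  apply: filterS bE => x Hx Dx.
  by change (B x - b x = B x - Qfield (grad phi) x); rewrite (Hx Dx).
- exact: (ae_eq_Fl p mD mdot_v fh.1 fH.1 fA.1 hE).
Qed.

Lemma tests_sobolev K : (forall phi, QLip0 p v Q Omega phi ->
    Ev (vfield phi) <= K * EQ (Qfield (grad phi))) ->
  forall a b h, tests a b h -> Ev a <= K * EQ b.
Proof.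
by move=> HK a b h /testsE[phi qphi [-> [-> _] _ _]]; exact: HK.
Qed.

Lemma tests_subunit : exists C, forall a b h, tests a b h -> Ev h <= C * EQ b.
Proof.
have [C _ HC] := subunit_energy subt; exists C.
by move=> a b h /testsE[phi qphi [_ [-> ->] _ _]]; have [] := HC _ qphi.
Qed.

Lemma vfieldB u w : vfield u - vfield w = vfield (u \- w).
Proof.
rewrite -scaleN1r -(vfield_comb u w (-1)); congr vfield.
by apply/funext => x; rewrite mulN1r.
Qed.

Lemma QfieldB U W : Qfield U - Qfield W = Qfield (U \- W).
Proof.
apply/funext => x; change (Qfield U x - Qfield W x = Qfield (U \- W) x).
by rewrite /Qfield /qfield /mulmxv -mulmxBl.
Qed.

Local Notation closure_of_tests := (in_closure fin_v Ev fin_Q EQ tests).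

Lemma QH0_closure u U : QH0 p v Q Omega u U -> closure_of_tests (vfield u) (Qfield U).
Proof.
move=> [/Lp_fin fu /QLp_fin fU H]; split; [exact: fu|exact: fU|move=> e e0].
have d0 : 0 < (e / 2) `^ p^-1 by rewrite powR_gt0// divr_gt0.
have [phi qphi lt0] := H _ d0; have [fphi gphi] := QLip0_fin qphi.
exists (vfield phi), (Qfield (grad phi)), (vfield (along t phi)).
split; first exact: tests_of.
have fd := form_sub vform fu fphi; have gd := form_sub Qform fU gphi.
rewrite vfieldB in fd *; rewrite QfieldB in gd *.
move: lt0; rewrite (Lpnorm_Ev fd) (QLpnorm_EQ gd) -EFinD lte_fin.
by move=> /(root_sum_small (venergy_ge0 _) (Qenergy_ge0 _) e0).
Qed.

Lemma closure_QH0 u U : measurable_on Omega u -> vmeasurable_on Omega U ->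
  closure_of_tests (vfield u) (Qfield U) -> QH0 p v Q Omega u U.
Proof.
move=> mu' mU [fu fU H]; split; [exact: fin_Lp|exact: fin_QLp|move=> e e0].
have d0 : 0 < (e / 2) `^ p by rewrite powR_gt0// divr_gt0.
have [a [b [h [/testsE[phi qphi [-> _ /(_ _ fU)[_ ->] _]] lt]]]] := H _ d0.
exists phi => //; have [fphi gphi] := QLip0_fin qphi.
have fd := form_sub vform fu fphi; have gd := form_sub Qform fU gphi.
rewrite vfieldB in fd lt; rewrite QfieldB in gd lt.
rewrite (Lpnorm_Ev fd) (QLpnorm_EQ gd) -EFinD lte_fin.
exact: (sum_root_small (venergy_ge0 _) (Qenergy_ge0 _) e0 lt).
Qed.

End tests.

(** Null sets of [v dx] are null up to the zero set of [v]. This turns conditions on [F] and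
    equality in the weighted space into statements about Lebesgue measure. *)
Lemma ae_vdxP (P : T -> Prop) : {ae vdx v Omega, forall x, Omega x -> P x} <->
  {ae mu, forall x, D x -> 0 < v x -> P x}.
Proof.
have mE (B : set T) : measurable B -> measurable_fun (B `&` D) (fun x : T => (v x)%:E).
  by move=> mB; apply/measurable_EFinP; apply: measurable_funS mv => //; exact: subIsetr.
have vdxE (B : set T) : vdx v Omega B = (\int[mu]_(x in B `&` D) `|(v x)%:E|)%E.
  apply: eq_integral => x; rewrite inE => -[_ Dx].
  by rewrite gee0_abs// lee_fin v_ge0.
split=> [[B [mB B0 subB]]|[N [mN N0 subN]]].
  have mBD := measurableI _ _ mB mD.
  move: B0; rewrite vdxE => /(ae_eq_integral_abs mu mBD (mE B mB)).
  apply: filterS => x H Dx vx; apply: contrapT => Px.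
  have [v0] : (v x)%:E = 0%E by apply: H; split=> //; apply: subB => /(_ Dx).
  by rewrite v0 ltxx in vx.
(* The zero set of [v] is measurable and has no mass for [v dx]. *)
pose Z := D `&` (v : T -> R) @^-1` [set 0].
have mZ : measurable Z by exact: mv mD _ (measurable_set1 0).
exists (N `|` Z); split; first exact: measurableU.
  rewrite vdxE; apply/ae_eq_integral_abs.
  - by apply: measurableI => //; exact: measurableU.
  - by apply: mE; exact: measurableU.
  - exists N; split=> // x; apply: contra_notP => xN -[[//|[_ vx0]] _].
    by rewrite vx0.
move=> x; apply: contra_notP => /not_orP[xN xZ] Dx.
apply: contrapT => Px; apply: xN; apply: subN => H; apply: Px; apply: H => //.
rewrite lt_neqAle v_ge0// andbT eq_sym; apply/eqP => vx0.
by apply: xZ; split.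
Qed.

Lemma FvE u phi : Fv (vfield u) (vfield phi) =
  \int[mu]_(x in D) (signed_pow p (u x) * phi x * v x).
Proof.
by apply: eq_Rintegral => x; rewrite inE => Dx; exact: (@flux_wfield R _ T D p p1 v v_ge0).
Qed.

Lemma FQE U W : FQ (Qfield U) (Qfield W) = \int[mu]_(x in D)
  (enorm (mulmxv (sqrtmx (Q x)) (U x)) `^ (p - 2) * dot (mulmxv (Q x) (U x)) (W x)).
Proof.
apply: eq_Rintegral => x; rewrite inE => Dx.
by rewrite -(dot_sqrtmx _ _ (Q_psd Dx)).
Qed.

(** * The zero-order coefficient *)

Section coefficient.
Variable F : 'rV[R]_n -> R.
Hypotheses (F_bounded : Linfty v Omega F)
  (F_ge0 : {ae vdx v Omega, forall x, Omega x -> 0 <= F x}).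

(* [F] is only nonnegative almost everywhere for [v dx] *)
Definition coef (a : T -> 'rV[R]_1) : T -> 'rV[R]_1 :=
  fun x => Num.max 0 (F x) `^ p^-1 *: a x.

Let max0 x : 0 <= Num.max 0 (F x). Proof. by rewrite le_max lexx. Qed.

Lemma coef_comb a b k : coef (a + k *: b) = coef a + k *: coef b.
Proof.
apply/funext => x.
change (Num.max 0 (F x) `^ p^-1 *: (a x + k *: b x) =
  Num.max 0 (F x) `^ p^-1 *: a x + k *: (Num.max 0 (F x) `^ p^-1 *: b x)).
by rewrite scalerDr !scalerA mulrC.
Qed.

Lemma coef_in a : @wfields R _ T D p v a -> @wfields R _ T D p v (coef a).
Proof.
move=> [u mu' ->].
have -> : coef (@wfield R _ T p v u) = vfield (fun x => Num.max 0 (F x) `^ p^-1 * u x).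
  by apply/funext => x; apply/rowP => i; rewrite !ord1 !mxE eqxx !mulr1n mulrCA.
have mc : measurable_fun D (fun x : T => Num.max 0 (F x) `^ p^-1).
  apply: (measurableT_comp (measurable_powR p^-1)).
  apply: measurable_maxr; first exact: measurable_cst.
  exact F_bounded.1.
exact (vfield_in (measurable_funM mc mu')).
Qed.

Lemma pw_coef a x : pw p (coef a x) = Num.max 0 (F x) * pw p (a x).
Proof. by rewrite pwZ ger0_norm ?powR_ge0// powR_invK ?max0. Qed.

Lemma coef_fin : exists K, forall a, fin_v a -> fin_v (coef a) /\ Ev (coef a) <= K * Ev a.
Proof.
have [mF [M HM]] := F_bounded; exists `|M| => a fa.
have [[u mu' aE] _] := fa.
have ca := coef_in fa.1.
have mdot := @wfields_dot R _ T D p v mv.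
have mpa : measurable_fun D (fun x => pw p (a x)) by have := measurable_pw p mdot fa.1.
have mpc : measurable_fun D (fun x => pw p (coef a x)) by have := measurable_pw p mdot ca.
have le : (energy mu D p (coef a) <= `|M|%:E * energy mu D p a)%E.
  have pos (A : T -> 'rV[R]_1) x : D x -> (0 <= (pw p (A x))%:E)%E.
    by move=> _; rewrite lee_fin pw_ge0.
  have mea := (measurable_EFinP D _).2 mpa.
  have mec := (measurable_EFinP D _).2 mpc.
  rewrite /energy -(ge0_integralZl mu mD mea (pos a) (_ : (0 <= `|M|%:E)%E)); last first.
    by rewrite lee_fin.
  have meM := measurable_funeM `|M|%:E mea.
  apply: (ae_ge0_le_integral mD (pos (coef a)) mec _ meM).
    by move=> x Dx; apply: mule_ge0; rewrite ?lee_fin// pw_ge0.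
  (* The essential bound is available where [v] is positive; both sides vanish where [v] does. *)
  move/ae_vdxP : HM; apply: filterS => x H Dx.
  rewrite -EFinM lee_fin pw_coef aE (@pw_wfield R _ T D p p1 v v_ge0)//.
  have := v_ge0 Dx; rewrite le_eqVlt => /predU1P[<-|vx]; first by rewrite !mulr0.
  apply: ler_wpM2r; first by rewrite mulr_ge0 ?powR_ge0 ?ltW.
  rewrite ge_max normr_ge0/=.
  by rewrite (le_trans (ler_norm _))// (le_trans (H Dx vx))// ler_norm.
have fca : fin_v (coef a).
  split=> //; apply: (le_lt_trans le); rewrite (energyE mD mdot fa).
  by rewrite -EFinM ltry.
split; first exact: fca.
have ea := energyE mD mdot fa; have eca := energyE mD mdot fca.
by rewrite ea eca -EFinM lee_fin in le.
Qed.

Lemma FcE u phi : measurable_on Omega u -> measurable_on Omega phi ->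
  Fv (coef (vfield u)) (coef (vfield phi)) =
  \int[mu]_(x in D) (F x * signed_pow p (u x) * phi x * v x).
Proof.
move=> mu' mphi; have mdot := @wfields_dot R _ T D p v mv.
have fE x : D x -> F x * signed_pow p (u x) * phi x * v x =
    F x * flux p (vfield u x) (vfield phi x).
  by move=> Dx; rewrite (@flux_wfield R _ T D p p1 v v_ge0)// !mulrA.
have -> : \int[mu]_(x in D) (F x * signed_pow p (u x) * phi x * v x) =
    \int[mu]_(x in D) (F x * flux p (vfield u x) (vfield phi x)).
  by apply: eq_Rintegral => x; rewrite inE; exact: fE.
have m1 : measurable_fun D (fun x : T => flux p (coef (vfield u) x) (coef (vfield phi) x)).
  exact (measurable_flux p mdot (coef_in (vfield_in mu')) (coef_in (vfield_in mphi))).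
have m2 : measurable_fun D (fun x : T => F x * flux p (vfield u x) (vfield phi x)).
  apply: measurable_funM; first exact F_bounded.1.
  exact (measurable_flux p mdot (vfield_in mu') (vfield_in mphi)).
rewrite /Fv /Fl /Rintegral (ae_eq_integral_real mD m1 m2)//.
(* Truncating [F] at 0 changes nothing almost everywhere on the set where [v] is positive, and the
   zeros of [v] make both integrands 0. *)
move/ae_vdxP : F_ge0; apply: filterS => x H Dx.
rewrite /coef flux_homog ?powR_ge0// powR_invK ?max0//.
rewrite (@flux_wfield R _ T D p p1 v v_ge0)//.
have := v_ge0 Dx; rewrite le_eqVlt => /predU1P[<-|vx]; first by rewrite !mulr0.
by rewrite max_r// H.
Qed.

End coefficient.

Local Notation weak := (weak_solution p v Q Omega).
Local Notation solves_with F t := (solves fin_v Ev Fv fin_Q EQ FQ (tests t) (coef F)).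

Lemma weak_solves F t f g u U : admissible_coef p v Q Omega F t ->
  Lp p v Omega f -> Lp p v Omega g -> weak F t f g u U ->
  solves_with F t (vfield f) (vfield g) (vfield u) (Qfield U).
Proof.
move=> [LF F0 subt] /Lp_fin ff /Lp_fin fg [QH H].
have [[mu' _] QU _] := QH.
split; first exact: (QH0_closure subt QH).
move=> a' b' h' /(testsE subt)[phi qphi [-> _ HB HA]].
rewrite (HB _ (QLp_fin QU)).1 (HA _ fg) FQE (FcE LF F0 mu' (QLip0_Lp qphi).1.1) !FvE.
exact: H.
Qed.

Lemma solves_weak F t f g u U : admissible_coef p v Q Omega F t ->
  measurable_on Omega u -> vmeasurable_on Omega U ->
  solves_with F t (vfield f) (vfield g) (vfield u) (Qfield U) -> weak F t f g u U.
Proof.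
move=> [LF F0 subt] mu' mU [cl H].
split; first exact: (closure_QH0 subt mu' mU cl).
move=> phi qphi; have := H _ _ _ (tests_of subt qphi).
by rewrite FQE (FcE LF F0 mu' (QLip0_Lp qphi).1.1) !FvE.
Qed.

Lemma coef_finite F a : Linfty v Omega F -> fin_v a -> fin_v (coef F a).
Proof. by move=> LF fa; have [K HK] := coef_fin LF; have [] := HK _ fa. Qed.

Lemma coef_energy F : Linfty v Omega F ->
  exists K, forall a, fin_v a -> Ev (coef F a) <= K * Ev a.
Proof.
move=> LF; have [K HK] := coef_fin LF; exists K => a fa.
by have [] := HK _ fa.
Qed.

(** * Consequences of the Sobolev property *)

Section solvability.
Hypothesis sobolev : p_Sobolev p v Q Omega.

Lemma weak_solution_exists F t f g : admissible p v Q Omega F t f g ->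
  exists u U, weak F t f g u U.
Proof.
move=> [adm Lf Lg]; have [LF F0 subt] := adm.
have [K _ HK] := sobolev_energy.1 sobolev; have [C HC] := tests_subunit subt.
have [a [b sol]] := solution_exists p1 vform Qform (@tests_fin t)
  (@tests_comb t) (@tests0 t) (tests_sobolev subt HK) HC (@coef_comb F)
  (fun a => @coef_finite F a LF) (coef_energy LF) (Lp_fin Lf) (Lp_fin Lg).
have [[[[u mu' aE] _] [[U mU bE] _] _] _] := sol.
exists u, U; apply: (solves_weak adm mu' mU).
by rewrite -[vfield u]aE -[Qfield U]bE.
Qed.

Lemma weak_solution_regular F t : admissible_coef p v Q Omega F t ->
  regular p v Q Omega F t.
Proof.
move=> adm; have [LF F0 subt] := adm.
have [K _ HK] := sobolev_energy.1 sobolev; have [C HC] := tests_subunit subt.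
have [B B0 HB] := solution_bound vform Qform (@tests_fin t)
  (tests_sobolev subt HK) HC (@coef_comb F)
  (fun a => @coef_finite F a LF) (coef_energy LF).
have c1 : 0 < 2 * B + 1 by rewrite ltr_wpDl// mulr_ge0.
(* With [s] the sum of the two norms, either energy of the data is at most [s^p], so [B] times their
   sum is at most [2 B s^p]; the 1 keeps the constant positive. *)
exists ((2 * B + 1) `^ p^-1); split; first exact: powR_gt0.
move=> f g u U Lf Lg sol; have [[Lu _ _] _] := sol.
have ff := Lp_fin Lf; have fg := Lp_fin Lg.
have := HB _ _ _ _ ff fg (weak_solves adm Lf Lg sol).
rewrite (Lpnorm_Ev (Lp_fin Lu)) (Lpnorm_Ev ff) (Lpnorm_Ev fg) -EFinD -EFinM lee_fin.
have x0 := venergy_ge0 (vfield u); have y0 := venergy_ge0 (vfield f).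
have z0 := venergy_ge0 (vfield g).
move: (Ev (vfield u)) (Ev (vfield f)) (Ev (vfield g)) x0 y0 z0 => x y z x0 y0 z0 le.
have yr := powR_ge0 y p^-1; have zr := powR_ge0 z p^-1.
set s := _ + _ `^ _; have s0 : 0 <= s by exact: addr_ge0.
rewrite -(powR_Kinv s0); apply/le_root; rewrite ?powR_ge0//.
rewrite powR_invK ?(ltW c1)//; apply: (le_trans le).
have ys : y <= s `^ p.
  by rewrite -{1}(powR_invK y0); apply: le_powR => //; rewrite lerDl.
have zs : z <= s `^ p.
  by rewrite -{1}(powR_invK z0); apply: le_powR => //; rewrite lerDr.
have : B * (y + z) <= B * (s `^ p + s `^ p) by rewrite ler_wpM2l// lerD.
have : 0 <= s `^ p by exact: powR_ge0.
lra.
Qed.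

Lemma weak_solution_unique F t f g u1 U1 u2 U2 : admissible p v Q Omega F t f g ->
  weak F t f g u1 U1 -> weak F t f g u2 U2 -> QH0_eq v Q Omega u1 U1 u2 U2.
Proof.
move=> [adm Lf Lg] sol1 sol2; have [LF F0 subt] := adm.
have [K _ HK] := sobolev_energy.1 sobolev.
have [Ev0 EQ0] := solution_unique p1 vform Qform (@tests_fin t)
  (@tests_comb t) (tests_sobolev subt HK) (@coef_comb F)
  (fun a => @coef_finite F a LF) (coef_energy LF)
  (weak_solves adm Lf Lg sol1) (weak_solves adm Lf Lg sol2).
have [[Lu1 QU1 _] _] := sol1; have [[Lu2 QU2 _] _] := sol2.
have mdot_v := @wfields_dot R _ T D p v mv.
have mdot_Q := @qfields_dot R _ T D n Q mQ Q_psd.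
split.
  apply/ae_vdxP; have := En_eq0 mD mdot_v (form_sub vform (Lp_fin Lu1) (Lp_fin Lu2)) Ev0.
  apply: filterS => x H Dx vx; have := H Dx.
  (* Where [v] is positive its root can be divided out. *)
  rewrite vfieldB => /rowP/(_ 0); rewrite !mxE eqxx mulr1n => /eqP.
  rewrite mulf_eq0 gt_eqF ?powR_gt0//= subr_eq0 => /eqP; exact.
have := En_eq0 mD mdot_Q (form_sub Qform (QLp_fin QU1) (QLp_fin QU2)) EQ0.
apply: filterS => x H Dx; have := H Dx.
by move/eqP; rewrite subr_eq0 => /eqP.
Qed.

End solvability.

(** * From solvability to the Sobolev inequality *)

Lemma Fv0l A : Fv 0 A = 0.
Proof.
rewrite /Fv /Fl /Rintegral (eq_integral (fun=> 0%E)) ?integral0// => x _.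
by rewrite /flux dot0l mulr0.
Qed.

Lemma sobolev_of_dirichlet : p_Dirichlet p v Q Omega -> p_Sobolev p v Q Omega.
Proof.
move=> [ex reg].
have along0 phi : along (fun=> 0) phi = (fun=> 0).
  by apply/funext => x; rewrite /along dot0l.
have L0 : Lp p v Omega (fun=> 0).
  by apply: fin_Lp; [exact: measurable_cst_on|rewrite vfield0; exact: fin_v0].
have Ev00 : Ev 0 = 0 by rewrite /Ev /En /Rintegral -/(energy _ _ _ _) energy0.
have sub0 : subunit p v Q Omega (fun=> 0).
  split; first exact: vmeasurable_cst_on.
  exists 0 => phi qphi; rewrite -/(along _ _) along0 (Lpnorm_Ev (Lp_fin L0)).
  by rewrite vfield0 Ev00 powR0 ?mul0e ?invr_neq0// gt_eqF.
have adm : admissible_coef p v Q Omega (fun=> 0) (fun=> 0).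
  split; last exact: sub0.
    split; first exact: measurable_cst_on.
    by exists 0; apply/ae_vdxP; apply: aeW => x _ _; rewrite normr0.
  by apply/ae_vdxP; apply: aeW.
(* Regularity depends on the coefficients only: [c0] is obtained before any test function is
   considered, which makes the resulting Sobolev constant uniform. *)
have [c0 [c00 Hc]] := reg _ _ adm.
apply/sobolev_energy.
have key a b h : tests (fun=> 0) a b h -> exists a0 b0,
    [/\ in_closure fin_v Ev fin_Q EQ (tests (fun=> 0)) a0 b0,
      Ev a0 <= c0 `^ p * Ev a &
      forall a' b' h', tests (fun=> 0) a' b' h' -> FQ b0 b' = Fv a a'].
  move=> /(testsE sub0)[phi qphi [-> _ _ _]].
  have [Lphi _] := QLip0_Lp qphi; have fphi := Lp_fin Lphi.
  have [u [U sol]] := ex _ _ _ _ (And3 adm Lphi L0).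
  have [[Lu _ _] _] := sol; have fu := Lp_fin Lu.
  have [cl H] := weak_solves adm Lphi L0 sol.
  exists (vfield u), (Qfield U); split; first exact: cl.
    have := Hc _ _ _ _ Lphi L0 sol.
    rewrite (Lpnorm_Ev fu) (Lpnorm_Ev fphi) (Lpnorm_Ev (Lp_fin L0)) vfield0 Ev00.
    rewrite powR0 ?invr_neq0 ?gt_eqF// adde0 -EFinM lee_fin.
    by move/(le_root (venergy_ge0 _) (venergy_ge0 _) (ltW c00)).
  move=> a' b' h' t'; have := H _ _ _ t'.
  have c0' A : coef (fun=> 0) A = 0.
    by apply/funext => x; rewrite /coef maxxx powR0 ?scale0r// invr_neq0// gt_eqF.
  by rewrite !c0' vfield0 !Fv0l !addr0.
have [K K0 HK] := sobolev_of_solutions vform Qform (@tests_fin (fun=> 0)) key.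
by exists K => [|phi qphi]; [exact: K0|exact: HK (tests_of sub0 qphi)].
Qed.

End dirichlet.

Theorem theorem1p5 (R : realType) (n : nat) (n_gt0 : (0 < n)%N)
    (Omega : set 'rV[R]_n) (p : R)
    (v : 'rV[R]_n -> R) (Q : 'rV[R]_n -> 'M[R]_n)
    (Omega_bounded : bounded_set Omega) (Omega_connected : connected Omega)
    (Omega_open : open Omega) (p_gt1 : 1 < p)
    (v_meas : measurable_on Omega v)
    (v_ge0 : forall x, Omega x -> 0 <= v x)
    (Q_meas : forall i j, measurable_on Omega (fun x => Q x i j))
    (Q_psd : forall x, Omega x -> psdmx (Q x))
    (Q_loc : forall K : set 'rV[R]_n, compact K -> K `<=` Omega ->
      (\int[@leb R n]_(x in K) (opnorm (Q x) `^ (p / 2))%:E < +oo)%E) :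
  (p_Dirichlet p v Q Omega <-> p_Sobolev p v Q Omega) /\
  (p_Sobolev p v Q Omega ->
   forall F t f g, admissible p v Q Omega F t f g ->
   forall u1 U1 u2 U2,
     weak_solution p v Q Omega F t f g u1 U1 ->
     weak_solution p v Q Omega F t f g u2 U2 ->
     QH0_eq v Q Omega u1 U1 u2 U2).
Proof.
split=> [|sob F t f g adm u1 U1 u2 U2]; last first.
  exact: (weak_solution_unique Omega_open p_gt1 v_meas v_ge0 Q_meas Q_psd sob adm).
split=> [|sob]; first exact: sobolev_of_dirichlet.
split=> [F t f g|F t].
  exact: (weak_solution_exists Omega_open p_gt1 v_meas v_ge0 Q_meas Q_psd sob).
exact: (weak_solution_regular Omega_open p_gt1 v_meas v_ge0 Q_meas Q_psd sob).
Qed.
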